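(* Let $A$ and $B$ be noetherian rings and let $(A,B,{}_BM_A,{}_AN_B,0,\psi)$ be a Morita context (so $\phi=0$) in which each of the bimodules $_BM_A$ and $_AN_B$ is finitely generated both as a left and as a right module. Let $I:=\mathrm{Im}(\psi)\subseteq A$, and assume that $A$ is the trivial extension $\Lambda\ltimes I$ of a subring $\Lambda$ of $A$ (with the same identity) by $I$. Let $\Lambda_{\psi}=\left(\begin{smallmatrix}A&N\\ M&B\end{smallmatrix}\right)_{(0,\psi)}$ be the associated Morita context ring. (I) The following two sets of conditions are equivalent. (1) ${}_\Lambda N_B$, ${}_BM_\Lambda$ and ${}_\Lambda I_\Lambda$ are weakly compatible bimodules; $({}_AN,0,0,0)$ and $({}_AI,0,0,0)$ are semi-weakly compatible left $\Lambda_\psi$-modules; and $(M_A,0,0,0)$ and $(I_A,0,0,0)$ are semi-weakly compatible right $\Lambda_\psi$-modules. (2) For every finitely generated left $\Lambda_\psi$-module $(X,Y,f,g)$: $(X,Y,f,g)$ is Gorenstein-projective if and only if both of the following hold: (a) ${}_B\mathrm{Coker}(f)$ and ${}_\Lambda\mathrm{Coker}(g)$ are Gorenstein-projective; (b) there are isomorphisms $\mathrm{Im}(f)\simeq M\otimes_A\mathrm{Coker}(g)$ of left $B$-modules, $\mathrm{Im}(g)/IX\simeq N\otimes_B\mathrm{Coker}(f)$ of left $A$-modules, and $IX\simeq I\otimes_A\mathrm{Coker}(g)$ of left $A$-modules. (II) Suppose that ${}_\Lambda N_B$, ${}_BM_\Lambda$ and ${}_\Lambda I_\Lambda$ are weakly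 compatible. If a finitely generated left $\Lambda_\psi$-module $(X,Y,f,g)$ satisfies conditions (a) and (b) of (2), then it is Gorenstein-projective.
   Context: Rings are unital and associative; noetherian means left and right noetherian; all modules are finitely generated, and modules are left modules unless otherwise stated. For a ring $R$, $R\text{-proj}$ is the category of finitely generated projective left $R$-modules. A Morita context $(A,B,{}_BM_A,{}_AN_B,\phi,\psi)$ consists of rings $A,B$, bimodules $_BM_A$, $_AN_B$ and bimodule homomorphisms $\phi:M\otimes_AN\to B$, $\psi:N\otimes_BM\to A$ with $\psi(n\otimes m)n'=n\phi(m\otimes n')$ and $\phi(m\otimes n)m'=m\psi(n\otimes m')$. Its Morita context ring $\Lambda_{(\phi,\psi)}$ is the set of matrices $\left(\begin{smallmatrix}a&n\\ m&b\end{smallmatrix}\right)$ with multiplication $\left(\begin{smallmatrix}a&n\\ m&b\end{smallmatrix}\right)\left(\begin{smallmatrix}a'&n'\\ m'&b'\end{smallmatrix}\right)=\left(\begin{smallmatrix}aa'+\psi(n\otimes m')&an'+nb'\\ ma'+bm'&\phi(m\otimes n')+bb'\end{smallmatrix}\right)$; $\Lambda_\psi:=\Lambda_{(0,\psi)}$. A left $\Lambda_{(\phi,\psi)}$-module is a quadruple $(X,Y,f,g)$ with $X$ a left $A$-module, $Y$ a left $B$-module, $f:M\otimes_AX\to Y$ a $B$-homomorphism and $g:N\otimes_BY\to X$ an $A$-homomorphism such that $g(n\otimes f(m\otimes x))=\psi(n\otimes m)x$ and $f(m\otimes g(n\otimes y))=\phi(m\otimes n)y$. A right $\Lambda_{(\phi,\psi)}$-module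 is similarly a quadruple $(C_A,D_B,h,k)$ with $h:C\otimes_AN\to D$ a right $B$-homomorphism and $k:D\otimes_BM\to C$ a right $A$-homomorphism satisfying the analogous compatibilities. When $\phi=0$, one has $IN=0$, $MI=0$, $I^2=0$ and $I\,\mathrm{Coker}(g)=0$, $IX\subseteq\mathrm{Im}(g)$ for every $\Lambda_\psi$-module $(X,Y,f,g)$. Thus $(N,0,0,0)$, $(I,0,0,0)$ are left and $(M,0,0,0)$, $(I,0,0,0)$ are right $\Lambda_\psi$-modules. ''$A=\Lambda\ltimes I$ is the trivial extension'' means $A=\Lambda\oplus I$ with $(\lambda,x)(\lambda',x')=(\lambda\lambda',\lambda x'+x\lambda')$; $A$-modules restrict to $\Lambda$-modules along $\Lambda\subseteq A$, and $\Lambda\simeq A/I$. A complex $P^\bullet$ of left $R$-modules is totally exact if it is exact and $\mathrm{Hom}_R(P^\bullet,R)$ is exact. A left $R$-module $X$ is Gorenstein-projective if $X=\mathrm{Ker}(d_P^0)$ for some totally exact complex $P^\bullet$ of projective left $R$-modules. A left $R$-module $X$ is semi-weakly compatible if $\mathrm{Hom}_R(P^\bullet,X)$ is exact for every totally exact complex $P^\bullet$ with terms in $R\text{-proj}$. A right $R$-module $Y$ is semi-weakly compatible if $Y\otimes_RQ^\bullet$ is exact for every totally exact complex $Q^\bullet$ with terms in $R\text{-proj}$. A bimodule ${}_RU_S$ is weakly compatible if ${}_RU$ and $U_S$ are both semi-weakly compatible. *)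

(* Defs.v *)
From HB Require Import structures.
From mathcomp Require Import all_boot all_algebra.
From mathcomp Require Import boolp.

Set Implicit Arguments.
Unset Strict Implicit.
Unset Printing Implicit Defensive.

Import GRing.Theory.
Local Open Scope ring_scope.
Local Open Scope quotient_scope.

(* Conventions.  Rings are [pzRingType] (unital, associative, possibly zero). *)
(* Left R-modules are [lmodType R]; right R-modules are [lmodType R^c], so    *)
(* that [(r : R^c) *: c] is the product of c by r on the right.               *)

(* [submodClosed] is stated over semirings, so closure under opposites has to *)
(* be added by hand before quotienting.                                       *)
Definition submod_pred (R : pzRingType) (V : lmodType R) (S : submodClosed V) :
  {pred V} := fun v => v \in S.

Record submod (R : pzRingType) (V : lmodType R) (S : submodClosed V) : Type :=
  Submod { submod_val : V; submod_valP : submod_pred S submod_val }.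

Section SubmodTheory.
Variables (R : pzRingType) (V : lmodType R) (S : submodClosed V).

Fact submod_closedP : submod_closed (submod_pred S).
Proof.
split=> [|a u v Su Sv]; first exact: (rpred0 S).
have Su' : u \in S by []. have Sv' : v \in S by [].
by change (a *: u + v \in S); rewrite rpredD ?rpredZ.
Qed.

HB.instance Definition _ :=
  GRing.isSubmodClosed.Build R V (submod_pred S) submod_closedP.

HB.instance Definition _ := [isSub for @submod_val R V S].
HB.instance Definition _ := [Choice of submod S by <:].
HB.instance Definition _ :=
  GRing.SubChoice_isSubLmodule.Build R V (submod_pred S) (submod S) submod_closedP.
End SubmodTheory.

Definition quotmod (R : pzRingType) (V : lmodType R) (S : submodClosed V) :
  Type := Quotient.quot (submod_pred S).

Section QuotmodTheory.
Variables (R : pzRingType) (V : lmodType R) (S : submodClosed V).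

HB.instance Definition _ := GRing.Zmodule.on (quotmod S).

Definition quot_pi (v : V) : quotmod S := \pi_(Quotient.quot (submod_pred S)) v.

Definition quot_scale (a : R) (q : quotmod S) : quotmod S :=
  quot_pi (a *: repr (q : Quotient.quot (submod_pred S))).

Fact quot_piP (u v : V) : (quot_pi u == quot_pi v) = (u - v \in S).
Proof. by rewrite /quot_pi -Quotient.idealrBE. Qed.

Fact quot_reprK (q : quotmod S) :
  quot_pi (repr (q : Quotient.quot (submod_pred S))) = q.
Proof. exact: (@reprK _ (Quotient.quot (submod_pred S))). Qed.

Fact quot_piD : {morph quot_pi : u v / u + v}.
Proof. exact: (raddfD \pi_(Quotient.quot (submod_pred S))). Qed.

Fact quot_scale_pi a v : quot_scale a (quot_pi v) = quot_pi (a *: v).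
Proof.
apply/eqP; rewrite quot_piP -scalerBr rpredZ // -quot_piP.
by rewrite quot_reprK.
Qed.

Fact quot_scalerA a b q : quot_scale a (quot_scale b q) = quot_scale (a * b) q.
Proof. by rewrite -[q]quot_reprK !quot_scale_pi scalerA. Qed.
Fact quot_scale1r : left_id 1 quot_scale.
Proof. by move=> q; rewrite -[q]quot_reprK quot_scale_pi scale1r. Qed.
Fact quot_scalerDr : right_distributive quot_scale +%R.
Proof.
move=> a p q; rewrite -[p]quot_reprK -[q]quot_reprK.
by rewrite -quot_piD !quot_scale_pi scalerDr quot_piD.
Qed.
Fact quot_scalerDl q : {morph quot_scale^~ q : a b / a + b}.
Proof.
by move=> a b; rewrite -[q]quot_reprK !quot_scale_pi scalerDl quot_piD.
Qed.

HB.instance Definition _ := GRing.Zmodule_isLmodule.Build R (quotmod S)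
  quot_scalerA quot_scale1r quot_scalerDr quot_scalerDl.
End QuotmodTheory.

Section KerImCoker.
Variables (R : pzRingType) (U V : lmodType R) (f : {linear U -> V}).

Definition ker_pred : {pred U} := fun u => f u == 0.
Definition im_pred : {pred V} := fun v => `[< exists u, f u = v >].

Fact ker_closed : submod_closed ker_pred.
Proof.
split=> [|a u v]; rewrite !unfold_in ?raddf0 // => /eqP fu /eqP fv.
by rewrite linearP fu fv scaler0 addr0.
Qed.
HB.instance Definition _ := GRing.isSubmodClosed.Build R U ker_pred ker_closed.

Fact im_closed : submod_closed im_pred.
Proof.
split=> [|a u v]; rewrite !unfold_in; first by apply/asboolP; exists 0; rewrite raddf0.
move=> /asboolP[x <-] /asboolP[y <-]; apply/asboolP.
by exists (a *: x + y); rewrite linearP.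
Qed.
HB.instance Definition _ := GRing.isSubmodClosed.Build R V im_pred im_closed.

Definition kermod : lmodType R := submod ker_pred.
Definition immod : lmodType R := submod im_pred.
Definition coker : lmodType R := quotmod im_pred.
End KerImCoker.

(* [relquot S T] is S / (S :&: T), that is S / T when T is contained in S. *)
Section RelativeQuotient.
Variables (R : pzRingType) (V : lmodType R) (S T : submodClosed V).

Definition relquot_pred : {pred submod S} := fun v => val v \in T.
Fact relquot_closed : submod_closed relquot_pred.
Proof.
split=> [|a u v Tu Tv]; first exact: (rpred0 T).
have Tu' : val u \in T by []. have Tv' : val v \in T by [].
by change (a *: val u + val v \in T); rewrite rpredD ?rpredZ.
Qed.
HB.instance Definition _ :=
  GRing.isSubmodClosed.Build R (submod S) relquot_pred relquot_closed.
Definition relquot : lmodType R := quotmod relquot_pred.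
End RelativeQuotient.

Definition lin_iso (R : pzRingType) (U V : lmodType R) : Prop :=
  exists h : {linear U -> V}, bijective h.

Definition fin_gen (R : pzRingType) (V : lmodType R) : Prop :=
  exists (n : nat) (e : 'I_n -> V),
    forall v, exists c : 'I_n -> R, v = \sum_(i < n) c i *: e i.

(* Left ideals of R are the submodules of R^o. *)
Definition left_noetherian (R : pzRingType) : Prop :=
  forall J : submodClosed R^o, fin_gen (submod J).

Definition noetherian (R : pzRingType) : Prop :=
  left_noetherian R /\ left_noetherian R^c.

Definition projective (R : pzRingType) (P : lmodType R) : Prop :=
  forall (U V : lmodType R) (p : {linear U -> V}) (f : {linear P -> V}),
    (forall v, exists u, p u = v) ->
    exists g : {linear P -> U}, forall x, p (g x) = f x.

Definition in_proj (R : pzRingType) (P : lmodType R) : Prop :=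
  projective P /\ fin_gen P.

Definition balanced (R : pzRingType) (C : lmodType R^c) (X : lmodType R)
    (Z : zmodType) (b : C -> X -> Z) : Prop :=
  [/\ forall x, {morph b^~ x : c c' / c + c'},
      forall c, {morph b c : x x' / x + x'}
    & forall c (r : R) x, b ((r : R^c) *: c) x = b c (r *: x)].

Definition word_sum (C X : Type) (Z : zmodType) (b : C -> X -> Z)
  (s : seq (C * X)) : Z := \sum_(p <- s) b p.1 p.2.

(* A word of pairs (c, x) stands for the sum of the simple tensors c (x) x;   *)
(* two words are identified when no balanced map separates them.  The result  *)
(* has the universal property of the tensor product: see [tlift_tmul] and     *)
(* [tens_ext] below.                                                          *)
Section Tensor.
Variables (R : pzRingType) (C : lmodType R^c) (X : lmodType R).

Definition word_eqv (s t : seq (C * X)) : bool :=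
  `[< forall (Z : zmodType) (b : C -> X -> Z),
        balanced b -> word_sum b s = word_sum b t >].

Fact word_eqv_equiv : equiv_class_of word_eqv.
Proof.
split=> [s|s t|t s u].
- by apply/asboolP.
- by apply/asboolP/asboolP => + Z b bb => ->.
- by move=> /asboolP st /asboolP tu; apply/asboolP=> Z b bb; rewrite st ?tu.
Qed.
Canonical word_eqv_equivRel := EquivRelPack word_eqv_equiv.
Canonical word_eqv_encModRel := defaultEncModRel word_eqv.

Definition tens : Type := {eq_quot word_eqv}.
HB.instance Definition _ := Choice.on tens.
HB.instance Definition _ := EqQuotient.on tens.

Definition tpi (s : seq (C * X)) : tens := \pi_tens s.

Fact tpiP s t : tpi s = tpi t <->
  forall (Z : zmodType) (b : C -> X -> Z),
    balanced b -> word_sum b s = word_sum b t.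
Proof.
by split=> [/eqquotP/asboolP //|st]; apply/eqquotP/asboolP.
Qed.

Fact tpiK (t : tens) : tpi (repr t) = t.
Proof. exact: reprK. Qed.

Definition word_opp (s : seq (C * X)) := [seq (- p.1, p.2) | p <- s].

Fact word_sum_cat (Z : zmodType) (b : C -> X -> Z) s t :
  word_sum b (s ++ t) = word_sum b s + word_sum b t.
Proof. exact: big_cat. Qed.

Fact balanced0l (Z : zmodType) (b : C -> X -> Z) x : balanced b -> b 0 x = 0.
Proof. by case=> bl _ _; apply: (addIr (b 0 x)); rewrite -bl !add0r. Qed.

Fact word_sum_opp (Z : zmodType) (b : C -> X -> Z) s :
  balanced b -> word_sum b (word_opp s) = - word_sum b s.
Proof.
move=> bb; rewrite /word_sum big_map -sumrN; apply: eq_bigr => -[c x] _ /=.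
apply: (addIr (b c x)); rewrite addNr.
by case: (bb) => bl _ _; rewrite -bl addNr (balanced0l _ bb).
Qed.

Definition tadd (s t : tens) : tens := tpi (repr s ++ repr t).
Definition topp (s : tens) : tens := tpi (word_opp (repr s)).

Fact tadd_pi s t : tadd (tpi s) (tpi t) = tpi (s ++ t).
Proof.
apply/tpiP => Z b bb; rewrite !word_sum_cat.
by congr (_ + _); move: Z b bb; apply/tpiP; rewrite tpiK.
Qed.
Fact topp_pi s : topp (tpi s) = tpi (word_opp s).
Proof.
apply/tpiP => Z b bb; rewrite !word_sum_opp //; congr (- _).
by move: Z b bb; apply/tpiP; rewrite tpiK.
Qed.

Fact taddA : associative tadd.
Proof.
move=> s t u; rewrite -[s]tpiK -[t]tpiK -[u]tpiK.
by rewrite !tadd_pi catA.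
Qed.
Fact taddC : commutative tadd.
Proof.
move=> s t; rewrite -[s]tpiK -[t]tpiK !tadd_pi.
by apply/tpiP => Z b bb; rewrite !word_sum_cat addrC.
Qed.
Fact tadd0 : left_id (tpi [::]) tadd.
Proof. by move=> s; rewrite -[s]tpiK tadd_pi. Qed.
Fact taddN : left_inverse (tpi [::]) topp tadd.
Proof.
move=> s; rewrite -[s]tpiK topp_pi tadd_pi; apply/tpiP => Z b bb.
by rewrite word_sum_cat word_sum_opp // addNr /word_sum big_nil.
Qed.
HB.instance Definition _ := GRing.isZmodule.Build tens taddA taddC tadd0 taddN.

Definition tmul (c : C) (x : X) : tens := tpi [:: (c, x)].

Fact tpi_cat s t : tpi (s ++ t) = tpi s + tpi t.
Proof. by rewrite -[LHS]tadd_pi. Qed.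

Fact tpiE s : tpi s = word_sum tmul s.
Proof.
elim: s => [|[c x] s IHs]; first by rewrite /word_sum big_nil.
by rewrite -cat1s tpi_cat IHs word_sum_cat {2}/word_sum big_seq1.
Qed.

Lemma tmul_balanced : balanced tmul.
Proof.
split=> [x c c'|c x x'|c r x]; rewrite -?tpi_cat; apply/tpiP => Z b [bl br bm];
  by rewrite /word_sum !big_cons !big_nil /= ?addr0 ?bl ?br ?bm.
Qed.

(* Meaningful when b is balanced. *)
Definition tlift (Z : zmodType) (b : C -> X -> Z) (t : tens) : Z :=
  word_sum b (repr t).

Fact tlift_pi (Z : zmodType) (b : C -> X -> Z) s :
  balanced b -> tlift b (tpi s) = word_sum b s.
Proof. by move: Z b; apply/tpiP; rewrite tpiK. Qed.

Lemma tlift_tmul (Z : zmodType) (b : C -> X -> Z) :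
  balanced b -> forall c x, tlift b (tmul c x) = b c x.
Proof. by move=> bb c x; rewrite tlift_pi // /word_sum big_seq1. Qed.

Lemma tliftD (Z : zmodType) (b : C -> X -> Z) :
  balanced b -> {morph tlift b : s t / s + t}.
Proof.
move=> bb s t; rewrite -[s]tpiK -[t]tpiK -tpi_cat !tlift_pi //.
exact: word_sum_cat.
Qed.

Lemma tens_ind (P : tens -> Prop) :
  P 0 -> (forall s t, P s -> P t -> P (s + t)) ->
  (forall c x, P (tmul c x)) -> forall t, P t.
Proof.
move=> P0 PD PM t; rewrite -[t]tpiK tpiE /word_sum.
by elim/big_rec: _ => // -[c x] u _ Pu; apply: PD.
Qed.

Fact tmorph0 (Z : zmodType) (f : tens -> Z) :
  {morph f : s t / s + t} -> f 0 = 0.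
Proof. by move=> fD; apply: (addIr (f 0)); rewrite -fD !add0r. Qed.

Lemma tens_ext (Z : zmodType) (f g : tens -> Z) :
  {morph f : s t / s + t} -> {morph g : s t / s + t} ->
  (forall c x, f (tmul c x) = g (tmul c x)) -> f =1 g.
Proof.
move=> fD gD fg t; elim/tens_ind: t => [|s t fs ft|c x]; last exact: fg.
- by rewrite !tmorph0.
- by rewrite fD gD fs ft.
Qed.
End Tensor.

Notation "c \ot x" := (tmul c x) (at level 40, left associativity).

Section TensorMap.
Variables (R : pzRingType).

Definition tens_map (C C' : lmodType R^c) (X X' : lmodType R)
    (f : C -> C') (g : X -> X') : tens C X -> tens C' X' :=
  tlift (fun c x => f c \ot g x).

Variables (C C' : lmodType R^c) (X X' : lmodType R).
Variables (f : {linear C -> C'}) (g : {linear X -> X'}).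

Fact tens_map_balanced : balanced (fun c x => f c \ot g x).
Proof.
case: (tmul_balanced C' X') => bl br bm.
by split=> [x c c'|c x x'|c r x]; rewrite ?linearD ?linearZ /= ?bl ?br ?bm.
Qed.

Lemma tens_mapD : {morph tens_map f g : s t / s + t}.
Proof. exact: tliftD tens_map_balanced. Qed.

Lemma tens_map_tmul c x : tens_map f g (c \ot x) = f c \ot g x.
Proof. exact: tlift_tmul tens_map_balanced _ _. Qed.
End TensorMap.

HB.mixin Record Lmodule_isBimodule (R S : pzRingType) (M : Type)
    of GRing.Lmodule R M := {
  rscale : M -> S -> M;
  rscalerA : forall m s t, rscale (rscale m s) t = rscale m (s * t);
  rscaler1 : forall m, rscale m 1 = m;
  rscalerDl : forall s, {morph rscale^~ s : m n / m + n};
  rscalerDr : forall m, {morph rscale m : s t / s + t};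
  rscalerAl : forall (r : R) m s, rscale (r *: m) s = r *: rscale m s
}.

#[short(type="bimodType")]
HB.structure Definition Bimodule (R S : pzRingType) :=
  {M of GRing.Lmodule R M & Lmodule_isBimodule R S M}.

Notation "m <* s" := (rscale m s) (at level 40, left associativity).

Definition rmod (R S : pzRingType) (M : bimodType R S) : Type := M.

Section RightModule.
Variables (R S : pzRingType) (M : bimodType R S).
HB.instance Definition _ := GRing.Zmodule.on (rmod M).

Definition rmod_scale (s : S^c) (m : rmod M) : rmod M := (m : M) <* s.

Fact rmod_scalerA s t m : rmod_scale s (rmod_scale t m) = rmod_scale (s * t) m.
Proof. exact: rscalerA. Qed.
Fact rmod_scale1r : left_id 1 rmod_scale.
Proof. exact: rscaler1. Qed.
Fact rmod_scalerDr : right_distributive rmod_scale +%R.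
Proof. by move=> s m n; apply: rscalerDl. Qed.
Fact rmod_scalerDl m : {morph rmod_scale^~ m : s t / s + t}.
Proof. by move=> s t; exact: (rscalerDr (m : M) s t). Qed.
HB.instance Definition _ := GRing.Zmodule_isLmodule.Build S^c (rmod M)
  rmod_scalerA rmod_scale1r rmod_scalerDr rmod_scalerDl.
End RightModule.

(* M (x)_S X as a left R-module, for M an R-S-bimodule. *)
Definition ltens (R S : pzRingType) (M : bimodType R S) (X : lmodType S) :
  Type := tens (rmod M) X.

Section LeftTensor.
Variables (R S : pzRingType) (M : bimodType R S) (X : lmodType S).
HB.instance Definition _ := GRing.Zmodule.on (ltens M X).

Section Scale.
Variable r : R.
Definition lscale_fun (m : rmod M) : rmod M := r *: (m : M).
Fact lscale_fun_linear : linear lscale_fun.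
Proof.
move=> s m n; rewrite /lscale_fun (scalerDr (s := M)); congr (_ + _).
by symmetry; apply: (rscalerAl r (m : M) s).
Qed.
HB.instance Definition _ := GRing.isLinear.Build S^c (rmod M) (rmod M) _
  lscale_fun lscale_fun_linear.
End Scale.

Definition ltens_scale (r : R) (t : ltens M X) : ltens M X :=
  tens_map (lscale_fun r) idfun t.

Fact ltens_scaleD r : {morph ltens_scale r : s t / s + t}.
Proof. exact: tens_mapD. Qed.
Fact ltens_scale_tmul r (m : M) x :
  ltens_scale r ((m : rmod M) \ot x) = ((r *: m : M) : rmod M) \ot x.
Proof. exact: tens_map_tmul. Qed.

Fact ltens_scalerA a b t :
  ltens_scale a (ltens_scale b t) = ltens_scale (a * b) t.
Proof.
elim/tens_ind: t => [|s t IHs IHt|m x].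
- by rewrite !(tmorph0 (@ltens_scaleD _)).
- by rewrite !ltens_scaleD IHs IHt.
- by rewrite !ltens_scale_tmul scalerA.
Qed.
Fact ltens_scale1r : left_id 1 ltens_scale.
Proof.
elim/tens_ind => [|s t IHs IHt|m x].
- by rewrite (tmorph0 (@ltens_scaleD _)).
- by rewrite ltens_scaleD IHs IHt.
- by rewrite ltens_scale_tmul scale1r.
Qed.
Fact ltens_scalerDr : right_distributive ltens_scale +%R.
Proof. by move=> r; apply: ltens_scaleD. Qed.
Fact ltens_scalerDl t : {morph ltens_scale^~ t : a b / a + b}.
Proof.
move=> a b; elim/tens_ind: t => [|s t IHs IHt|m x].
- by rewrite !(tmorph0 (@ltens_scaleD _)) addr0.
- by rewrite !ltens_scaleD IHs IHt addrACA.
- by rewrite !ltens_scale_tmul scalerDl; case: (tmul_balanced (rmod M) X) => ->.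
Qed.
HB.instance Definition _ := GRing.Zmodule_isLmodule.Build R (ltens M X)
  ltens_scalerA ltens_scale1r ltens_scalerDr ltens_scalerDl.
End LeftTensor.

(* C (x)_R N as a right S-module, for N an R-S-bimodule. *)
Definition rtens (R S : pzRingType) (C : lmodType R^c) (N : bimodType R S) :
  Type := tens C N.

Section RightTensor.
Variables (R S : pzRingType) (C : lmodType R^c) (N : bimodType R S).
HB.instance Definition _ := GRing.Zmodule.on (rtens C N).

Section Scale.
Variable s : S.
Definition rscale_fun (n : N) : N := n <* s.
Fact rscale_fun_linear : linear rscale_fun.
Proof. by move=> r m n; rewrite /rscale_fun rscalerDl rscalerAl. Qed.
HB.instance Definition _ := GRing.isLinear.Build R N N _
  rscale_fun rscale_fun_linear.
End Scale.

Definition rtens_scale (s : S^c) (t : rtens C N) : rtens C N :=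
  tens_map idfun (rscale_fun s) t.

Fact rtens_scaleD s : {morph rtens_scale s : t u / t + u}.
Proof. exact: tens_mapD. Qed.
Fact rtens_scale_tmul (s : S) c (n : N) : rtens_scale s (c \ot n) = c \ot (n <* s).
Proof. exact: tens_map_tmul. Qed.

Fact rtens_scalerA a b t :
  rtens_scale a (rtens_scale b t) = rtens_scale (a * b) t.
Proof.
elim/tens_ind: t => [|s t IHs IHt|c n].
- by rewrite !(tmorph0 (@rtens_scaleD _)).
- by rewrite !rtens_scaleD IHs IHt.
- by rewrite !rtens_scale_tmul rscalerA.
Qed.
Fact rtens_scale1r : left_id 1 rtens_scale.
Proof.
elim/tens_ind => [|s t IHs IHt|c n].
- by rewrite (tmorph0 (@rtens_scaleD _)).
- by rewrite rtens_scaleD IHs IHt.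
- by rewrite rtens_scale_tmul rscaler1.
Qed.
Fact rtens_scalerDr : right_distributive rtens_scale +%R.
Proof. by move=> r; apply: rtens_scaleD. Qed.
Fact rtens_scalerDl t : {morph rtens_scale^~ t : a b / a + b}.
Proof.
move=> a b; elim/tens_ind: t => [|s t IHs IHt|c n].
- by rewrite !(tmorph0 (@rtens_scaleD _)) addr0.
- by rewrite !rtens_scaleD IHs IHt addrACA.
- by rewrite !rtens_scale_tmul rscalerDr; case: (tmul_balanced C N) => _ ->.
Qed.
HB.instance Definition _ := GRing.Zmodule_isLmodule.Build S^c (rtens C N)
  rtens_scalerA rtens_scale1r rtens_scalerDr rtens_scalerDl.
End RightTensor.

Definition restr (R S : pzRingType) (f : {rmorphism R -> S}) (V : lmodType S) :
  Type := V.

Section Restriction.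
Variables (R S : pzRingType) (f : {rmorphism R -> S}) (V : lmodType S).
HB.instance Definition _ := GRing.Zmodule.on (restr f V).
Definition restr_scale (r : R) (v : restr f V) : restr f V := f r *: (v : V).
Fact restr_scalerA a b v : restr_scale a (restr_scale b v) = restr_scale (a * b) v.
Proof. by rewrite /restr_scale scalerA rmorphM. Qed.
Fact restr_scale1r : left_id 1 restr_scale.
Proof. by move=> v; rewrite /restr_scale rmorph1 scale1r. Qed.
Fact restr_scalerDr : right_distributive restr_scale +%R.
Proof. by move=> a u v; rewrite /restr_scale (scalerDr (s := V)). Qed.
Fact restr_scalerDl v : {morph restr_scale^~ v : a b / a + b}.
Proof. by move=> a b; rewrite /restr_scale rmorphD (scalerDl (s := V)). Qed.
HB.instance Definition _ := GRing.Zmodule_isLmodule.Build R (restr f V)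
  restr_scalerA restr_scale1r restr_scalerDr restr_scalerDl.
End Restriction.

Definition restrl (R S T : pzRingType) (f : {rmorphism R -> S})
  (M : bimodType S T) : Type := restr f M.
Definition restrr (R S T : pzRingType) (f : {rmorphism R -> S})
  (M : bimodType T S) : Type := M.

Section LeftRestriction.
Variables (R S T : pzRingType) (f : {rmorphism R -> S}) (M : bimodType S T).
HB.instance Definition _ := GRing.Lmodule.on (restrl f M).
Fact restrl_rscalerAl (r : R) (m : restrl f M) (t : T) :
  ((r *: m : restrl f M) : M) <* t = r *: ((m : M) <* t : restrl f M) :> M.
Proof. exact: rscalerAl. Qed.
HB.instance Definition _ := Lmodule_isBimodule.Build R T (restrl f M)
  (@rscalerA _ _ M) (@rscaler1 _ _ M) (@rscalerDl _ _ M) (@rscalerDr _ _ M)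
  restrl_rscalerAl.
End LeftRestriction.

Section RightRestriction.
Variables (R S T : pzRingType) (f : {rmorphism R -> S}) (M : bimodType T S).
HB.instance Definition _ := GRing.Lmodule.on (restrr f M).
Definition restrr_rscale (m : restrr f M) (r : R) : restrr f M := (m : M) <* f r.
Fact restrr_rscalerA m a b :
  restrr_rscale (restrr_rscale m a) b = restrr_rscale m (a * b).
Proof. by rewrite /restrr_rscale rscalerA rmorphM. Qed.
Fact restrr_rscaler1 m : restrr_rscale m 1 = m.
Proof. by rewrite /restrr_rscale rmorph1 rscaler1. Qed.
Fact restrr_rscalerDl a : {morph restrr_rscale^~ a : m n / m + n}.
Proof. by move=> m n; apply: rscalerDl. Qed.
Fact restrr_rscalerDr m : {morph restrr_rscale m : a b / a + b}.
Proof. by move=> a b; rewrite /restrr_rscale rmorphD rscalerDr. Qed.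
Fact restrr_rscalerAl (t : T) m a :
  restrr_rscale (t *: m) a = t *: restrr_rscale m a.
Proof. exact: rscalerAl. Qed.
HB.instance Definition _ := Lmodule_isBimodule.Build T R (restrr f M)
  restrr_rscalerA restrr_rscaler1 restrr_rscalerDl restrr_rscalerDr
  restrr_rscalerAl.
End RightRestriction.

(* Every index is of the form i + 1, so that exactness at all the terms       *)
(* P (i + 1) is exactness everywhere.                                         *)
Record complex (R : pzRingType) := Complex {
  cx_obj :> int -> lmodType R;
  cx_d : forall i : int, {linear cx_obj i -> cx_obj (i + 1)};
  cx_dd : forall (i : int) x, cx_d (i + 1) (cx_d i x) = 0 }.

Section Complexes.
Variables (R : pzRingType) (P : complex R).

Definition exact_cx : Prop :=
  forall (i : int) (y : P (i + 1)),
    cx_d P (i + 1) y = 0 <-> exists x, cx_d P i x = y.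

(* Exactness of Hom_R(P, X), unfolded: kernel = image at Hom_R(P (i + 1), X). *)
Definition hom_exact (X : lmodType R) : Prop :=
  forall (i : int) (u : {linear P (i + 1) -> X}),
    (forall x, u (cx_d P i x) = 0) <->
    exists v : {linear P (i + 1 + 1) -> X},
      forall y, u y = v (cx_d P (i + 1) y).

Definition tens_exact (Y : lmodType R^c) : Prop :=
  forall (i : int) (t : tens Y (P (i + 1))),
    tens_map (C' := Y) idfun (cx_d P (i + 1)) t = 0 <->
    exists s : tens Y (P i), tens_map (C' := Y) idfun (cx_d P i) s = t.

Definition totally_exact : Prop := exact_cx /\ hom_exact R^o.

Definition terms_in_proj : Prop := forall i, in_proj (P i).
End Complexes.

(* As all modules are finitely generated, so are the terms of the complex.    *)
Definition gorenstein_projective (R : pzRingType) (X : lmodType R) : Prop :=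
  exists P : complex R,
    [/\ terms_in_proj P, totally_exact P & lin_iso X (kermod (cx_d P 0))].

Definition semi_weakly_compatible (R : pzRingType) (X : lmodType R) : Prop :=
  forall P : complex R, terms_in_proj P -> totally_exact P -> hom_exact P X.

Definition semi_weakly_compatible_r (R : pzRingType) (Y : lmodType R^c) : Prop :=
  forall Q : complex R, terms_in_proj Q -> totally_exact Q -> tens_exact Q Y.

Definition weakly_compatible (R S : pzRingType) (U : bimodType R S) : Prop :=
  semi_weakly_compatible U /\ semi_weakly_compatible_r (rmod U).

Record moritaContext (A B : pzRingType) (M : bimodType B A) (N : bimodType A B) :=
  MoritaContext {
    phi : {additive tens (rmod M) N -> B};
    psi : {additive tens (rmod N) M -> A};
    phi_l : forall (b : B) (t : ltens M N), phi (b *: t) = b * phi t;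
    phi_r : forall (b : B) (t : rtens (rmod M) N),
      phi ((b : B^c) *: t) = phi t * b;
    psi_l : forall (a : A) (t : ltens N M), psi (a *: t) = a * psi t;
    psi_r : forall (a : A) (t : rtens (rmod N) M),
      psi ((a : A^c) *: t) = psi t * a;
    psi_phi : forall (n : N) (m : M) (n' : N),
      psi ((n : rmod N) \ot m) *: n' = n <* phi ((m : rmod M) \ot n');
    phi_psi : forall (m : M) (n : N) (m' : M),
      phi ((m : rmod M) \ot n) *: m' = m <* psi ((n : rmod N) \ot m') }.

(* ((a, n), (m, b)) is the matrix with rows (a, n) and (m, b). *)
Definition mring (A B : pzRingType) (M : bimodType B A) (N : bimodType A B)
  (mc : moritaContext M N) : Type := ((A * N) * (M * B))%type.

Section Morita.
Variables (A B : pzRingType) (M : bimodType B A) (N : bimodType A B).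
Variable mc : moritaContext M N.

Definition phim (m : M) (n : N) : B := phi mc ((m : rmod M) \ot n).
Definition psim (n : N) (m : M) : A := psi mc ((n : rmod N) \ot m).

Fact psimDl n n' m : psim (n + n') m = psim n m + psim n' m.
Proof.
rewrite /psim -raddfD; congr (psi mc _).
by case: (tmul_balanced (rmod N) M) => -> _ _.
Qed.
Fact psimDr n m m' : psim n (m + m') = psim n m + psim n m'.
Proof.
rewrite /psim -raddfD; congr (psi mc _).
by case: (tmul_balanced (rmod N) M) => _ -> _.
Qed.
Fact phimDl m m' n : phim (m + m') n = phim m n + phim m' n.
Proof.
rewrite /phim -raddfD; congr (phi mc _).
by case: (tmul_balanced (rmod M) N) => -> _ _.
Qed.
Fact phimDr m n n' : phim m (n + n') = phim m n + phim m n'.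
Proof.
rewrite /phim -raddfD; congr (phi mc _).
by case: (tmul_balanced (rmod M) N) => _ -> _.
Qed.
Fact psimZl a n m : psim (a *: n) m = a * psim n m.
Proof.
by rewrite /psim -psi_l; congr (psi mc _); rewrite -[LHS]ltens_scale_tmul.
Qed.
Fact phimZl b m n : phim (b *: m) n = b * phim m n.
Proof.
by rewrite /phim -phi_l; congr (phi mc _); rewrite -[LHS]ltens_scale_tmul.
Qed.
Fact psimZr n m a : psim n (m <* a) = psim n m * a.
Proof.
by rewrite /psim -psi_r; congr (psi mc _); rewrite -[LHS]rtens_scale_tmul.
Qed.
Fact phimZr m n b : phim m (n <* b) = phim m n * b.
Proof.
by rewrite /phim -phi_r; congr (phi mc _); rewrite -[LHS]rtens_scale_tmul.
Qed.
Fact psim_mid n b m : psim (n <* b) m = psim n (b *: m).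
Proof.
rewrite /psim; congr (psi mc _).
by case: (tmul_balanced (rmod N) M) => _ _ <-.
Qed.
Fact phim_mid m a n : phim (m <* a) n = phim m (a *: n).
Proof.
rewrite /phim; congr (phi mc _).
by case: (tmul_balanced (rmod M) N) => _ _ <-.
Qed.

Local Notation mring := (mring mc).
HB.instance Definition _ := GRing.Zmodule.on mring.

Definition mring_one : mring := ((1, 0), (0, 1)).
Definition mring_mul (x y : mring) : mring :=
  let: ((a, n), (m, b)) := x in let: ((a', n'), (m', b')) := y in
  ((a * a' + psim n m', a *: n' + n <* b'),
   (m <* a' + b *: m', phim m n' + b * b')).

Fact rscale0l (R S : pzRingType) (U : bimodType R S) (s : S) : (0 : U) <* s = 0.
Proof. by apply: (addIr ((0 : U) <* s)); rewrite -rscalerDl !add0r. Qed.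
Fact rscale0r (R S : pzRingType) (U : bimodType R S) (u : U) : u <* (0 : S) = 0.
Proof. by apply: (addIr (u <* 0)); rewrite -rscalerDr !add0r. Qed.
Fact psim0l m : psim 0 m = 0.
Proof. by apply: (addIr (psim 0 m)); rewrite -psimDl !add0r. Qed.
Fact psim0r n : psim n 0 = 0.
Proof. by apply: (addIr (psim n 0)); rewrite -psimDr !add0r. Qed.
Fact phim0l n : phim 0 n = 0.
Proof. by apply: (addIr (phim 0 n)); rewrite -phimDl !add0r. Qed.
Fact phim0r m : phim m 0 = 0.
Proof. by apply: (addIr (phim m 0)); rewrite -phimDr !add0r. Qed.

Fact mring_mulA : associative mring_mul.
Proof.
move=> [[a n] [m b]] [[a' n'] [m' b']] [[a2 n2] [m2 b2]] /=.
congr ((_, _), (_, _)).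
- rewrite mulrDr psimDr mulrDl psimDl psim_mid psimZl psimZr mulrA -!addrA.
  by congr (_ + _); rewrite addrCA.
- rewrite scalerDr rscalerDl !rscalerDr scalerDl rscalerAl scalerA rscalerA.
  by rewrite -psi_phi -!addrA; congr (_ + _); rewrite addrCA.
- rewrite rscalerDr scalerDr rscalerDl scalerDl rscalerAl scalerA rscalerA.
  by rewrite -phi_psi -!addrA; congr (_ + _); rewrite addrCA.
- rewrite mulrDr phimDr mulrDl phimDl phim_mid phimZl phimZr mulrA -!addrA.
  by congr (_ + _); rewrite addrCA.
Qed.
Fact mring_mul1l : left_id mring_one mring_mul.
Proof.
move=> [[a n] [m b]] /=.
by rewrite psim0l phim0l !rscale0l !scale1r !mul1r !addr0 !add0r.
Qed.
Fact mring_mul1r : right_id mring_one mring_mul.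
Proof.
move=> [[a n] [m b]] /=.
by rewrite psim0r phim0r !scaler0 !rscaler1 !mulr1 !addr0 !add0r.
Qed.
Fact mring_mulDl : left_distributive mring_mul +%R.
Proof.
move=> [[a n] [m b]] [[a' n'] [m' b']] [[a2 n2] [m2 b2]] /=.
by congr ((_, _), (_, _));
  rewrite ?mulrDl ?psimDl ?phimDl ?scalerDl ?rscalerDl addrACA.
Qed.
Fact mring_mulDr : right_distributive mring_mul +%R.
Proof.
move=> [[a n] [m b]] [[a' n'] [m' b']] [[a2 n2] [m2 b2]] /=.
by congr ((_, _), (_, _));
  rewrite ?mulrDr ?psimDr ?phimDr ?scalerDr ?rscalerDr addrACA.
Qed.
HB.instance Definition _ := GRing.Zmodule_isPzRing.Build mring
  mring_mulA mring_mul1l mring_mul1r mring_mulDl mring_mulDr.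

End Morita.

Record lquad (A B : pzRingType) (M : bimodType B A) (N : bimodType A B)
    (mc : moritaContext M N) := LQuad {
  lX : lmodType A;
  lY : lmodType B;
  lf : {linear ltens M lX -> lY};
  lg : {linear ltens N lY -> lX};
  lgf : forall (n : N) (m : M) x,
    lg ((n : rmod N) \ot lf ((m : rmod M) \ot x)) = psim mc n m *: x;
  lfg : forall (m : M) (n : N) y,
    lf ((m : rmod M) \ot lg ((n : rmod N) \ot y)) = phim mc m n *: y }.

Definition lquad_mod (A B : pzRingType) (M : bimodType B A) (N : bimodType A B)
  (mc : moritaContext M N) (Q : lquad mc) : Type := (lX Q * lY Q)%type.

Section LeftModules.
Variables (A B : pzRingType) (M : bimodType B A) (N : bimodType A B).
Variables (mc : moritaContext M N) (Q : lquad mc).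

Definition lfm (m : M) (x : lX Q) : lY Q := lf Q ((m : rmod M) \ot x).
Definition lgm (n : N) (y : lY Q) : lX Q := lg Q ((n : rmod N) \ot y).

Fact lfmDl m m' x : lfm (m + m') x = lfm m x + lfm m' x.
Proof.
rewrite /lfm -raddfD; congr (lf Q _).
by case: (tmul_balanced (rmod M) (lX Q)) => -> _ _.
Qed.
Fact lfmDr m x x' : lfm m (x + x') = lfm m x + lfm m x'.
Proof.
rewrite /lfm -raddfD; congr (lf Q _).
by case: (tmul_balanced (rmod M) (lX Q)) => _ -> _.
Qed.
Fact lgmDl n n' y : lgm (n + n') y = lgm n y + lgm n' y.
Proof.
rewrite /lgm -raddfD; congr (lg Q _).
by case: (tmul_balanced (rmod N) (lY Q)) => -> _ _.
Qed.
Fact lgmDr n y y' : lgm n (y + y') = lgm n y + lgm n y'.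
Proof.
rewrite /lgm -raddfD; congr (lg Q _).
by case: (tmul_balanced (rmod N) (lY Q)) => _ -> _.
Qed.
Fact lfmZl b m x : lfm (b *: m) x = b *: lfm m x.
Proof.
by rewrite /lfm -linearZ; congr (lf Q _); rewrite -[LHS]ltens_scale_tmul.
Qed.
Fact lgmZl a n y : lgm (a *: n) y = a *: lgm n y.
Proof.
by rewrite /lgm -linearZ; congr (lg Q _); rewrite -[LHS]ltens_scale_tmul.
Qed.
Fact lfm_mid m a x : lfm (m <* a) x = lfm m (a *: x).
Proof.
rewrite /lfm; congr (lf Q _).
by case: (tmul_balanced (rmod M) (lX Q)) => _ _ <-.
Qed.
Fact lgm_mid n b y : lgm (n <* b) y = lgm n (b *: y).
Proof.
rewrite /lgm; congr (lg Q _).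
by case: (tmul_balanced (rmod N) (lY Q)) => _ _ <-.
Qed.
Fact lfm0l x : lfm 0 x = 0.
Proof. by apply: (addIr (lfm 0 x)); rewrite -lfmDl !add0r. Qed.
Fact lgm0l y : lgm 0 y = 0.
Proof. by apply: (addIr (lgm 0 y)); rewrite -lgmDl !add0r. Qed.

HB.instance Definition _ := GRing.Zmodule.on (lquad_mod Q).

Definition lquad_scale (l : mring mc) (v : lquad_mod Q) : lquad_mod Q :=
  let: ((a, n), (m, b)) := l in let: (x, y) := v in
  (a *: x + lgm n y, lfm m x + b *: y).

Fact lquad_scalerA a b v :
  lquad_scale a (lquad_scale b v) = lquad_scale (a * b) v.
Proof.
move: a b v => [[a n] [m b]] [[a' n'] [m' b']] [x y] /=.
congr (_, _).
- rewrite scalerDr lgmDr scalerDl lgmDl lgm_mid lgmZl scalerA /lgm /lfm lgf.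
  by rewrite -!addrA; congr (_ + _); rewrite addrCA.
- rewrite scalerDr lfmDr scalerDl lfmDl lfm_mid lfmZl scalerA /lgm /lfm lfg.
  by rewrite -!addrA; congr (_ + _); rewrite addrCA.
Qed.
Fact lquad_scale1r : left_id 1 lquad_scale.
Proof. by move=> [x y] /=; rewrite lgm0l lfm0l !scale1r addr0 add0r. Qed.
Fact lquad_scalerDr : right_distributive lquad_scale +%R.
Proof.
move=> [[a n] [m b]] [x y] [x' y'] /=.
by congr (_, _); rewrite scalerDr ?lgmDr ?lfmDr addrACA.
Qed.
Fact lquad_scalerDl v : {morph lquad_scale^~ v : a b / a + b}.
Proof.
move=> [[a n] [m b]] [[a' n'] [m' b']]; case: v => x y /=.
by congr (_, _); rewrite scalerDl ?lgmDl ?lfmDl addrACA.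
Qed.
HB.instance Definition _ := GRing.Zmodule_isLmodule.Build (mring mc) (lquad_mod Q)
  lquad_scalerA lquad_scale1r lquad_scalerDr lquad_scalerDl.
End LeftModules.

Record rquad (A B : pzRingType) (M : bimodType B A) (N : bimodType A B)
    (mc : moritaContext M N) := RQuad {
  rC : lmodType A^c;
  rD : lmodType B^c;
  rh : {linear rtens rC N -> rD};
  rk : {linear rtens rD M -> rC};
  rkh : forall c (n : N) (m : M),
    rk (rh (c \ot n) \ot m) = (psim mc n m : A^c) *: c;
  rhk : forall d (m : M) (n : N),
    rh (rk (d \ot m) \ot n) = (phim mc m n : B^c) *: d }.

Definition rquad_mod (A B : pzRingType) (M : bimodType B A) (N : bimodType A B)
  (mc : moritaContext M N) (Q : rquad mc) : Type := (rC Q * rD Q)%type.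

Section RightModules.
Variables (A B : pzRingType) (M : bimodType B A) (N : bimodType A B).
Variables (mc : moritaContext M N) (Q : rquad mc).

Definition rhm (c : rC Q) (n : N) : rD Q := rh Q (c \ot n).
Definition rkm (d : rD Q) (m : M) : rC Q := rk Q (d \ot m).

Fact rhmDl c c' n : rhm (c + c') n = rhm c n + rhm c' n.
Proof.
rewrite /rhm -raddfD; congr (rh Q _).
by case: (tmul_balanced (rC Q) N) => -> _ _.
Qed.
Fact rhmDr c n n' : rhm c (n + n') = rhm c n + rhm c n'.
Proof.
rewrite /rhm -raddfD; congr (rh Q _).
by case: (tmul_balanced (rC Q) N) => _ -> _.
Qed.
Fact rkmDl d d' m : rkm (d + d') m = rkm d m + rkm d' m.
Proof.
rewrite /rkm -raddfD; congr (rk Q _).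
by case: (tmul_balanced (rD Q) M) => -> _ _.
Qed.
Fact rkmDr d m m' : rkm d (m + m') = rkm d m + rkm d m'.
Proof.
rewrite /rkm -raddfD; congr (rk Q _).
by case: (tmul_balanced (rD Q) M) => _ -> _.
Qed.
Fact rhmZr c n (b : B) : rhm c (n <* b) = (b : B^c) *: rhm c n.
Proof.
by rewrite /rhm -linearZ; congr (rh Q _); rewrite -[LHS]rtens_scale_tmul.
Qed.
Fact rkmZr d m (a : A) : rkm d (m <* a) = (a : A^c) *: rkm d m.
Proof.
by rewrite /rkm -linearZ; congr (rk Q _); rewrite -[LHS]rtens_scale_tmul.
Qed.
Fact rhm_mid c (a : A) n : rhm ((a : A^c) *: c) n = rhm c (a *: n).
Proof.
rewrite /rhm; congr (rh Q _).
by case: (tmul_balanced (rC Q) N) => _ _ ->.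
Qed.
Fact rkm_mid d (b : B) m : rkm ((b : B^c) *: d) m = rkm d (b *: m).
Proof.
rewrite /rkm; congr (rk Q _).
by case: (tmul_balanced (rD Q) M) => _ _ ->.
Qed.
Fact rhm0r c : rhm c 0 = 0.
Proof. by apply: (addIr (rhm c 0)); rewrite -rhmDr !add0r. Qed.
Fact rkm0r d : rkm d 0 = 0.
Proof. by apply: (addIr (rkm d 0)); rewrite -rkmDr !add0r. Qed.

HB.instance Definition _ := GRing.Zmodule.on (rquad_mod Q).

Definition rquad_scale (l : (mring mc)^c) (v : rquad_mod Q) : rquad_mod Q :=
  let: ((a, n), (m, b)) := (l : mring mc) in let: (c, d) := v in
  ((a : A^c) *: c + rkm d m, rhm c n + (b : B^c) *: d).

Fact rquad_scalerA a b v :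
  rquad_scale a (rquad_scale b v) = rquad_scale (a * b) v.
Proof.
move: a b v => [[a' n'] [m' b']] [[a n] [m b]] [c d] /=.
congr (_, _).
- rewrite scalerDr rkmDl scalerDl rkmDr rkm_mid rkmZr scalerA /rkm /rhm rkh.
  by rewrite -!addrA; congr (_ + _); rewrite addrCA.
- rewrite scalerDr rhmDl scalerDl rhmDr rhm_mid rhmZr scalerA /rkm /rhm rhk.
  by rewrite -!addrA; congr (_ + _); rewrite addrCA.
Qed.
Fact rquad_scale1r : left_id 1 rquad_scale.
Proof. by move=> [c d] /=; rewrite rkm0r rhm0r !scale1r addr0 add0r. Qed.
Fact rquad_scalerDr : right_distributive rquad_scale +%R.
Proof.
move=> [[a n] [m b]] [c d] [c' d'] /=.
by congr (_, _); rewrite scalerDr ?rkmDl ?rhmDl addrACA.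
Qed.
Fact rquad_scalerDl v : {morph rquad_scale^~ v : a b / a + b}.
Proof.
move=> [[a n] [m b]] [[a' n'] [m' b']]; case: v => c d /=.
by congr (_, _); rewrite scalerDl ?rkmDr ?rhmDr addrACA.
Qed.
HB.instance Definition _ := GRing.Zmodule_isLmodule.Build (mring mc)^c (rquad_mod Q)
  rquad_scalerA rquad_scale1r rquad_scalerDr rquad_scalerDl.
End RightModules.

Definition zero_mod (R : pzRingType) : Type := unit.

Section ZeroModule.
Variable R : pzRingType.
HB.instance Definition _ := Choice.on (zero_mod R).
Definition zero_mod_add (_ _ : zero_mod R) : zero_mod R := tt.
Definition zero_mod_opp (_ : zero_mod R) : zero_mod R := tt.
Definition zero_mod_scale (_ : R) (_ : zero_mod R) : zero_mod R := tt.
Fact zero_modA : associative zero_mod_add. Proof. by []. Qed.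
Fact zero_modC : commutative zero_mod_add. Proof. by []. Qed.
Fact zero_mod0 : left_id (tt : zero_mod R) zero_mod_add. Proof. by case. Qed.
Fact zero_modN : left_inverse (tt : zero_mod R) zero_mod_opp zero_mod_add.
Proof. by []. Qed.
HB.instance Definition _ :=
  GRing.isZmodule.Build (zero_mod R) zero_modA zero_modC zero_mod0 zero_modN.
Fact zero_mod_scaleA a b v :
  zero_mod_scale a (zero_mod_scale b v) = zero_mod_scale (a * b) v.
Proof. by []. Qed.
Fact zero_mod_scale1 : left_id 1 zero_mod_scale. Proof. by case. Qed.
Fact zero_mod_scaleDr : right_distributive zero_mod_scale +%R. Proof. by []. Qed.
Fact zero_mod_scaleDl v : {morph zero_mod_scale^~ v : a b / a + b}.
Proof. by []. Qed.
HB.instance Definition _ := GRing.Zmodule_isLmodule.Build R (zero_mod R)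
  zero_mod_scaleA zero_mod_scale1 zero_mod_scaleDr zero_mod_scaleDl.
End ZeroModule.

Section ImagePsi.
Variables (A B : pzRingType) (M : bimodType B A) (N : bimodType A B).
Variable mc : moritaContext M N.

Definition impsi_pred : {pred A^o} := fun a => `[< exists t, psi mc t = a >].

Fact impsi_closed : submod_closed impsi_pred.
Proof.
split=> [|a u v]; rewrite !unfold_in; first by apply/asboolP; exists 0; rewrite raddf0.
move=> /asboolP[s <-] /asboolP[t <-]; apply/asboolP.
by exists ((a *: (s : ltens N M)) + t); rewrite raddfD psi_l.
Qed.
HB.instance Definition _ :=
  GRing.isSubmodClosed.Build A A^o impsi_pred impsi_closed.

Fact impsi_mulr (x : A) a : impsi_pred x -> impsi_pred (x * a).
Proof.
move=> /asboolP[t <-]; apply/asboolP.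
by exists ((a : A^c) *: (t : rtens (rmod N) M)); rewrite psi_r.
Qed.

Definition impsi : Type := submod impsi_pred.
HB.instance Definition _ := GRing.Lmodule.on impsi.

Definition impsi_val (x : impsi) : A := submod_val (x : submod impsi_pred).

Definition impsi_rscale (x : impsi) (a : A) : impsi :=
  Submod (impsi_mulr a (submod_valP x) : submod_pred impsi_pred (impsi_val x * a)).

Fact impsi_val_inj : injective impsi_val. Proof. exact: val_inj. Qed.
Fact impsi_rscalerA x a b :
  impsi_rscale (impsi_rscale x a) b = impsi_rscale x (a * b).
Proof. by apply: impsi_val_inj; apply/esym/mulrA. Qed.
Fact impsi_rscaler1 x : impsi_rscale x 1 = x.
Proof. by apply: impsi_val_inj; apply: mulr1. Qed.
Fact impsi_rscalerDl a : {morph impsi_rscale^~ a : x y / x + y}.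
Proof. by move=> x y; apply: impsi_val_inj; apply: mulrDl. Qed.
Fact impsi_rscalerDr x : {morph impsi_rscale x : a b / a + b}.
Proof. by move=> a b; apply: impsi_val_inj; apply: mulrDr. Qed.
Fact impsi_rscalerAl a x b : impsi_rscale (a *: x) b = a *: impsi_rscale x b.
Proof. by apply: impsi_val_inj; apply/esym/mulrA. Qed.
HB.instance Definition _ := Lmodule_isBimodule.Build A A impsi
  impsi_rscalerA impsi_rscaler1 impsi_rscalerDl impsi_rscalerDr impsi_rscalerAl.

(* The submodule I X of an A-module X. *)
Definition impsi_mul_pred (X : lmodType A) : {pred X} := fun y =>
  `[< exists s : seq (impsi * X), y = \sum_(p <- s) impsi_val p.1 *: p.2 >].
Arguments impsi_mul_pred X _ : clear implicits.

Fact impsi_mul_closed X : submod_closed (impsi_mul_pred X).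
Proof.
split=> [|a u v]; rewrite !unfold_in.
  by apply/asboolP; exists [::]; rewrite big_nil.
move=> /asboolP[s ->] /asboolP[t ->]; apply/asboolP.
exists ([seq (a *: p.1, p.2) | p <- s] ++ t); rewrite big_cat big_map.
congr (_ + _); rewrite scaler_sumr; apply: eq_bigr => p _ /=.
by rewrite scalerA.
Qed.
HB.instance Definition _ X :=
  GRing.isSubmodClosed.Build A X (impsi_mul_pred X) (impsi_mul_closed X).
End ImagePsi.
Arguments impsi_mul_pred {A B M N} mc X _.

(* [lquad0 X _] is (X, 0, 0, 0) and [rquad0 C _] is (C, 0, 0, 0). *)
Section FirstComponent.
Variables (A B : pzRingType) (M : bimodType B A) (N : bimodType A B).
Variable mc : moritaContext M N.

Section Left.
Variable X : lmodType A.
Hypothesis X0 : forall n m (x : X), psim mc n m *: x = 0.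
Fact lquad0_lgf (n : N) (m : M) (x : X) :
  (\0 : {linear ltens N (zero_mod B) -> X})
    ((n : rmod N) \ot (\0 : {linear ltens M X -> zero_mod B})
                        ((m : rmod M) \ot x)) = psim mc n m *: x.
Proof. by rewrite X0. Qed.
Fact lquad0_lfg (m : M) (n : N) (y : zero_mod B) :
  (\0 : {linear ltens M X -> zero_mod B})
    ((m : rmod M) \ot (\0 : {linear ltens N (zero_mod B) -> X})
                        ((n : rmod N) \ot y)) = phim mc m n *: y.
Proof. by []. Qed.
Definition lquad0 : lquad mc := LQuad lquad0_lgf lquad0_lfg.
End Left.

Section Right.
Variable C : lmodType A^c.
Hypothesis C0 : forall n m (c : C), (psim mc n m : A^c) *: c = 0.
Fact rquad0_rkh (c : C) (n : N) (m : M) :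
  (\0 : {linear rtens (zero_mod B^c) M -> C})
    ((\0 : {linear rtens C N -> zero_mod B^c}) (c \ot n) \ot m)
  = (psim mc n m : A^c) *: c.
Proof. by rewrite C0. Qed.
Fact rquad0_rhk (d : zero_mod B^c) (m : M) (n : N) :
  (\0 : {linear rtens C N -> zero_mod B^c})
    ((\0 : {linear rtens (zero_mod B^c) M -> C}) (d \ot m) \ot n)
  = (phim mc m n : B^c) *: d.
Proof. by []. Qed.
Definition rquad0 : rquad mc := RQuad rquad0_rkh rquad0_rhk.
End Right.

Hypothesis phi0 : forall t, phi mc t = 0.

Fact psim_psi n m t : psim mc n m * psi mc t = 0.
Proof.
elim/tens_ind: t => [|s t IHs IHt|n' m']; rewrite ?raddf0 ?mulr0 //.
  by rewrite raddfD mulrDr IHs IHt addr0.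
by rewrite -[psi mc _]/(psim mc n' m') -psimZl psi_phi phi0 rscale0r psim0l.
Qed.
Fact psi_psim t n m : psi mc t * psim mc n m = 0.
Proof.
elim/tens_ind: t => [|s t IHs IHt|n' m']; rewrite ?raddf0 ?mul0r //.
  by rewrite raddfD mulrDl IHs IHt addr0.
by rewrite -[psi mc _]/(psim mc n' m') -psimZr -phi_psi phi0 scale0r psim0r.
Qed.

Fact psim_N n m (n' : N) : psim mc n m *: n' = 0.
Proof. by rewrite psi_phi phi0 rscale0r. Qed.
Fact psim_impsi n m (x : impsi mc) : psim mc n m *: x = 0.
Proof.
apply: impsi_val_inj; rewrite -[LHS]/(psim mc n m * impsi_val x).
case: x => a Ia; have /asboolP[t ta] := Ia.
by rewrite -[impsi_val _]/a -ta psim_psi.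
Qed.
Fact M_psim n m (m' : rmod M) : (psim mc n m : A^c) *: m' = 0.
Proof. by rewrite -[LHS]phi_psi phi0 scale0r. Qed.
Fact impsi_psim n m (x : rmod (impsi mc)) : (psim mc n m : A^c) *: x = 0.
Proof.
apply: impsi_val_inj; rewrite -[LHS]/(impsi_val x * psim mc n m).
case: x => a Ia; have /asboolP[t ta] := Ia.
by rewrite -[impsi_val _]/a -ta psi_psim.
Qed.

Definition lquad_N : lquad mc := lquad0 psim_N.
Definition lquad_I : lquad mc := lquad0 psim_impsi.
Definition rquad_M : rquad mc := rquad0 M_psim.
Definition rquad_I : rquad mc := rquad0 impsi_psim.
End FirstComponent.

Definition subring_incl (A : pzRingType) (S : pred A) (L : subPzRingType S) :
  {rmorphism L -> A} := \val.

Definition trivial_extension (A B : pzRingType) (M : bimodType B A)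
    (N : bimodType A B) (mc : moritaContext M N) (S : pred A)
    (L : subPzRingType S) : Prop :=
  bijective (fun p : L * impsi mc => subring_incl L p.1 + impsi_val p.2) /\
  forall (l l' : L) (x x' : impsi mc),
    (subring_incl L l + impsi_val x) * (subring_incl L l' + impsi_val x') =
    subring_incl L (l * l') +
    impsi_val (subring_incl L l *: x' + x <* subring_incl L l').

Section Conditions.
Variables (A B : pzRingType) (M : bimodType B A) (N : bimodType A B).
Variables (mc : moritaContext M N) (S : pred A) (L : subPzRingType S).
Variable Q : lquad mc.

Definition cokers_gorenstein_projective : Prop :=
  gorenstein_projective (coker (lf Q)) /\
  gorenstein_projective (restr (subring_incl L) (coker (lg Q))).

Definition images_iso_tensors : Prop :=
  [/\ lin_iso (immod (lf Q)) (ltens M (coker (lg Q))),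
      lin_iso (relquot (im_pred (lg Q)) (impsi_mul_pred mc (lX Q)))
              (ltens N (coker (lf Q)))
    & lin_iso (submod (impsi_mul_pred mc (lX Q)))
              (ltens (impsi mc) (coker (lg Q)))].
End Conditions.

(* Main.v *)
Require Import Defs.
From HB Require Import structures.
From mathcomp Require Import all_boot all_algebra.
From mathcomp Require Import boolp.

(** Write T for the Morita context ring, L for the subring with A = L + I, and
    S = L * B.  Since phi = 0, one has I N = 0, M I = 0 and I I = 0, so the
    matrices with diagonal entries in I and 0 form a nilpotent ideal J of T
    with T/J = S and J J = I, the latter in the upper left corner.  Thus
    J/I = N + M and I are S-bimodules, S is a subring of T, and the filtration
    T > J > I splits over S ([splitExt], [moritaExt]).

    The conditions on cokernels and images.  Let W = (X, Y, f, g) be a T-module.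
    Then S (x)_T W = W/JW is the pair (Coker g, Coker f) ([ind_top]), while
    JW/JJW = (Im g / I X, Im f) and JJW = (I X, 0).  So the three isomorphisms
    say that the graded pieces of W are abstractly those of T tensored with
    W/JW.  There are always canonical surjections from the latter to the former,
    and a surjective endomorphism of a noetherian module is injective
    ([hopfian]); hence the isomorphisms exist exactly when the canonical maps
    are injective ([images_iso_canonical]).  This amounts to the injectivity of
    J (x) W -> T (x) W and I (x) W -> J (x) W ([canonical_tor]), the first of
    which is Tor_1(S, W) = 0.  A module W with W/JW Gorenstein projective and
    Tor_1(S, W) = 0 is called [good]; it is [strong] if I (x) W -> J (x) W is
    injective too.  So the conditions on cokernels and images say that W is
    strong ([conditions_strong]).

    Good modules are Gorenstein projective ([gp_of_good]) when J/I and I are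
    compatible over S.  If W is good, Tor_1 and Ext^1 between W and S-modules
    can be computed over S from W/JW.  Compatibility makes them vanish on the
    pieces of J, so that a free cover of W/JW and an embedding of W/JW into a
    free module lift to W, with kernel and cokernel again good and with Ext^1
    into T zero.  Repeating this in both directions builds a totally exact
    complex ([gp_coind]).

    Gorenstein projective modules are strong ([strong_of_gp]) when moreover base
    change along T -> S preserves total exactness ([quotient_exact]): the Tor
    groups in question then vanish by compatibility over S.  That base change
    has this property follows from the hypotheses on N, M and I extended by zero
    through a triangular argument ([quotient_exact_of_corner]).  With e2 the
    second diagonal idempotent, B is e2 T / M as a right and T e2 / N as a left
    T-module, so base change to B preserves total exactness; by compatibility
    over B this extends to N as a right and to M as a left T-module, hence to J
    and to S = T/J.

    Conversely, suppose that the Gorenstein projective modules are the strong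
    ones.  Then Tor_1(S, -) and Ext^1(-, S) vanish on the cycles of totally exact
    complexes over T, so that base change to S preserves total exactness
    ([quotient_exact_of_strong]).  Modules induced from Gorenstein projective
    S-modules are strong by the splitting, and embedding them into projectives
    over T gives the compatibility of J/I and I ([compatible_of_strong]).  The
    compatibility hypotheses on N, M and I over L and B, and on their extensions
    by zero, say exactly that J/I and I are compatible and that base change to S
    preserves total exactness ([compatible_conditions]). *)

Set Implicit Arguments.
Unset Strict Implicit.
Unset Printing Implicit Defensive.

Import GRing.Theory.
Local Open Scope ring_scope.

(** * Linear maps and short exact sequences *)

Definition surj (A B : Type) (f : A -> B) := forall b, exists a, f a = b.

Lemma inj_conj (U V U' V' : Type) (f : U -> V) (f' : U' -> V')
    (u : U -> U') (v : V -> V') :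
  bijective u -> bijective v -> (forall x, v (f x) = f' (u x)) ->
  (injective f <-> injective f').
Proof.
move=> [u' uK u'K] vB fE; split=> fI x y.
  by rewrite -(u'K x) -(u'K y) -!fE => /(bij_inj vB)/fI->.
by move=> /(congr1 v); rewrite !fE => /fI/(can_inj uK).
Qed.

Section LinearMaps.
Variable R : pzRingType.

Definition lin_of (U V : lmodType R) (f : U -> V) (fL : linear f) :
  {linear U -> V} := HB.pack f (GRing.isLinear.Build R U V _ f fL).

Lemma factor_surj (A B C : lmodType R) (q : {linear A -> B}) (w : {linear A -> C}) :
  surj q -> (forall a, q a = 0 -> w a = 0) ->
  exists v : {linear B -> C}, forall a, v (q a) = w a.
Proof.
move=> qS qw; have [g gK] := choice qS.
have wE a a' : q a = q a' -> w a = w a'.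
  move=> /eqP; rewrite -subr_eq0 -raddfB => /eqP/qw/eqP.
  by rewrite raddfB subr_eq0 => /eqP.
have vL : linear (fun b => w (g b)).
  by move=> r b c; rewrite -linearP; apply: wE; rewrite linearP !gK.
by exists (lin_of vL) => a /=; apply: wE; rewrite gK.
Qed.

Lemma factor_inj (A B C : lmodType R) (i : {linear B -> C}) (f : {linear A -> C}) :
  injective i -> (forall a, exists b, i b = f a) ->
  exists v : {linear A -> B}, forall a, i (v a) = f a.
Proof.
move=> iI /choice[g gE].
have vL : linear g by move=> r a b; apply: iI; rewrite linearP !gE linearP.
by exists (lin_of vL).
Qed.

Lemma bij_inv_linear (U V : lmodType R) (h : {linear U -> V}) :
  bijective h -> exists g : {linear V -> U}, cancel h g /\ cancel g h.
Proof.
case=> g hK gK; have gL : linear g.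
  by move=> r u v; apply: (can_inj hK); rewrite linearP !gK.
by exists (lin_of gL).
Qed.

Lemma lin_iso_sym (U V : lmodType R) : lin_iso U V -> lin_iso V U.
Proof. by case=> h /bij_inv_linear[g [hK gK]]; exists g; exists h. Qed.

Lemma lin_iso_trans (U V W : lmodType R) : lin_iso U V -> lin_iso V W -> lin_iso U W.
Proof. by move=> [h hB] [g gB]; exists (g \o h); apply: bij_comp. Qed.

Lemma inj_surj_bij (U V : lmodType R) (h : {linear U -> V}) :
  injective h -> surj h -> bijective h.
Proof.
by move=> hI /choice[g gK]; exists g => // u; apply: hI; rewrite gK.
Qed.

Fact inl_linear (U V : lmodType R) : linear (fun x : U => (x, 0) : U * V).
Proof. by move=> r x y; rewrite [RHS]surjective_pairing /= scaler0 addr0. Qed.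
Fact inr_linear (U V : lmodType R) : linear (fun y : V => (0, y) : U * V).
Proof. by move=> r x y; rewrite [RHS]surjective_pairing /= scaler0 addr0. Qed.
Definition inl_lin U V := lin_of (@inl_linear U V).
Definition inr_lin U V := lin_of (@inr_linear U V).

Lemma inj_ker0 (U V : zmodType) (h : {additive U -> V}) :
  (forall u, h u = 0 -> u = 0) -> injective h.
Proof. by move=> h0; apply: raddf_inj. Qed.

Lemma inj_lker0 (U V : lmodType R) (h : {linear U -> V}) :
  (forall u, h u = 0 -> u = 0) -> injective h.
Proof. exact: inj_ker0. Qed.

Definition ses (K F W : lmodType R) (i : {linear K -> F}) (p : {linear F -> W}) :=
  [/\ injective i, surj p & forall f, p f = 0 <-> exists k, i k = f].

Section QuotientMap.
Variables (V : lmodType R) (S : submodClosed V).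
Fact quot_pi_linear : linear (quot_pi S).
Proof. by move=> r u v; rewrite quot_piD -quot_scale_pi. Qed.
Definition quot_map : {linear V -> quotmod S} := lin_of quot_pi_linear.
Lemma quot_map_surj : surj quot_map.
Proof.
by move=> w; exists (repr (w : Quotient.quot (submod_pred S))); apply: quot_reprK.
Qed.
Lemma quot_mapE v : quot_map v = 0 <-> v \in S.
Proof.
rewrite -(raddf0 quot_map) /=; split=> [/eqP|Sv]; first by rewrite quot_piP subr0.
by apply/eqP; rewrite quot_piP subr0.
Qed.
End QuotientMap.

Lemma coker_ex (K F : lmodType R) (i : {linear K -> F}) :
  exists (W : lmodType R) (p : {linear F -> W}),
    surj p /\ forall f, p f = 0 <-> exists k, i k = f.
Proof.
exists (coker i), (quot_map (im_pred i)); split=> [|f]; first exact: quot_map_surj.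
by rewrite quot_mapE; split=> [/asboolP|fi]; last exact/asboolP.
Qed.

Lemma ses_kermod (F W : lmodType R) (p : {linear F -> W}) :
  surj p -> ses (val : {linear kermod p -> F}) p.
Proof.
move=> pS; split=> // [|f]; first exact: val_inj.
split=> [pf|[k <-]]; last by apply/eqP/(submod_valP k).
have fP : submod_pred (ker_pred p) f by apply/eqP.
by exists (Submod fP).
Qed.

Lemma ses_ker (F W : lmodType R) (p : {linear F -> W}) :
  surj p -> exists (K : lmodType R) (i : {linear K -> F}), ses i p.
Proof. by move=> pS; exists (kermod p), val; apply: ses_kermod. Qed.

(** Identifies the base change of a syzygy with a syzygy chosen over the new
    ring, when the middle terms correspond. *)
Lemma ses_ker_iso (K F K' F' W : lmodType R)
    (i : {linear K -> F}) (p : {linear F -> W})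
    (i' : {linear K' -> F'}) (p' : {linear F' -> W}) (h : {linear F' -> F}) :
  ses i p -> ses i' p' -> bijective h -> (forall x, p (h x) = p' x) ->
  lin_iso K K'.
Proof.
move=> [iI pS pE] [i'I p'S p'E] /[dup] hB /bij_inv_linear[g [hK gK]] ph.
have [v vE] : exists v : {linear K -> K'}, forall a, i' (v a) = (g \o i) a.
  by apply: factor_inj => // a; apply/p'E; rewrite -ph gK; apply/pE; exists a.
exists v; apply: inj_surj_bij => [x y|x'].
  by move=> /(congr1 i'); rewrite !vE /= => /(can_inj gK)/iI.
have /pE[x xE] : p (h (i' x')) = 0 by rewrite ph; apply/p'E; exists x'.
by exists x; apply: i'I; rewrite vE /= xE hK.
Qed.

(** The dual comparison, for cosyzygies. *)
Lemma ses_coker_iso (K F W F' W' : lmodType R)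
    (i : {linear K -> F}) (p : {linear F -> W})
    (i' : {linear K -> F'}) (p' : {linear F' -> W'}) (h : {linear F -> F'}) :
  ses i p -> ses i' p' -> bijective h -> (forall x, h (i x) = i' x) ->
  lin_iso W W'.
Proof.
move=> [iI pS pE] [i'I p'S p'E] /[dup] hB /bij_inv_linear[g [hK gK]] hi.
have [v vE] : exists v : {linear W -> W'}, forall a, v (p a) = (p' \o h) a.
  apply: factor_surj => // a /pE[x <-] /=; rewrite hi.
  by apply/p'E; exists x.
exists v; apply: inj_surj_bij => [|w'].
  apply: inj_lker0 => w; have [f <-] := pS w; rewrite vE => /p'E[x xE].
  by apply/pE; exists x; apply: (can_inj hK); rewrite hi.
have [f' fE] := p'S w'; exists (p (g f')).
by rewrite vE /= gK.
Qed.
End LinearMaps.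

(** * Projective modules and extension of maps *)

Section Projectives.
Variable R : pzRingType.

Lemma fin_gen_fintype (V : lmodType R) (I : finType) (e : I -> V) :
  (forall v, exists c : I -> R, v = \sum_i c i *: e i) -> fin_gen V.
Proof.
move=> eE; exists #|I|, (fun j => e (enum_val j)) => v.
have [c ->] := eE v; exists (fun j => c (enum_val j)).
by rewrite (reindex (@enum_val I predT)) //; apply/onW_bij/enum_val_bij.
Qed.

(** Finitely generated projective modules through coordinates: in this form
    they pass to retracts, sums and base changes by moving the coordinate maps. *)
Definition has_dual_basis (P : lmodType R) : Prop :=
  exists (I : finType) (e : I -> P) (phi : I -> {linear P -> R^o}),
    forall x, x = \sum_i (phi i x : R) *: e i.

Definition freemod (n : nat) : lmodType R := {ffun 'I_n -> R^o}.

Definition free_basis n (i : 'I_n) : freemod n := [ffun j => (i == j)%:R].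

Lemma free_sumE n (x : freemod n) : x = \sum_i (x i : R) *: free_basis i.
Proof.
apply/ffunP => j; rewrite sum_ffunE (bigD1 j) //= big1 ?addr0 => [|i ij].
  by rewrite !ffunE eqxx [RHS]mulr1.
by rewrite !ffunE (negbTE ij); apply: mulr0.
Qed.

Definition free_coord n (i : 'I_n) (x : freemod n) : R^o := x i.
Fact free_coord_linear n i : linear (@free_coord n i).
Proof. by move=> r x y; rewrite /free_coord !ffunE. Qed.
HB.instance Definition _ n i :=
  GRing.isLinear.Build R (freemod n) R^o _ (@free_coord n i) (@free_coord_linear n i).

Definition comb (V : lmodType R) n (w : 'I_n -> V) (x : freemod n) : V :=
  \sum_i (x i : R) *: w i.
Fact comb_linear (V : lmodType R) n (w : 'I_n -> V) : linear (@comb V n w).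
Proof.
move=> r x y; rewrite /comb scaler_sumr -big_split; apply: eq_bigr => i _ /=.
by rewrite !ffunE scalerDl scalerA.
Qed.
HB.instance Definition _ (V : lmodType R) n (w : 'I_n -> V) :=
  GRing.isLinear.Build R (freemod n) V _ (@comb V n w) (@comb_linear V n w).

Lemma comb_basis (V : lmodType R) n (w : 'I_n -> V) i : comb w (free_basis i) = w i.
Proof.
rewrite /comb (bigD1 i) //= big1 ?addr0 => [|j ji].
  by rewrite ffunE eqxx scale1r.
by rewrite ffunE eq_sym (negbTE ji) scale0r.
Qed.

Lemma comb_morph (V : lmodType R) n (h : {linear freemod n -> V}) x :
  comb (fun i => h (free_basis i)) x = h x.
Proof.
rewrite [in RHS](free_sumE x) linear_sum; apply: eq_bigr => i _.
by rewrite linearZ.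
Qed.

Lemma freemod_ext (V : lmodType R) n (g h : {linear freemod n -> V}) :
  (forall i, g (free_basis i) = h (free_basis i)) -> g =1 h.
Proof.
move=> gh x; rewrite -(comb_morph g) -(comb_morph h).
by apply: eq_bigr => i _; rewrite gh.
Qed.

Lemma dual_basis_in_proj (P : lmodType R) : has_dual_basis P -> in_proj P.
Proof.
move=> [I [e [phi eE]]]; split; last first.
  by apply: (fin_gen_fintype (e := e)) => v; exists (fun i => phi i v).
move=> U V p f pS; have [u uE] := choice (fun i => pS (f (e i))).
have gL : linear (fun x => \sum_i (phi i x : R) *: u i).
  move=> r x y; rewrite scaler_sumr -big_split; apply: eq_bigr => i _ /=.
  by rewrite linearP scalerDl scalerA.
exists (lin_of gL) => x /=; rewrite [in RHS](eE x) !linear_sum.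
by apply: eq_bigr => i _; rewrite !linearZ uE.
Qed.

Lemma in_proj_free_retract (P : lmodType R) : in_proj P ->
  exists n (s : {linear P -> freemod n}) (r : {linear freemod n -> P}), cancel s r.
Proof.
move=> pP; have [_ [n [e eE]]] := pP; exists n.
have cS : surj (comb e).
  move=> v; have [c ->] := eE v; exists [ffun i => c i].
  by apply: eq_bigr => i _; rewrite ffunE.
by have [g gK] := pP.1 _ _ (comb e) idfun cS; exists g, (comb e).
Qed.

Lemma in_proj_dual_basis (P : lmodType R) : in_proj P -> has_dual_basis P.
Proof.
move=> /in_proj_free_retract[n [s [r sK]]].
exists 'I_n, (fun i => r (free_basis i)), (fun i => free_coord i \o s) => x.
rewrite -[LHS]sK [in LHS](free_sumE (s x)) linear_sum.
by apply: eq_bigr => i _; rewrite linearZ.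
Qed.

Lemma in_proj_free n : in_proj (freemod n).
Proof.
apply: dual_basis_in_proj.
by exists 'I_n, (@free_basis n), (fun i => free_coord i) => x; apply: free_sumE.
Qed.

Lemma in_proj_retract (P Q : lmodType R) (i : {linear Q -> P}) (r : {linear P -> Q}) :
  cancel i r -> in_proj P -> in_proj Q.
Proof.
move=> iK /in_proj_dual_basis[I [e [phi eE]]]; apply: dual_basis_in_proj.
exists I, (r \o e), (fun j => phi j \o i) => x /=.
rewrite -[LHS]iK [in LHS](eE (i x)) linear_sum.
by apply: eq_bigr => j _; rewrite linearZ.
Qed.

Lemma in_proj_prod (P Q : lmodType R) : in_proj P -> in_proj Q ->
  in_proj (P * Q)%type.
Proof.
move=> /in_proj_dual_basis[I [e [phi eE]]] /in_proj_dual_basis[I' [e' [phi' eE']]].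
apply: dual_basis_in_proj.
exists (I + I')%type, (fun s => match s with inl i => (e i, 0) | inr i => (0, e' i) end).
exists (fun s => match s with inl i => (phi i \o fst : {linear _ -> _})
                           | inr i => (phi' i \o snd : {linear _ -> _}) end).
move=> [x y]; rewrite big_sumType /=.
rewrite {1}(eE x) {1}(eE' y).
transitivity (\sum_i ((phi i x : R) *: e i, 0 : Q) + \sum_i (0 : P, (phi' i y : R) *: e' i)).
  rewrite -[LHS]/((_, _) : P * Q) [LHS]surjective_pairing /=.
  rewrite [RHS]surjective_pairing /= !linear_sum /=.
  by rewrite !big1_eq addr0 add0r.
by congr (_ + _); apply: eq_bigr => i _; rewrite -[RHS]/(_ *: _, _ *: _) scaler0.
Qed.

Lemma fin_gen_surj (U V : lmodType R) (p : {linear U -> V}) :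
  surj p -> fin_gen U -> fin_gen V.
Proof.
move=> pS [n [e eE]]; exists n, (p \o e) => v.
have [u <-] := pS v; have [c ->] := eE u; exists c.
by rewrite linear_sum; apply: eq_bigr => i _; rewrite linearZ.
Qed.
End Projectives.

Section ExtAlong.
Variable R : pzRingType.
Implicit Types K F W U E : lmodType R.

(** With F projective and W the cokernel of k, this is the vanishing of
    Ext^1(W, U). *)
Definition ext_along K F (k : {linear K -> F}) U : Prop :=
  forall u : {linear K -> U}, exists v : {linear F -> U}, forall x, v (k x) = u x.

Lemma ext_along_retract K F (k : {linear K -> F}) U U'
    (i : {linear U' -> U}) (r : {linear U -> U'}) :
  cancel i r -> ext_along k U -> ext_along k U'.
Proof.
move=> iK kU u; have [v vE] := kU (i \o u).
by exists (r \o v) => x /=; rewrite vE /= iK.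
Qed.

Lemma ext_along_prod K F (k : {linear K -> F}) U U' :
  ext_along k U -> ext_along k U' -> ext_along k (U * U')%type.
Proof.
move=> kU kU' u; have [v vE] := kU (fst \o u); have [v' vE'] := kU' (snd \o u).
have L : linear (fun y => (v y, v' y)) by move=> r x y; rewrite !linearP.
by exists (lin_of L) => x /=; rewrite vE vE' /= -surjective_pairing.
Qed.

(** Maps into a free module extend coordinate by coordinate, and a projective
    module is a retract of a free one. *)
Lemma ext_along_proj K F (k : {linear K -> F}) (P : lmodType R) :
  in_proj P -> ext_along k R^o -> ext_along k P.
Proof.
move=> /in_proj_free_retract[n [s [r sK]]] kR; apply: ext_along_retract sK _ => u.
have [v vE] := choice (fun i => kR (free_coord i \o u)).
have L : linear (fun y => [ffun i => v i y] : freemod R n).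
  by move=> a x y; apply/ffunP => i; rewrite !ffunE linearP.
by exists (lin_of L) => x /=; apply/ffunP => i; rewrite ffunE vE.
Qed.

(** The middle term of a long exact sequence: lift to E an extension of the
    induced map into U''; its defect lies in U and extends as well. *)
Lemma ext_along_ses K F (k : {linear K -> F}) U E U''
    (i : {linear U -> E}) (q : {linear E -> U''}) :
  ses i q -> projective F -> ext_along k U -> ext_along k U'' -> ext_along k E.
Proof.
move=> [iI qS qE] pF kU kU'' u.
have [v vE] := kU'' (q \o u); have [w wE] := pF _ _ q v qS.
have [u' u'E] : exists u' : {linear K -> U}, forall x, i (u' x) = (u \- (w \o k)) x.
  by apply: factor_inj => // x; apply/qE; rewrite /= linearB wE vE subrr.
have [v' v'E] := kU u'.
exists ((i \o v') \+ w) => x /=.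
by rewrite v'E u'E /= subrK.
Qed.

(** Ext^1(W, U) = 0 lets maps from W lift along extensions by U. *)
Lemma lift_of_ext K F W (k : {linear K -> F}) (p : {linear F -> W}) U E U''
    (i : {linear U -> E}) (q : {linear E -> U''}) :
  ses k p -> ses i q -> projective F -> ext_along k U ->
  forall h : {linear W -> U''}, exists g : {linear W -> E}, forall x, q (g x) = h x.
Proof.
move=> [kI pS pE] [iI qS qE] pF kU h.
have [g gE] := pF _ _ q (h \o p) qS.
have [u uE] : exists u : {linear K -> U}, forall x, i (u x) = (g \o k) x.
  apply: factor_inj => // x; apply/qE; rewrite /= gE /=.
  have -> : p (k x) = 0 by apply/pE; exists x.
  exact: linear0.
have [v vE] := kU u.
have [g' g'E] : exists g' : {linear W -> E}, forall x, g' (p x) = (g \- (i \o v)) x.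
  by apply: factor_surj => // x /pE[y <-] /=; rewrite vE uE /= subrr.
exists g' => x; have [f <-] := pS x.
have q0 y : q (i y) = 0 by apply/qE; exists y.
by rewrite g'E /= linearB gE q0 subr0.
Qed.

(** Along a two-step chain K' -> F' -> K -> F, extension into E and, one step
    earlier, into the kernel gives extension into the quotient U''. *)
Lemma ext_along_quot K' F' K F (k' : {linear K' -> F'}) (p' : {linear F' -> K})
    (k : {linear K -> F}) U E U'' (i : {linear U -> E}) (q : {linear E -> U''}) :
  ses k' p' -> ses i q -> projective F' ->
  ext_along k' U -> ext_along k E -> ext_along k U''.
Proof.
move=> kp iq pF' kU kE u; have [g gE] := lift_of_ext kp iq pF' kU u.
by have [v vE] := kE g; exists (q \o v) => x /=; rewrite vE.
Qed.

(** The mapping cone of a comparison map F' -> F over W is exact.  Hence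
    [ext_along] and [inj_tens] hold for every presentation of W as soon as they
    hold for one with projective middle term. *)
Lemma comparison_ses K F W (k : {linear K -> F}) (p : {linear F -> W})
    K' F' (k' : {linear K' -> F'}) (p' : {linear F' -> W}) :
  ses k p -> ses k' p' -> projective F' ->
  exists (a0 : {linear K' -> K}) (m : {linear K' -> (K * F')%type})
    (c : {linear (K * F')%type -> F}),
    [/\ ses m c, forall x, m x = (- a0 x, k' x) & forall x, c (x, 0) = k x].
Proof.
move=> [kI pS pE] [kI' pS' pE'] pF'.
have [a aE] := pF' _ _ p p' pS.
have [a0 a0E] : exists a0 : {linear K' -> K}, forall x, k (a0 x) = (a \o k') x.
  by apply: factor_inj => // x; apply/pE; rewrite /= aE; apply/pE'; exists x.
have mL : linear (fun x => (- a0 x, k' x)).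
  by move=> r x y; rewrite !linearP.
have cL : linear (fun z : K * F' => k z.1 + a z.2).
  by move=> r x y; rewrite /= !linearP scalerDr addrACA.
exists a0, (lin_of mL), (lin_of cL); split=> //= [|x]; last by rewrite linear0 addr0.
split=> [x y [_ /kI' //]|f|[x y] /=].
  have [y yE] := pS' (p f).
  have /pE[x xE] : p (f - a y) = 0 by rewrite linearB aE yE subrr.
  by exists (x, y); rewrite /= xE subrK.
split=> [e|[z [<- <-]]]; last by rewrite linearN a0E addNr.
have /pE'[z zE] : p' y = 0.
  have := congr1 p e; rewrite linearD aE linear0 => <-.
  by rewrite (_ : p (k x) = 0) ?add0r //; apply/pE; exists x.
exists z; rewrite zE; congr (_, _); apply: kI.
by apply/eqP; rewrite linearN a0E /= zE eq_sym -addr_eq0 e.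
Qed.

Lemma ext_along_comparison K F W (k : {linear K -> F}) (p : {linear F -> W})
    K' F' (k' : {linear K' -> F'}) (p' : {linear F' -> W}) U :
  ses k p -> ses k' p' -> projective F' -> ext_along k' U -> ext_along k U.
Proof.
move=> kp kp' pF' kU u.
have [a0 [m [c [[mI cS cE] mE ckE]]]] := comparison_ses kp kp' pF'.
have [v' v'E] := kU (u \o a0).
have [v vE] : exists v : {linear F -> U}, forall z, v (c z) = ((u \o fst) \+ (v' \o snd)) z.
  apply: factor_surj => // z /cE[x <-]; rewrite mE /= v'E /= linearN addNr //.
by exists v => x; rewrite -ckE vE /= linear0 addr0.
Qed.
End ExtAlong.

(** * Tensor products: exactness and flatness *)

Section AdditiveMaps.

Fact morphD_zmod (U V : zmodType) (f : U -> V) :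
  {morph f : x y / x + y} -> zmod_morphism f.
Proof. by move=> fD x y; apply: (addIr (f y)); rewrite -fD !subrK. Qed.

Definition add_of (U V : zmodType) (f : U -> V) (fD : {morph f : x y / x + y}) :
  {additive U -> V} :=
  HB.pack f (GRing.isZmodMorphism.Build U V f (morphD_zmod fD)).

Section ZmodQuotient.
Variables (G : zmodType) (P : G -> Prop).
Hypotheses (P0 : P 0) (PB : forall x y, P x -> P y -> P (x - y)).

Definition zmod_pred : {pred G} := fun t => `[< P t >].
Fact zmod_pred_closed : zmod_closed zmod_pred.
Proof.
split=> [|x y /asboolP Px /asboolP Py]; first exact/asboolP.
exact/asboolP/PB.
Qed.
HB.instance Definition _ := GRing.isZmodClosed.Build G zmod_pred zmod_pred_closed.

Lemma zmod_quotient :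
  exists (Z : zmodType) (pi : {additive G -> Z}), forall t, pi t = 0 <-> P t.
Proof.
exists (Quotient.quot zmod_pred), \pi_(Quotient.quot zmod_pred)%qT => t.
rewrite -(raddf0 \pi_(Quotient.quot zmod_pred)%qT).
split=> [/eqP|Pt]; last by apply/eqP; rewrite -Quotient.idealrBE subr0; apply/asboolP.
by rewrite -Quotient.idealrBE subr0 => /asboolP.
Qed.
End ZmodQuotient.
End AdditiveMaps.

Section TensorMaps.
Variable R : pzRingType.
Implicit Types (C D E : lmodType R^c) (K F W : lmodType R).

Lemma tmulDl C W (c c' : C) (x : W) : (c + c') \ot x = c \ot x + c' \ot x.
Proof. by case: (tmul_balanced C W) => ->. Qed.
Lemma tmulDr C W (c : C) (x x' : W) : c \ot (x + x') = c \ot x + c \ot x'.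
Proof. by case: (tmul_balanced C W) => _ ->. Qed.
Lemma tmul_mid C W (r : R) (c : C) (x : W) :
  ((r : R^c) *: c) \ot x = c \ot (r *: x).
Proof. by case: (tmul_balanced C W) => _ _ ->. Qed.
Lemma tmul0l C W (x : W) : (0 : C) \ot x = 0.
Proof. exact: balanced0l (tmul_balanced C W). Qed.
Lemma tmul0r C W (c : C) : c \ot (0 : W) = 0.
Proof. by apply: (addIr (c \ot 0)); rewrite -tmulDr !add0r. Qed.
Lemma tmulNr C W (c : C) (x : W) : c \ot (- x) = - (c \ot x).
Proof. by apply: (addIr (c \ot x)); rewrite -tmulDr !addNr tmul0r. Qed.
Lemma tmulBr C W (c : C) (x y : W) : c \ot (x - y) = c \ot x - c \ot y.
Proof. by rewrite tmulDr tmulNr. Qed.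
Lemma tmulNl C W (c : C) (x : W) : (- c) \ot x = - (c \ot x).
Proof. by apply: (addIr (c \ot x)); rewrite -tmulDl !addNr tmul0l. Qed.
Lemma tmulBl C W (c d : C) (x : W) : (c - d) \ot x = c \ot x - d \ot x.
Proof. by rewrite tmulDl tmulNl. Qed.

Definition tlift_of C W (Z : zmodType) (b : C -> W -> Z) (bb : balanced b) :
  {additive tens C W -> Z} := add_of (tliftD bb).
Lemma tlift_ofE C W (Z : zmodType) (b : C -> W -> Z) (bb : balanced b) c x :
  tlift_of bb (c \ot x) = b c x.
Proof. exact: tlift_tmul. Qed.

Lemma tens_additive_ext C W (Z : zmodType) (f g : {additive tens C W -> Z}) :
  (forall c x, f (c \ot x) = g (c \ot x)) -> f =1 g.
Proof. by apply: tens_ext; apply: raddfD. Qed.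

Definition tmapr D K F (k : {linear K -> F}) : tens D K -> tens D F :=
  tens_map (C' := D) idfun k.
Fact tmaprD D K F (k : {linear K -> F}) : {morph @tmapr D K F k : s t / s + t}.
Proof. exact: tens_mapD. Qed.
Fact tmaprB D K F (k : {linear K -> F}) : zmod_morphism (@tmapr D K F k).
Proof. exact: (raddfB (add_of (@tmaprD D K F k))). Qed.
HB.instance Definition _ D K F (k : {linear K -> F}) :=
  GRing.isZmodMorphism.Build (tens D K) (tens D F) (tmapr k) (@tmaprB D K F k).
Lemma tmaprE D K F (k : {linear K -> F}) (d : D) x : tmapr k (d \ot x) = d \ot k x.
Proof. exact: (tens_map_tmul idfun). Qed.

Definition tmapl C D (j : {linear C -> D}) W : tens C W -> tens D W :=
  tens_map (X' := W) j idfun.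
Fact tmaplD C D (j : {linear C -> D}) W : {morph @tmapl C D j W : s t / s + t}.
Proof. exact: tens_mapD. Qed.
Fact tmaplB C D (j : {linear C -> D}) W : zmod_morphism (@tmapl C D j W).
Proof. exact: (raddfB (add_of (@tmaplD C D j W))). Qed.
HB.instance Definition _ C D (j : {linear C -> D}) W :=
  GRing.isZmodMorphism.Build (tens C W) (tens D W) (@tmapl C D j W) (@tmaplB C D j W).
Lemma tmaplE C D (j : {linear C -> D}) W c (x : W) : tmapl j (c \ot x) = j c \ot x.
Proof. exact: (tens_map_tmul _ idfun). Qed.

Lemma tmapr_comp D K F W (k : {linear K -> F}) (p : {linear F -> W}) (t : tens D K) :
  tmapr p (tmapr k t) = tmapr (p \o k) t.
Proof.
move: t; apply: (tens_additive_ext (f := tmapr p \o tmapr k)) => d x /=.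
by rewrite !tmaprE.
Qed.

Lemma tmapl_comp C D E (j : {linear C -> D}) (q : {linear D -> E}) W (t : tens C W) :
  tmapl q (tmapl j t) = tmapl (q \o j) t.
Proof.
move: t; apply: (tens_additive_ext (f := tmapl q (W := W) \o tmapl j (W := W))) => d x /=.
by rewrite !tmaplE.
Qed.

Lemma tmaplr C D (j : {linear C -> D}) K F (k : {linear K -> F}) (t : tens C K) :
  tmapl j (tmapr k t) = tmapr k (tmapl j t).
Proof.
move: t; apply: (tens_additive_ext (f := tmapl j (W := F) \o tmapr k)
  (g := tmapr k \o tmapl j (W := K))) => d x /=.
by rewrite tmaprE !tmaplE tmaprE.
Qed.

Lemma tmapr_id D K (k : {linear K -> K}) (t : tens D K) : k =1 id -> tmapr k t = t.
Proof.
move=> kE; move: t; apply: (tens_additive_ext (f := tmapr k) (g := idfun)) => d x /=.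
by rewrite tmaprE kE.
Qed.

Lemma tmapl_id D W (j : {linear D -> D}) (t : tens D W) : j =1 id -> tmapl j t = t.
Proof.
move=> jE; move: t; apply: (tens_additive_ext (f := tmapl j (W := W)) (g := idfun)) => d x /=.
by rewrite tmaplE jE.
Qed.

Lemma tmapr0 D K F (k : {linear K -> F}) (t : tens D K) :
  (forall x, k x = 0) -> tmapr k t = 0.
Proof.
move=> kE; move: t; apply: (tens_additive_ext (f := tmapr k) (g := \0)) => d x /=.
by rewrite tmaprE kE tmul0r.
Qed.

Lemma tmapl0 C D (j : {linear C -> D}) W (t : tens C W) :
  (forall x, j x = 0) -> tmapl j t = 0.
Proof.
move=> kE; move: t; apply: (tens_additive_ext (f := tmapl j (W := W)) (g := \0)) => d x /=.
by rewrite tmaplE kE tmul0l.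
Qed.

Lemma tmapr_surj D F W (p : {linear F -> W}) : surj p -> surj (@tmapr D F W p).
Proof.
move=> pS t; elim/tens_ind: t => [|s t [x <-] [y <-]|d w].
- by exists 0; rewrite raddf0.
- by exists (x + y); rewrite raddfD.
- by have [f <-] := pS w; exists (d \ot f); rewrite tmaprE.
Qed.

Lemma tmapl_surj C D (p : {linear C -> D}) W : surj p -> surj (@tmapl C D p W).
Proof.
move=> pS t; elim/tens_ind: t => [|s t [x <-] [y <-]|d w].
- by exists 0; rewrite raddf0.
- by exists (x + y); rewrite raddfD.
- by have [c <-] := pS d; exists (c \ot w); rewrite tmaplE.
Qed.

(** Right exactness in the second variable: the quotient of D (x) F by the
    image of D (x) K carries a balanced map out of D * W. *)
Lemma tmapr_exact D K F W (k : {linear K -> F}) (p : {linear F -> W}) :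
  surj p -> (forall f, p f = 0 <-> exists x, k x = f) ->
  forall t : tens D F, tmapr p t = 0 <-> exists s, tmapr k s = t.
Proof.
move=> pS pE t; split=> [pt|[s <-]]; last first.
  by rewrite tmapr_comp tmapr0 // => x; apply/pE; exists x.
have [|x y [s <-] [s' <-]|Z [q qE]] :=
    zmod_quotient (P := fun t => exists s, tmapr (D := D) k s = t).
- by exists 0; rewrite raddf0.
- by exists (s - s'); rewrite raddfB.
have [g gK] := choice pS.
have qK d f f' : p f = p f' -> q (d \ot f) = q (d \ot f').
  move=> /eqP; rewrite -subr_eq0 -linearB => /eqP/pE[x xE].
  apply/eqP; rewrite -subr_eq0 -raddfB; apply/eqP/qE.
  by exists (d \ot x); rewrite tmaprE xE tmulBr.
have bb : balanced (fun d w => q (d \ot g w)).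
  split=> [w d d'|d w w'|d r w].
  - by rewrite tmulDl raddfD.
  - by rewrite -raddfD -tmulDr; apply: qK; rewrite linearD !gK.
  - by rewrite tmul_mid; apply: qK; rewrite linearZ !gK.
have qpE : tlift_of bb \o tmapr p =1 q.
  apply: tens_additive_ext => d f; rewrite -[LHS]/(tlift_of bb (tmapr p _)).
  by rewrite tmaprE tlift_ofE; apply: qK; rewrite gK.
by apply/qE; rewrite -qpE -[LHS]/(tlift_of bb (tmapr p t)) pt raddf0.
Qed.

(** The quotient of D (x) W by the image of C (x) W carries a balanced map out
    of E * W. *)
Lemma tmapl_exact C D E (k : {linear C -> D}) (p : {linear D -> E}) W :
  surj p -> (forall f, p f = 0 <-> exists x, k x = f) ->
  forall t : tens D W, tmapl p t = 0 <-> exists s, tmapl k s = t.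
Proof.
move=> pS pE t; split=> [pt|[s <-]]; last first.
  by rewrite tmapl_comp tmapl0 // => x; apply/pE; exists x.
have [|x y [s <-] [s' <-]|Z [q qE]] :=
    zmod_quotient (P := fun t => exists s, tmapl (W := W) k s = t).
- by exists 0; rewrite raddf0.
- by exists (s - s'); rewrite raddfB.
have [g gK] := choice pS.
have qK f f' w : p f = p f' -> q (f \ot w) = q (f' \ot w).
  move=> /eqP; rewrite -subr_eq0 -linearB => /eqP/pE[x xE].
  apply/eqP; rewrite -subr_eq0 -raddfB; apply/eqP/qE.
  by exists (x \ot w); rewrite tmaplE xE tmulBl.
have bb : balanced (fun e w => q (g e \ot w)).
  split=> [w d d'|d w w'|d r w].
  - by rewrite -raddfD -tmulDl; apply: qK; rewrite linearD !gK.
  - by rewrite tmulDr raddfD.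
  - by rewrite -tmul_mid; apply: qK; rewrite linearZ !gK.
have qpE : tlift_of bb \o tmapl p (W := W) =1 q.
  apply: tens_additive_ext => d f; rewrite -[LHS]/(tlift_of bb (tmapl p _)).
  by rewrite tmaplE tlift_ofE; apply: qK; rewrite gK.
by apply/qE; rewrite -qpE -[LHS]/(tlift_of bb (tmapl p t)) pt raddf0.
Qed.

(** The coordinates of a dual basis of P turn D (x) P into a natural direct
    summand of a power of D. *)
Lemma flat_of_proj C D (j : {linear C -> D}) (P : lmodType R) :
  in_proj P -> injective j -> injective (@tmapl C D j P).
Proof.
move=> /in_proj_dual_basis[I [e [phi eE]]] jI; apply: inj_ker0 => t jt.
have aB (E : lmodType R^c) i : balanced (fun (c : E) x => (phi i x : R^c) *: c).
  split=> [w d d'|d w w'|d r w]; first by rewrite scalerDr.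
    by rewrite linearD scalerDl.
  by rewrite linearZ /= scalerA.
pose a (E : lmodType R^c) i := tlift_of (aB E i).
have aE (E : lmodType R^c) (s : tens E P) : s = \sum_i (a E i s) \ot e i.
  elim/tens_ind: s => [|s s' {1}-> {1}->|c x].
  - by rewrite big1 // => i _; rewrite raddf0 tmul0l.
  - by rewrite -big_split; apply: eq_bigr => i _; rewrite raddfD tmulDl.
  pose h : {additive P -> tens E P} := add_of (tmulDr c).
  rewrite {1}(eE x) -[LHS]/(h (\sum_i (phi i x : R) *: e i)) raddf_sum.
  by apply: eq_bigr => i _; rewrite /a tlift_ofE tmul_mid.
have ja i (s : tens C P) : j (a C i s) = a D i (tmapl j s).
  elim/tens_ind: s => [|s s' IH IH'|c x]; first by rewrite !raddf0.
    by rewrite (raddfD (a C i)) linearD IH IH' raddfD (raddfD (a D i)).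
  by rewrite tmaplE /a !tlift_ofE linearZ.
rewrite [LHS]aE big1 // => i _.
have -> : a C i t = 0 by apply: jI; rewrite ja jt raddf0 linear0.
exact: tmul0l.
Qed.

Definition regularr : lmodType R^c := (R^c)^o.

Lemma act_balanced W : balanced (fun (r : regularr) (x : W) => (r : R) *: x).
Proof.
split=> [w d d'|d w w'|d r w]; first by rewrite scalerDl.
  by rewrite scalerDr.
by rewrite scalerA.
Qed.
Definition act W := tlift_of (act_balanced W).

Lemma actE W (r : R) (x : W) : act W ((r : regularr) \ot x) = r *: x.
Proof. exact: tlift_ofE. Qed.

Lemma act_can W (t : tens regularr W) : t = (1 : regularr) \ot act W t.
Proof.
elim/tens_ind: t => [|s t {1}-> {1}->|r x]; first by rewrite raddf0 tmul0r.
  by rewrite raddfD tmulDr.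
rewrite actE -tmul_mid; congr (_ \ot _).
by rewrite -[RHS]/(1 * (r : R)) mul1r.
Qed.

Lemma act_bij W : bijective (act W).
Proof.
exists (fun x => (1 : regularr) \ot x) => [t|x]; first by rewrite -act_can.
by rewrite actE scale1r.
Qed.

Lemma act_nat K F (k : {linear K -> F}) t : act F (tmapr k t) = k (act K t).
Proof.
elim/tens_ind: t => [|s t IH IH'|r x]; first by rewrite !raddf0.
  by rewrite (raddfD (act K)) linearD -IH -IH' raddfD (raddfD (act F)).
by rewrite tmaprE !actE linearZ.
Qed.
End TensorMaps.

(** * Tor as injectivity of tensored maps *)

Section InjTens.
Variable R : pzRingType.
Implicit Types (C D E : lmodType R^c) (K F W : lmodType R).

(** With F flat and W the cokernel of k, this is the vanishing of Tor_1(D, W). *)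
Definition inj_tens D K F (k : {linear K -> F}) : Prop := injective (@tmapr R D K F k).

Lemma tmapl_split_inj C D (i : {linear C -> D}) (r : {linear D -> C}) W :
  cancel i r -> injective (@tmapl R C D i W).
Proof.
move=> iK; apply: (can_inj (g := @tmapl R D C r W)) => t.
by rewrite tmapl_comp tmapl_id.
Qed.

Lemma inj_tens_retract D D' (i : {linear D' -> D}) (r : {linear D -> D'})
    K F (k : {linear K -> F}) :
  cancel i r -> inj_tens D k -> inj_tens D' k.
Proof.
move=> iK kD s t st; apply: (tmapl_split_inj (W := K) iK); apply: kD.
by rewrite -!tmaplr st.
Qed.

Lemma inj_tens_iso D D' K F (k : {linear K -> F}) :
  lin_iso D D' -> inj_tens D k -> inj_tens D' k.
Proof. by case=> h /bij_inv_linear[g [hK gK]]; apply: inj_tens_retract gK. Qed.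

Lemma tens_split0 D C C' (p : {linear D -> C}) (p' : {linear D -> C'})
    (i : {linear C -> D}) (i' : {linear C' -> D}) W (t : tens D W) :
  (forall d, d = i (p d) + i' (p' d)) -> tmapl p t = 0 -> tmapl p' t = 0 -> t = 0.
Proof.
move=> dE t1 t2.
have -> : t = tmapl i (tmapl p t) + tmapl i' (tmapl p' t).
  move: t {t1 t2}; apply: (tens_additive_ext (f := idfun)
    (g := (@tmapl R C D i W \o @tmapl R D C p W) \+
          (@tmapl R C' D i' W \o @tmapl R D C' p' W))).
  by move=> d x; rewrite /= !tmaplE /= -tmulDl -dE.
by rewrite t1 t2 !raddf0 addr0.
Qed.

Lemma inj_tens_prod D D' K F (k : {linear K -> F}) :
  inj_tens D k -> inj_tens D' k -> inj_tens (D * D')%type k.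
Proof.
move=> kD kD'; apply: inj_ker0 => t kt.
apply: (@tens_split0 (D * D')%type D D' fst snd (inl_lin D D') (inr_lin D D')).
- by move=> [d d']; rewrite [RHS]surjective_pairing /= addr0 add0r.
- by apply: kD; rewrite -tmaplr kt !raddf0.
- by apply: kD'; rewrite -tmaplr kt !raddf0.
Qed.

Lemma inj_tens_factor D K F F' (k : {linear K -> F}) (v : {linear F -> F'})
    (e : {linear K -> F'}) :
  (forall x, v (k x) = e x) -> inj_tens D e -> inj_tens D k.
Proof.
move=> vk eD s t /(congr1 (tmapr v)); rewrite !tmapr_comp => st.
apply: eD; have kE : @tmapr R D _ _ e =1 tmapr (v \o k).
  by apply: (tens_additive_ext (f := tmapr e) (g := tmapr (v \o k))) => d x; rewrite /= !tmaprE /= vk.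
by rewrite !kE.
Qed.

(** An element of D (x) K that dies in D (x) F also dies in E (x) K, so it comes
    from C (x) K, where it is detected in D (x) F by the two injections. *)
Lemma inj_tens_ses C D E (i : {linear C -> D}) (q : {linear D -> E})
    K F (k : {linear K -> F}) :
  ses i q -> injective (@tmapl R C D i F) ->
  inj_tens C k -> inj_tens E k -> inj_tens D k.
Proof.
move=> [_ qS qE] iF kC kE; apply: inj_ker0 => t kt.
have /(tmapl_exact qS qE)[s st] : tmapl q t = 0.
  by apply: kE; rewrite -tmaplr kt !raddf0.
have s0 : s = 0 by apply: kC; apply: iF; rewrite !raddf0 tmaplr st.
by rewrite -st s0 raddf0.
Qed.

(** Tor_1(E, W), for E = D/C and W = F/K, computed in either variable: the
    rows and columns of the three-by-three diagram of tensor products are right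
    exact, and a nonzero kernel travels along the anti-diagonal. *)
Lemma tor_balance_l C D E (i : {linear C -> D}) (q : {linear D -> E})
    K F W (k : {linear K -> F}) (p : {linear F -> W}) :
  ses i q -> ses k p -> inj_tens D k ->
  injective (@tmapl R C D i W) -> inj_tens E k.
Proof.
move=> [_ qS qE] [_ pS pE] kD iW; apply: inj_ker0 => x kx.
have [d dx] := tmapl_surj qS x.
have /(tmapl_exact qS qE)[c cE] : tmapl q (tmapr k d) = 0 by rewrite tmaplr dx kx.
have /(tmapr_exact pS pE)[c0 c0E] : tmapr p c = 0.
  apply: iW; rewrite raddf0 tmaplr cE tmapr_comp tmapr0 // => y.
  by apply/pE; exists y.
have dE : d = tmapl i c0 by apply: kD; rewrite -tmaplr c0E cE.
by rewrite -dx dE tmapl_comp tmapl0 // => y; apply/qE; exists y.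
Qed.

Lemma tor_balance_r C D E (i : {linear C -> D}) (q : {linear D -> E})
    K F W (k : {linear K -> F}) (p : {linear F -> W}) :
  ses i q -> ses k p -> injective (@tmapl R C D i F) ->
  inj_tens E k -> injective (@tmapl R C D i W).
Proof.
move=> [_ qS qE] [_ pS pE] iF kE; apply: inj_ker0 => x ix.
have [c cx] := tmapr_surj pS x.
have /(tmapr_exact pS pE)[d dE] : tmapr p (tmapl i c) = 0 by rewrite -tmaplr cx ix.
have /(tmapl_exact qS qE)[c0 c0E] : tmapl q d = 0.
  apply: kE; rewrite raddf0 -tmaplr dE tmapl_comp tmapl0 // => y.
  by apply/qE; exists y.
have cE : c = tmapr k c0 by apply: iF; rewrite tmaplr c0E dE.
by rewrite -cx cE tmapr_comp tmapr0 // => y; apply/pE; exists y.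
Qed.

Lemma inj_tens_comparison D K F W (k : {linear K -> F}) (p : {linear F -> W})
    K' F' (k' : {linear K' -> F'}) (p' : {linear F' -> W}) :
  ses k p -> ses k' p' -> projective F' -> inj_tens D k' -> inj_tens D k.
Proof.
move=> kp kp' pF' kD; apply: inj_ker0 => t kt.
have [a0 [m [c [[mI cS cE] mE ckE]]]] := comparison_ses kp kp' pF'.
have iE : tmapr k t = tmapr c (tmapr (inl_lin K F') t).
  move: t {kt}; apply: (tens_additive_ext (f := tmapr k) (g := tmapr c \o tmapr (inl_lin K F'))).
  by move=> d x; rewrite /= !tmaprE -ckE.
have /(tmapr_exact cS cE)[s sE] : tmapr c (tmapr (inl_lin K F') t) = 0 by rewrite -iE.
have /(congr1 (tmapr snd)) := sE; rewrite !tmapr_comp [RHS]tmapr0 //.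
have -> : tmapr (snd \o m) s = tmapr k' s.
  move: (s); apply: (tens_additive_ext (f := tmapr (snd \o m)) (g := tmapr k')) => d x.
  by rewrite /= !tmaprE /= mE.
rewrite -(raddf0 (tmapr k')) => /kD s0; move: sE.
rewrite s0 raddf0 => /(congr1 (tmapr fst)); rewrite raddf0 tmapr_comp => ->.
by rewrite tmapr_id.
Qed.

Lemma inj_tens_regular K F (k : {linear K -> F}) :
  injective k <-> inj_tens (regularr R) k.
Proof.
split=> [kI s t /(congr1 (act F))|kI x y kxy].
  by rewrite !act_nat => /kI; apply: (bij_inj (act_bij K)).
have /(congr1 (act K)) : (1 : regularr R) \ot x = (1 : regularr R) \ot y.
  by apply: kI; rewrite !tmaprE kxy.
by rewrite !actE !scale1r.
Qed.
End InjTens.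

(** * Change of rings *)

Section OppositeMorphism.
Variables (R S : pzRingType) (f : {rmorphism R -> S}).
Let fc : R^c -> S^c := f.
Fact cmorph_zmod : zmod_morphism fc.
Proof. exact: (raddfB f). Qed.
Fact cmorph_monoid : monoid_morphism fc.
Proof. by split=> [|x y]; [exact: (rmorph1 f) | exact: (rmorphM f)]. Qed.
(** The same map, seen between the opposite rings. *)
Definition cmorph : {rmorphism R^c -> S^c} :=
  HB.pack fc (GRing.isZmodMorphism.Build R^c S^c fc cmorph_zmod)
    (GRing.isMonoidMorphism.Build R^c S^c fc cmorph_monoid).
End OppositeMorphism.

Section RestrictionOfMaps.
Variables (R S : pzRingType) (f : {rmorphism R -> S}).

Fact rlin_linear (U V : lmodType S) (h : {linear U -> V}) :
  linear (h : restr f U -> restr f V).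
Proof. by move=> r x y; exact: (linearP h). Qed.
Definition rlin U V h : {linear restr f U -> restr f V} := lin_of (@rlin_linear U V h).

Lemma rlin_lift (U V : lmodType S) (g : {linear restr f U -> restr f V}) :
  surj f -> exists h : {linear U -> V}, forall x, h x = g x.
Proof.
move=> fS; have L : linear (g : U -> V).
  move=> s x y; have [r <-] := fS s; exact: (linearP g).
by exists (lin_of L).
Qed.

Lemma ses_rlin (K F W : lmodType S) (i : {linear K -> F}) (p : {linear F -> W}) :
  ses i p -> ses (rlin i) (rlin p).
Proof. by []. Qed.

End RestrictionOfMaps.

Arguments rlin {R S} f {U V} h.

Section LtensMaps.
Variables (R S : pzRingType) (M : bimodType R S).
Implicit Types (K F X : lmodType S).

Lemma ltens_scaleE (r : R) (m : M) X (x : X) :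
  r *: ((m : rmod M) \ot x : ltens M X) = ((r *: m : M) : rmod M) \ot x.
Proof. exact: ltens_scale_tmul. Qed.

Definition ltens_map K F (k : {linear K -> F}) : ltens M K -> ltens M F :=
  tmapr (D := rmod M) k.
Fact ltens_map_linear K F k : linear (@ltens_map K F k).
Proof.
move=> a x y; rewrite /ltens_map raddfD; congr (_ + _).
move: x; apply: (@tens_ext S (rmod M) K (ltens M F)
  (fun x => tmapr k (a *: (x : ltens M K) : ltens M K))
  (fun x => a *: (tmapr k x : ltens M F))) => [s t|s t|s w].
- rewrite -[LHS]/(tmapr k (a *: ((s : ltens M K) + t) : ltens M K)) (scalerDr a).
  exact: raddfD.
- by rewrite raddfD; apply: (scalerDr a (tmapr k s : ltens M F)).
rewrite [X in tmapr _ X](ltens_scaleE a s w) !tmaprE.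
by rewrite [RHS](ltens_scaleE a s (k w)).
Qed.
HB.instance Definition _ K F (k : {linear K -> F}) :=
  GRing.isLinear.Build R (ltens M K) (ltens M F) _ (ltens_map k) (@ltens_map_linear K F k).

Lemma ltens_lift (X : lmodType S) (V : lmodType R) (b : rmod M -> X -> V) :
  balanced b -> (forall (r : R) (m : M) x, b (r *: m : M) x = r *: b m x) ->
  exists g : {linear ltens M X -> V}, forall (m : M) x, g ((m : rmod M) \ot x) = b m x.
Proof.
move=> bb bZ; have L : linear (tlift_of bb : ltens M X -> V).
  move=> a x y; rewrite raddfD; congr (_ + _).
  move: x; apply: (@tens_ext S (rmod M) X V
    (fun x => tlift_of bb (a *: (x : ltens M X)))
    (fun x => a *: tlift_of bb x)) => [s t|s t|s w].
  - rewrite -[LHS]/(tlift_of bb (a *: ((s : ltens M X) + t))) (scalerDr a).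
    exact: raddfD.
  - by rewrite raddfD scalerDr.
  by rewrite [X in tlift_of _ X](ltens_scaleE a s w) !tlift_ofE bZ.
by exists (lin_of L) => m x; apply: tlift_ofE.
Qed.
End LtensMaps.
Arguments ltens_map {R S} M {K F} k _.

(** S as an S-R-bimodule along f : R -> S. *)
Definition bc (R S : pzRingType) (f : {rmorphism R -> S}) : Type := S.

Section BaseChangeBimodule.
Variables (R S : pzRingType) (f : {rmorphism R -> S}).
Implicit Types (W K F P : lmodType R).
HB.instance Definition _ := GRing.Lmodule.copy (bc f) S^o.
Definition bc_rscale (s : bc f) (r : R) : bc f := (s : S) * f r.
Fact bc_rscalerA m s t : bc_rscale (bc_rscale m s) t = bc_rscale m (s * t).
Proof. by rewrite /bc_rscale rmorphM mulrA. Qed.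
Fact bc_rscaler1 m : bc_rscale m 1 = m.
Proof. by rewrite /bc_rscale rmorph1 mulr1. Qed.
Fact bc_rscalerDl s : {morph bc_rscale^~ s : m n / m + n}.
Proof. by move=> m n; apply: mulrDl. Qed.
Fact bc_rscalerDr m : {morph bc_rscale m : s t / s + t}.
Proof. by move=> s t; rewrite /bc_rscale rmorphD; apply: mulrDr. Qed.
Fact bc_rscalerAl (r : S) m s : bc_rscale (r *: m) s = r *: bc_rscale m s.
Proof. by apply/esym/mulrA. Qed.
HB.instance Definition _ := Lmodule_isBimodule.Build S R (bc f)
  bc_rscalerA bc_rscaler1 bc_rscalerDl bc_rscalerDr bc_rscalerAl.

Definition bcr : lmodType R^c := rmod (bc f).

Lemma bcr_restr : lin_iso (restr (cmorph f) (regularr S)) bcr.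
Proof.
have L : linear (id : restr (cmorph f) (regularr S) -> bcr) by [].
by exists (lin_of L); exists id.
Qed.

(** Base change S (x)_R W. *)
Definition ind (W : lmodType R) : lmodType S := ltens (bc f) W.

(** The unit of the adjunction between base change and restriction. *)
Definition ind_unit (W : lmodType R) (w : W) : restr f (ind W) :=
  ((1 : S) : bcr) \ot w.
Fact ind_unit_linear W : linear (@ind_unit W).
Proof.
move=> r x y; rewrite /ind_unit tmulDr -tmul_mid; congr (_ + _).
apply: etrans (esym (@ltens_scale_tmul _ _ (bc f) W (f r) 1 x)).
by congr (_ \ot _); rewrite -[LHS]/(1 * f r) -[RHS]/(f r * 1) mulr1 mul1r.
Qed.
HB.instance Definition _ W :=
  GRing.isLinear.Build R W (restr f (ind W)) _ (@ind_unit W) (@ind_unit_linear W).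

Fact ind_adj_linear W (V : lmodType S) (u : {linear ind W -> V}) :
  linear (fun w => u (ind_unit w) : restr f V).
Proof. by move=> r x y; rewrite linearP -[LHS]/(u _) linearP. Qed.
Definition ind_adj W V u := lin_of (@ind_adj_linear W V u).

Lemma ind_tmulE W (s : S) (w : W) : ((s : bcr) \ot w : ind W) = s *: (ind_unit w : ind W).
Proof.
rewrite [RHS](@ltens_scale_tmul _ _ (bc f) W s 1 w).
by congr (_ \ot _); rewrite -[RHS]/(s * 1) mulr1.
Qed.

Lemma ind_ext W (V : lmodType S) (g h : {linear ind W -> V}) :
  (forall w, g (ind_unit w) = h (ind_unit w)) -> g =1 h.
Proof.
move=> gh; apply: (@tens_ext R bcr W V g h) => [||s w];
  [exact: (linearD g) | exact: (linearD h) | ].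
by rewrite ind_tmulE !linearZ gh.
Qed.

Section Lift.
Variables (W : lmodType R) (V : lmodType S) (h : {linear W -> restr f V}).
Lemma ind_lift_ex : exists g : {linear ind W -> V}, forall w, g (ind_unit w) = h w.
Proof.
have bb : balanced (fun (s : rmod (bc f)) (w : W) => (s : S) *: (h w : V)).
  split=> [w s t|s w w'|s r w].
  - by rewrite -scalerDl.
  - by rewrite linearD -scalerDr.
  - by rewrite linearZ -[LHS]/((s * f r) *: (h w : V)) -scalerA.
have [r m x|g gE] := ltens_lift bb; first by rewrite scalerA.
by exists g => w; rewrite gE scale1r.
Qed.
Definition ind_lift : {linear ind W -> V} := projT1 (cid ind_lift_ex).
Lemma ind_lift_unit w : ind_lift (ind_unit w) = h w.
Proof. exact: (projT2 (cid ind_lift_ex)). Qed.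
End Lift.

Definition ind_map (K F : lmodType R) (k : {linear K -> F}) :
  {linear ind K -> ind F} := ltens_map (bc f) k.

Lemma ind_map_unit K F (k : {linear K -> F}) x :
  ind_map k (ind_unit x) = ind_unit (k x).
Proof. exact: tmaprE. Qed.

Lemma ind_unit_surj W : surj f -> surj (@ind_unit W).
Proof.
move=> fS t; elim/tens_ind: t => [|s t [x <-] [y <-]|s w].
- by exists 0; rewrite linear0.
- by exists (x + y); rewrite linearD.
- have [r <-] := fS s; exists (r *: w).
  by rewrite linearZ -[RHS]/((f r : bcr) \ot w : ind W) ind_tmulE.
Qed.

Lemma ind_ses K F W (k : {linear K -> F}) (p : {linear F -> W}) :
  ses k p -> inj_tens bcr k -> ses (ind_map k) (ind_map p).
Proof.
move=> [kI pS pE] kB; split; [exact: kB | exact: tmapr_surj | ].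
exact: (tmapr_exact pS pE).
Qed.

(** The adjunction between base change and restriction turns extension
    problems over R into extension problems over S. *)
Lemma ext_along_ind K F (k : {linear K -> F}) (U : lmodType S) :
  ext_along k (restr f U) <-> ext_along (ind_map k) U.
Proof.
split=> kU u.
- have [v vE] := kU (ind_adj u); exists (ind_lift v).
  apply: (ind_ext (g := ind_lift v \o ind_map k)) => x /=.
  by rewrite ind_map_unit ind_lift_unit vE.
- have [v vE] := kU (ind_lift u).
  by exists (ind_adj v) => x /=; rewrite -ind_map_unit vE /= ind_lift_unit.
Qed.

Lemma in_proj_ind P : in_proj P -> in_proj (ind P).
Proof.
move=> /in_proj_dual_basis[I [e [phi eE]]]; apply: dual_basis_in_proj.
have L i : linear (fun x => f (phi i x) : restr f S^o).
  by move=> r x y; rewrite linearP rmorphD rmorphM.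
exists I, (fun i => ind_unit (e i)), (fun i => ind_lift (lin_of (L i))).
have SL : linear (fun x : ind P =>
    \sum_i (ind_lift (lin_of (L i)) x : S) *: (ind_unit (e i) : ind P)).
  move=> r x y; rewrite scaler_sumr -big_split; apply: eq_bigr => i _ /=.
  by rewrite linearP scalerDl scalerA.
apply: (ind_ext (g := idfun) (h := lin_of SL)) => w /=.
rewrite {1}(eE w) linear_sum; apply: eq_bigr => i _.
by rewrite ind_lift_unit linearZ.
Qed.

Lemma fin_gen_ind W : fin_gen W -> fin_gen (ind W).
Proof.
move=> [n [e eE]]; exists n, (fun i => ind_unit (e i)) => t.
elim/tens_ind: t => [|s t [c -> ] [d ->]|s w].
- by exists (fun=> 0); rewrite big1 // => i _; rewrite scale0r.
- exists (fun i => c i + d i); rewrite -big_split; apply: eq_bigr => i _ /=.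
  by rewrite scalerDl.
have [c ->] := eE w; exists (fun i => s * f (c i)).
rewrite -[LHS]/((s : bcr) \ot _ : ind W) ind_tmulE linear_sum scaler_sumr.
by apply: eq_bigr => i _; rewrite linearZ -scalerA.
Qed.

Lemma ind_free n : exists h : {linear freemod S n -> ind (freemod R n)},
  [/\ bijective h, forall i, h (free_basis S i) = ind_unit (free_basis R i)
    & forall x : freemod R n, h [ffun i => f (x i)] = ind_unit x].
Proof.
pose h := comb (fun i => ind_unit (free_basis R i) : ind (freemod R n)).
have L : linear (fun x : freemod R n => [ffun i => f (x i)] : restr f (freemod S n)).
  move=> r x y; apply/ffunP => i.
  by rewrite !ffunE rmorphD rmorphM.
have hE (x : freemod R n) : h [ffun i => f (x i)] = ind_unit x.
  rewrite [in RHS](free_sumE x) linear_sum /h /comb.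
  by apply: eq_bigr => i _; rewrite ffunE linearZ.
exists h; split=> // [|i]; last exact: comb_basis.
exists (ind_lift (lin_of L)) => [x|].
  rewrite /h /comb linear_sum [RHS](free_sumE x); apply: eq_bigr => i _.
  rewrite linearZ /= ind_lift_unit /=; congr (_ *: _).
  by apply/ffunP => j; rewrite !ffunE rmorph_nat.
apply: (ind_ext (g := h \o ind_lift (lin_of L)) (h := idfun)) => x.
by rewrite /= ind_lift_unit -[LHS]/(h [ffun i => f (x i)]) hE.
Qed.

(** V (x)_S (S (x)_R W) = V (x)_R W for a right S-module V, naturally in V
    and W. *)
Section TensInd.
Variables (V : lmodType S^c) (W : lmodType R).
Let rV := restr (cmorph f) V.

Fact tind_balanced : balanced (fun (v : rV) (w : W) => (v : V) \ot (ind_unit w : ind W)).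
Proof.
split=> [w v v'|v w w'|v r w].
- exact: (tmulDl (v : V) v').
- by rewrite linearD; apply: (tmulDr (v : V)).
- by rewrite linearZ -(tmul_mid (f r) (v : V) (ind_unit w : ind W)).
Qed.
Definition tind := tlift_of tind_balanced.

Lemma tindE (v : V) w : tind ((v : rV) \ot w) = v \ot (ind_unit w : ind W).
Proof. exact: tlift_ofE. Qed.

Fact tind_inv1_balanced (v : V) :
  balanced (fun (s : bcr) (w : W) => (((s : S^c) *: v : V) : rV) \ot w).
Proof.
split=> [w s t|s w w'|s r w].
- by rewrite -tmulDl; congr (_ \ot _); rewrite -[RHS]scalerDl.
- by rewrite -tmulDr.
- rewrite -tmul_mid; congr (_ \ot _).
  exact: (esym (scalerA (f r : S^c) (s : S^c) v)).
Qed.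
Fact tind_inv_balanced :
  balanced (fun (v : V) (t : ind W) => tlift_of (tind_inv1_balanced v) t).
Proof.
split=> [t v v'|v t t'|v s t].
- move: t; apply: (tens_additive_ext (f := tlift_of (tind_inv1_balanced (v + v')))
    (g := tlift_of (tind_inv1_balanced v) \+ tlift_of (tind_inv1_balanced v'))) => s w.
  rewrite -[RHS]/(tlift_of (tind_inv1_balanced v) (s \ot w) +
    tlift_of (tind_inv1_balanced v') (s \ot w)) !tlift_ofE -tmulDl.
  by congr (_ \ot _); rewrite -[RHS]scalerDr.
- exact: raddfD.
- move: t; apply: (@tens_ext R bcr W (tens rV W)
    (tlift_of (tind_inv1_balanced ((s : S^c) *: v)))
    (fun t => tlift_of (tind_inv1_balanced v) (s *: (t : ind W)))) => [|t t'|s' w].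
  + exact: raddfD.
  + rewrite -[LHS]/(tlift_of (tind_inv1_balanced v) (s *: ((t : ind W) + t'))).
    by rewrite (scalerDr s); apply: raddfD.
  rewrite [X in _ = tlift_of _ X](@ltens_scale_tmul _ _ (bc f) W s s' w) !tlift_ofE.
  by congr (_ \ot _); exact: (scalerA (s' : S^c) (s : S^c) v).
Qed.

Lemma tind_bij : bijective tind.
Proof.
exists (tlift_of tind_inv_balanced).
- apply: (tens_additive_ext (f := tlift_of tind_inv_balanced \o tind) (g := idfun)) => v w.
  rewrite -[LHS]/(tlift_of tind_inv_balanced (tind (v \ot w))) tindE !tlift_ofE.
  by congr (_ \ot _); apply: (scale1r (v : V)).
- apply: (tens_additive_ext (f := tind \o tlift_of tind_inv_balanced) (g := idfun)) => v t.
  rewrite -[LHS]/(tind (tlift_of tind_inv_balanced (v \ot t))) tlift_ofE.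
  rewrite -[RHS]/(v \ot t).
  pose h : {additive ind W -> tens V (ind W)} := add_of (tmulDr v).
  move: t; apply: (tens_additive_ext (f := tind \o tlift_of (tind_inv1_balanced v))
    (g := h)) => s w.
  rewrite -[LHS]/(tind (tlift_of (tind_inv1_balanced v) (s \ot w))) tlift_ofE tindE.
  by rewrite -[RHS]/(v \ot (s \ot w : ind W)) ind_tmulE -tmul_mid.
Qed.
End TensInd.

Lemma tind_natr (V : lmodType S^c) K F (k : {linear K -> F}) t :
  tind V F (tmapr k t) = tmapr (ind_map k) (tind V K t).
Proof.
move: t; apply: (tens_additive_ext (f := tind V F \o tmapr k)
  (g := tmapr (ind_map k) \o tind V K)) => v x.
rewrite -[LHS]/(tind V F (tmapr k (v \ot x))) tmaprE tindE.
by rewrite -[RHS]/(tmapr (ind_map k) (tind V K (v \ot x))) tindE tmaprE /= ind_map_unit.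
Qed.

Lemma tind_natl (C D : lmodType S^c) (j : {linear C -> D}) W t :
  tind D W (tmapl (rlin (cmorph f) j) t) = tmapl j (tind C W t).
Proof.
move: t; apply: (tens_additive_ext (f := tind D W \o @tmapl R _ _ (rlin (cmorph f) j) W)
  (g := tmapl j (W := ind W) \o tind C W)) => v x.
rewrite -[LHS]/(tind D W (tmapl _ (v \ot x))) tmaplE tindE.
by rewrite -[RHS]/(tmapl j (tind C W (v \ot x))) tindE tmaplE.
Qed.

Lemma inj_tens_ind (V : lmodType S^c) K F (k : {linear K -> F}) :
  inj_tens (restr (cmorph f) V) k <-> inj_tens V (ind_map k).
Proof. exact: inj_conj (tind_bij V K) (tind_bij V F) (tind_natr k). Qed.

Lemma tmapl_ind_inj (C D : lmodType S^c) (j : {linear C -> D}) W :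
  injective (@tmapl R _ _ (rlin (cmorph f) j) W) <-> injective (@tmapl S C D j (ind W)).
Proof. exact: inj_conj (tind_bij C W) (tind_bij D W) (tind_natl j (W := W)). Qed.

Lemma lin_iso_ind W W' : lin_iso W W' -> lin_iso (ind W) (ind W').
Proof.
case=> h /bij_inv_linear[g [hK gK]]; exists (ind_map h); exists (ind_map g).
  apply: (ind_ext (g := ind_map g \o ind_map h) (h := idfun)) => x /=.
  by rewrite !ind_map_unit hK.
apply: (ind_ext (g := ind_map h \o ind_map g) (h := idfun)) => x /=.
by rewrite !ind_map_unit gK.
Qed.
End BaseChangeBimodule.
Arguments ind_map {R S} f {K F} k.
Arguments ind_unit {R S} f {W} w.

(** S (x)_T (T (x)_S V) is induced along pi \o iota, which is the identity. *)
Lemma ind_section (S T : pzRingType) (pi : {rmorphism T -> S})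
    (iota : {rmorphism S -> T}) (iotaK : cancel iota pi) (V : lmodType S) :
  lin_iso (ind pi (ind iota V)) V.
Proof.
have L1 : linear (id : V -> restr iota (restr pi V)).
  by move=> r x y; rewrite -[RHS]/(pi (iota r) *: (x : V) + y) iotaK.
pose g := ind_lift (ind_lift (lin_of L1)).
have L2 : linear (fun v => ind_unit pi (ind_unit iota v) : ind pi (ind iota V)).
  move=> r x y; rewrite linearP.
  rewrite -[LHS]/(ind_unit pi (iota r *: (ind_unit iota x : ind iota V) + ind_unit iota y)).
  rewrite linearP.
  by rewrite -[LHS]/(pi (iota r) *: (ind_unit pi (ind_unit iota x) : ind pi _) + _) iotaK.
exists g; exists (lin_of L2); last first.
  move=> v; rewrite -[LHS]/(g (ind_unit pi (ind_unit iota v))) /g.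
  rewrite ind_lift_unit /=.
  by rewrite ind_lift_unit.
apply: (ind_ext (g := lin_of L2 \o g) (h := idfun)) => w.
rewrite -[LHS]/(lin_of L2 (ind_lift _ (ind_unit pi w))) ind_lift_unit.
have L3 : linear (fun v : restr pi V => lin_of L2 v : restr pi (ind pi (ind iota V))).
  by move=> r x y; rewrite -[LHS]/(lin_of L2 (pi r *: (x : V) + y)) linearP.
apply: (ind_ext (g := lin_of L3 \o ind_lift (lin_of L1)) (h := @ind_unit _ _ pi _)) => v.
by rewrite -[LHS]/(lin_of L2 ((ind_lift (lin_of L1) (ind_unit iota v) : restr pi V) : V)) ind_lift_unit.
Qed.

(** * Complexes and Gorenstein projective modules *)

(** Exactness of a complex is stated at indices i + 1; this reaches all
    indices. *)
Lemma int_succ (K : int -> Prop) : (forall j, K (j + 1)) -> forall i, K i.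
Proof. by move=> KS i; rewrite -(subrK 1 i). Qed.

Section Kernels.
Variables (R : pzRingType) (P : complex R).

Definition cx_ker (i : int) : lmodType R := kermod (cx_d P i).
Definition cx_incl (i : int) : {linear cx_ker i -> P i} := val.

Lemma cx_incl_inj i : injective (cx_incl i).
Proof. exact: val_inj. Qed.

Lemma cx_inclP i x : (exists k, cx_incl i k = x) <-> cx_d P i x = 0.
Proof.
split=> [[k <-]|dx]; first by apply/eqP/(submod_valP k).
have dP : submod_pred (ker_pred (cx_d P i)) x by apply/eqP.
by exists (Submod dP).
Qed.

Lemma cx_proj_ex i : exists p : {linear P i -> cx_ker (i + 1)},
  forall x, cx_incl (i + 1) (p x) = cx_d P i x.
Proof.
by apply: factor_inj => [|x]; [exact: cx_incl_inj | apply/cx_inclP/cx_dd].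
Qed.
Definition cx_proj i := projT1 (cid (cx_proj_ex i)).
Lemma cx_projE i x : cx_incl (i + 1) (cx_proj i x) = cx_d P i x.
Proof. exact: (projT2 (cid (cx_proj_ex i))). Qed.

Hypothesis Pexact : exact_cx P.

Lemma cx_ses i : ses (cx_incl i) (cx_proj i).
Proof.
split=> [|y|x]; first exact: cx_incl_inj.
  have /Pexact[x xE] : cx_d P (i + 1) (cx_incl (i + 1) y) = 0.
    by apply/cx_inclP; exists y.
  by exists x; apply: cx_incl_inj; rewrite cx_projE.
rewrite cx_inclP -cx_projE; split=> [->|e]; first exact: linear0.
by apply: cx_incl_inj; rewrite e linear0.
Qed.

(** For an exact complex the two exactness properties can be tested one cycle
    module at a time, as vanishing of Tor_1 and Ext^1 on the next one. *)
Lemma tens_exactP (D : lmodType R^c) :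
  tens_exact P D <-> forall i, inj_tens D (cx_incl i).
Proof.
have dE i (t : tens D (P i)) :
    tmapr (cx_d P i) t = tmapr (cx_incl (i + 1)) (tmapr (cx_proj i) t).
  rewrite tmapr_comp; move: t.
  apply: (tens_additive_ext (f := tmapr (cx_d P i))
    (g := tmapr (cx_incl (i + 1) \o cx_proj i))) => d x.
  by rewrite [LHS]tmaprE [RHS]tmaprE -cx_projE.
split=> [PD|PD i t].
  do 2![apply: int_succ]; move=> i; apply: inj_ker0 => s s0.
  have [_ pS pE] := cx_ses (i + 1).
  have [t ts] := tmapr_surj pS s.
  have /PD[u uE] : tmapr (cx_d P (i + 1)) t = 0 by rewrite dE ts.
  rewrite -ts; apply/(tmapr_exact pS pE); exists (tmapr (cx_proj i) u).
  by rewrite -dE.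
have [_ qS _] := cx_ses i; have [_ pS pE] := cx_ses (i + 1).
split=> [t0|[s <-]].
  have /(tmapr_exact pS pE)[s sE] : tmapr (cx_proj (i + 1)) t = 0.
    by apply: (PD (i + 1 + 1)); rewrite -dE raddf0.
  have [u uE] := tmapr_surj qS s; exists u.
  by rewrite -[LHS]/(tmapr (cx_d P i) u) dE uE.
rewrite -[LHS]/(tmapr (cx_d P (i + 1)) (tmapr (cx_d P i) s)) tmapr_comp.
by apply: tmapr0 => x; apply: cx_dd.
Qed.

Lemma hom_exactP (U : lmodType R) :
  hom_exact P U <-> forall i, ext_along (cx_incl i) U.
Proof.
split=> [PU|PU i u].
  do 2![apply: int_succ]; move=> i u; have [_ pS pE] := cx_ses (i + 1).
  have [|v vE] := (PU i (u \o cx_proj (i + 1))).1.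
    move=> x /=; have -> : cx_proj (i + 1) (cx_d P i x) = 0.
      by apply/pE/cx_inclP/cx_dd.
    exact: linear0.
  by exists v => y; have [x <-] := pS y; rewrite cx_projE -vE.
split=> [u0|[v vE] x]; last by rewrite vE cx_dd linear0.
have [_ pS pE] := cx_ses (i + 1).
have [u' u'E] : exists u' : {linear cx_ker (i + 1 + 1) -> U},
    forall x, u' (cx_proj (i + 1) x) = u x.
  by apply: factor_surj => // x /pE/cx_inclP/Pexact[y <-].
have [v vE] := PU _ u'; exists v => y.
by rewrite -cx_projE vE u'E.
Qed.
End Kernels.

Section GorensteinProjective.
Variable R : pzRingType.
Implicit Types W X Y U V K F Q : lmodType R.

(** One step of a totally exact complex, seen on its cycles: the extension
    condition is exactness of the dual sequence. *)
Definition gp_step W W' : Prop :=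
  exists Q (i : {linear W -> Q}) (p : {linear Q -> W'}),
    [/\ in_proj Q, ses i p & ext_along i R^o].

(** Dependent choice in both directions from x0. *)
Lemma int_chain (T : Type) (C : T -> Prop) (r : T -> T -> Prop) (x0 : T) :
  C x0 -> (forall x, C x -> exists2 y, C y & r x y) ->
  (forall x, C x -> exists2 y, C y & r y x) ->
  exists w : int -> T, w 0 = x0 /\ forall i, r (w i) (w (i + 1)).
Proof.
move=> Cx rR rL.
have [|f fP] := choice (X := {x | C x}) (P := fun x y : {x | C x} => r (sval x) (sval y)).
  by case=> x Hx; have [y Cy xy] := rR x Hx; exists (exist _ y Cy).
have [|g gP] := choice (X := {x | C x}) (P := fun x y : {x | C x} => r (sval y) (sval x)).
  by case=> x Hx; have [y Cy xy] := rL x Hx; exists (exist _ y Cy).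
pose x1 : {x | C x} := exist _ x0 Cx.
exists (fun i => match i with Posz n => sval (iter n f x1)
                          | Negz n => sval (iter n.+1 g x1) end).
split=> // -[n|[|n]].
- by rewrite (_ : Posz n + 1 = Posz n.+1); [exact: fP | rewrite -PoszD addn1].
- exact: gP.
- by rewrite (_ : Negz n.+1 + 1 = Negz n) ?NegzE; [exact: gP | rewrite -[n.+2]addn1 PoszD opprD subrK].
Qed.

(** A module is Gorenstein projective as soon as it lies in a class all of
    whose members continue one step to the right and one step to the left:
    splicing these steps gives the totally exact complex. *)
Lemma gp_coind (C : lmodType R -> Prop) X :
  C X -> (forall W, C W -> exists2 W', C W' & gp_step W W') ->
  (forall W, C W -> exists2 W', C W' & gp_step W' W) ->
  gorenstein_projective X.
Proof.
move=> CX CR CL; have [w [w0 wS]] := int_chain CX CR CL.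
pose Q i := projT1 (cid (wS i)).
pose inc i : {linear w i -> Q i} := projT1 (cid (projT2 (cid (wS i)))).
pose prj i : {linear Q i -> w (i + 1)} :=
  projT1 (cid (projT2 (cid (projT2 (cid (wS i)))))).
have QP i : [/\ in_proj (Q i), ses (inc i) (prj i) & ext_along (inc i) R^o].
  exact: (projT2 (cid (projT2 (cid (projT2 (cid (wS i))))))).
have pi0 i x : prj i (inc i x) = 0.
  by have [_ [_ _ pE] _] := QP i; apply/pE; exists x.
pose d i : {linear Q i -> Q (i + 1)} := inc (i + 1) \o prj i.
have dd i x : d (i + 1) (d i x) = 0 by rewrite /d /= pi0 linear0.
have dE i x : d i x = 0 <-> exists y, inc i y = x.
  have [_ [_ _ pE] _] := QP i; have [_ [iI _ _] _] := QP (i + 1).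
  rewrite -pE /d /=; split=> [|->]; last exact: linear0.
  by rewrite -(linear0 (inc (i + 1))) => /iI.
exists (Complex dd); split=> [i||] /=; first by case: (QP i).
  split=> i u /=.
    rewrite dE; have [_ [_ pS _] _] := QP i.
    by split=> [[y <-]|[x <-]]; [have [x <-] := pS y; exists x | exists (prj i x)].
  have [_ [_ pS pE] _] := QP (i + 1); have [_ [_ qS _] _] := QP i.
  have [_ _ iE] := QP (i + 1 + 1).
  split=> [u0|[v vE] x]; last exact: etrans (vE _) (etrans (congr1 v (dd i x)) (linear0 v)).
  have [u' u'E] : exists u' : {linear w (i + 1 + 1) -> R^o},
      forall x, u' (prj (i + 1) x) = u x.
    by apply: factor_surj => // x /pE[y <-]; have [z <-] := qS y; apply: (u0 z).
  by have [v vE] := iE u'; exists v => y; rewrite -u'E -vE.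
rewrite -w0.
have [k kE] : exists k : {linear w 0 -> kermod (d 0)},
    forall x, (val : {linear kermod (d 0) -> Q 0}) (k x) = inc 0 x.
  apply: factor_inj => [|x]; first exact: val_inj.
  have dP : submod_pred (ker_pred (d 0)) (inc 0 x) by apply/eqP/dE; exists x.
  by exists (Submod dP).
have [_ [iI _ _] _] := QP 0.
exists k; apply: inj_surj_bij => [x y /(congr1 val)|x].
  by move: (kE x) (kE y) => /= -> -> /iI.
have /dE[y yE] : d 0 (val x) = 0 by apply/eqP/(submod_valP x).
by exists y; apply: val_inj; rewrite -yE -kE.
Qed.

Lemma gp_ker (P : complex R) i :
  terms_in_proj P -> totally_exact P -> gorenstein_projective (cx_ker P i).
Proof.
move=> pP [eP hP].
have stepP j : gp_step (cx_ker P j) (cx_ker P (j + 1)).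
  by exists (P j), (cx_incl P j), (cx_proj P j); split;
    [exact: pP | exact: cx_ses | exact: (hom_exactP eP _).1].
apply: (gp_coind (C := fun W => exists j, W = cx_ker P j)); first by exists i.
  by move=> W [j ->]; exists (cx_ker P (j + 1)); first exists (j + 1).
move=> W [j ->]; move: j; apply: int_succ => j.
by exists (cx_ker P j); first exists j.
Qed.

Lemma gp_iso X Y : lin_iso X Y -> gorenstein_projective X -> gorenstein_projective Y.
Proof.
move=> XY [P [pP tP XP]]; exists P; split=> //.
exact: lin_iso_trans (lin_iso_sym XY) XP.
Qed.

Lemma ses_iso_r K F W W' (k : {linear K -> F}) (p : {linear F -> W}) (h : {linear W -> W'}) :
  bijective h -> ses k p -> ses k (h \o p).
Proof.
move=> hB [kI pS pE]; split=> // [w|f] /=.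
  have [g hK gK] := hB; have [f fE] := pS (g w); exists f.
  by rewrite /= fE gK.
rewrite -pE; split=> [|->]; last exact: linear0.
by rewrite -(linear0 h) => /(bij_inj hB).
Qed.

Lemma ses_iso_l K K' F W (k : {linear K -> F}) (p : {linear F -> W}) (h : {linear K' -> K}) :
  bijective h -> ses k p -> ses (k \o h) p.
Proof.
move=> hB [kI pS pE]; split=> // [x y /kI/(bij_inj hB) //|f] /=.
rewrite pE; split=> -[x <-]; last by exists (h x).
by have [g hK gK] := hB; exists (g x); rewrite gK.
Qed.

(** The cover of X found in a totally exact complex, together with
    Ext^1(X, U) = 0 and Tor_1(D, X) = 0 for compatible U and D. *)
Lemma gp_left X : gorenstein_projective X ->
  exists K Q (k : {linear K -> Q}) (p : {linear Q -> X}),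
    [/\ in_proj Q, ses k p, gorenstein_projective K,
        forall U, semi_weakly_compatible U -> ext_along k U
      & forall D : lmodType R^c, semi_weakly_compatible_r D -> inj_tens D k].
Proof.
move=> [P [pP tP /lin_iso_sym[h hB]]]; move: (0) X h hB; apply: int_succ => j X h hB.
have [eP _] := tP.
exists (cx_ker P j), (P j), (cx_incl P j), (h \o cx_proj P j); split=> //.
- by apply: ses_iso_r => //; apply: cx_ses.
- exact: gp_ker.
- by move=> U UC; apply: (hom_exactP eP U).1 => //; apply: UC.
- by move=> D DC; apply: (tens_exactP eP D).1 => //; apply: DC.
Qed.

Lemma gp_right X : gorenstein_projective X ->
  exists Q Y (i : {linear X -> Q}) (p : {linear Q -> Y}),
    [/\ in_proj Q, ses i p & gorenstein_projective Y].
Proof.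
move=> [P [pP tP [h hB]]]; have [eP _] := tP.
exists (P 0), (cx_ker P (0 + 1)), (cx_incl P 0 \o h), (cx_proj P 0); split=> //.
  exact: (ses_iso_l (k := cx_incl P 0)) (cx_ses eP 0).
exact: gp_ker.
Qed.

Lemma fin_gen_gp X : gorenstein_projective X -> fin_gen X.
Proof.
by move=> /gp_left[K [Q [k [p [[_ Qf] [_ pS _] _ _ _]]]]]; apply: fin_gen_surj pS Qf.
Qed.

Lemma compatible_regular : semi_weakly_compatible R^o.
Proof. by move=> P _ []. Qed.

(** By comparison with the presentation found in a totally exact complex. *)
Lemma gp_ext V U K F (k : {linear K -> F}) (p : {linear F -> V}) :
  gorenstein_projective V -> semi_weakly_compatible U -> ses k p -> ext_along k U.
Proof.
move=> /gp_left[K' [Q [k' [p' [Qp kp' _ kU _]]]]] UC kp.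
exact: ext_along_comparison kp kp' Qp.1 (kU _ UC).
Qed.

(** By comparison with the presentation found in a totally exact complex. *)
Lemma gp_tor V (D : lmodType R^c) K F (k : {linear K -> F}) (p : {linear F -> V}) :
  gorenstein_projective V -> semi_weakly_compatible_r D -> ses k p -> inj_tens D k.
Proof.
move=> /gp_left[K' [Q [k' [p' [Qp kp' _ _ kD]]]]] DC kp.
exact: inj_tens_comparison kp kp' Qp.1 (kD _ DC).
Qed.

Lemma in_proj_zero : in_proj (zero_mod R).
Proof.
apply: dual_basis_in_proj; exists 'I_0, (fun=> 0), (fun=> \0) => -[].
by rewrite big_ord0.
Qed.

Lemma gp_proj Q : in_proj Q -> gorenstein_projective Q.
Proof.
move=> Qp; apply: (gp_coind (C := @in_proj R)) => // {Qp}Q Qp.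
  exists (zero_mod R); first exact: in_proj_zero.
  exists Q, idfun, \0; split=> //; last by move=> u; exists u.
  split=> // [[]|f]; first by exists 0.
  by split=> // _; exists f.
exists (zero_mod R); first exact: in_proj_zero.
exists Q, \0, idfun; split=> //; last by move=> u; exists \0 => -[]; rewrite /= (linear0 u).
split=> [[] [] //|x|f] /=; first by exists x.
by split=> [->|[_ <-] //]; exists 0.
Qed.

Lemma pair_linear X Y X' Y' (f : {linear X -> X'}) (g : {linear Y -> Y'}) :
  linear (fun z : X * Y => (f z.1, g z.2)).
Proof. by move=> r x y; rewrite /= !linearP. Qed.
Definition pair_lin X Y X' Y' f g := lin_of (@pair_linear X Y X' Y' f g).

Lemma ses_prod K F W K' F' W' (k : {linear K -> F}) (p : {linear F -> W})
    (k' : {linear K' -> F'}) (p' : {linear F' -> W'}) :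
  ses k p -> ses k' p' -> ses (pair_lin k k') (pair_lin p p').
Proof.
move=> [kI pS pE] [kI' pS' pE']; split=> [[x y] [x' y'] [/kI-> /kI'-> //]|[x y]|[x y]].
  by have [a <-] := pS x; have [b <-] := pS' y; exists (a, b).
split=> [[/pE[a <-] /pE'[b <-]]|[[a b] [<- <-]]]; first by exists (a, b).
by congr (_, _); [apply/pE; exists a | apply/pE'; exists b].
Qed.

Lemma gp_step_prod X Y X' Y' : gp_step X X' -> gp_step Y Y' ->
  gp_step (X * Y)%type (X' * Y')%type.
Proof.
move=> [Q [i [p [Qp ip iE]]]] [Q' [i' [p' [Qp' ip' iE']]]].
exists (Q * Q')%type, (pair_lin i i'), (pair_lin p p'); split.
- exact: in_proj_prod.
- exact: ses_prod.
move=> u; have [v vE] := iE (u \o inl_lin X Y); have [v' vE'] := iE' (u \o inr_lin X Y).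
exists ((v \o fst) \+ (v' \o snd)) => -[x y] /=.
by rewrite vE vE' /= -linearD [X in u X]surjective_pairing /= addr0 add0r.
Qed.

Lemma gp_step_right X : gorenstein_projective X ->
  exists2 Y, gorenstein_projective Y & gp_step X Y.
Proof.
move=> /gp_right[Q [Y [i [p [Qp ip gY]]]]]; exists Y => //.
by exists Q, i, p; split=> //; apply: gp_ext gY compatible_regular ip.
Qed.

Lemma gp_step_left X : gorenstein_projective X ->
  exists2 Y, gorenstein_projective Y & gp_step Y X.
Proof.
move=> gX; have /gp_left[Y [Q [i [p [Qp ip gY _ _]]]]] := gX; exists Y => //.
by exists Q, i, p; split=> //; apply: gp_ext gX compatible_regular ip.
Qed.

Lemma gp_prod X Y : gorenstein_projective X -> gorenstein_projective Y ->
  gorenstein_projective (X * Y)%type.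
Proof.
move=> gX gY; apply: (gp_coind (C := fun W => exists X Y,
  [/\ W = (X * Y)%type, gorenstein_projective X & gorenstein_projective Y])).
- by exists X, Y.
- move=> W [X1 [Y1 [-> /gp_step_right[X2 gX2 sX] /gp_step_right[Y2 gY2 sY]]]].
  by exists (X2 * Y2)%type; [exists X2, Y2 | exact: gp_step_prod].
- move=> W [X1 [Y1 [-> /gp_step_left[X2 gX2 sX] /gp_step_left[Y2 gY2 sY]]]].
  by exists (X2 * Y2)%type; [exists X2, Y2 | exact: gp_step_prod].
Qed.

(** Used to replace projective terms by free ones. *)
Lemma in_proj_complement Q : in_proj Q ->
  exists n Q' (s : {linear Q -> freemod R n}) (r : {linear freemod R n -> Q})
    (s' : {linear Q' -> freemod R n}) (r' : {linear freemod R n -> Q'}),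
    in_proj Q' /\
    [/\ cancel s r, cancel s' r', forall x, x = s (r x) + s' (r' x),
        forall x, r (s' x) = 0 & forall x, r' (s x) = 0].
Proof.
move=> /in_proj_free_retract[n [s [r sK]]]; exists n.
have rS : surj r by move=> x; exists (s x).
have [Q' [s' [s'I _ s'E]]] := ses_ker rS.
have [r' r'E] : exists r' : {linear freemod R n -> Q'},
    forall x, s' (r' x) = (idfun \- (s \o r)) x.
  by apply: factor_inj => // x; apply/s'E; rewrite /= linearB sK subrr.
exists Q', s, r, s', r'.
have rs' x : r (s' x) = 0 by apply/s'E; exists x.
have s'K : cancel s' r' by move=> x; apply: s'I; rewrite r'E /= rs' linear0 subr0.
split; first exact: in_proj_retract s'K (in_proj_free R n).
split=> // x.
  by rewrite r'E /= addrC subrK.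
by apply: s'I; rewrite r'E /= sK subrr linear0.
Qed.

(** Adding a complement of the projective middle term to it and to Y makes it
    free; free modules, unlike projective ones, lift along a surjection of
    rings. *)
Lemma gp_free_right X : gorenstein_projective X ->
  exists n Y (i : {linear X -> freemod R n}) (p : {linear freemod R n -> Y}),
    ses i p /\ gorenstein_projective Y.
Proof.
move=> /gp_right[Q [Y [i [p [Qp [iI pS pE] gY]]]]].
have [n [Q' [s [r [s' [r' [Qp' [sK s'K srE rs' r's]]]]]]]] := in_proj_complement Qp.
have L : linear (fun x => (p (r x), r' x)) by move=> a x y; rewrite !linearP.
exists n, (Y * Q')%type, (s \o i), (lin_of L).
split; last by apply: gp_prod => //; apply: gp_proj.
split=> [x y /= /(can_inj sK)/iI //|[y q] |x] /=.
  have [x xE] := pS y; exists (s x + s' q).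
  by rewrite !linearD sK rs' linear0 addr0 r's s'K add0r xE.
split=> [[/pE[y yE] r0]|[y <-]]; first by exists y; rewrite yE [RHS]srE r0 linear0 addr0.
by rewrite sK r's; congr (_, _); apply/pE; exists y.
Qed.

Lemma gp_free_left X : gorenstein_projective X ->
  exists n Y (i : {linear Y -> freemod R n}) (p : {linear freemod R n -> X}),
    ses i p /\ gorenstein_projective Y.
Proof.
move=> /gp_left[Y [Q [i [p [Qp [iI pS pE] gY _ _]]]]].
have [n [Q' [s [r [s' [r' [Qp' [sK s'K srE rs' r's]]]]]]]] := in_proj_complement Qp.
have L : linear (fun z : Y * Q' => s (i z.1) + s' z.2).
  by move=> a x y; rewrite /= !linearP scalerDr addrACA.
exists n, (Y * Q')%type, (lin_of L), (p \o r).
split; last by apply: gp_prod => //; apply: gp_proj.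
split=> [[y q] [y' q'] /= e|x|x] /=.
- have := congr1 r e; rewrite !linearD !sK !rs' !addr0 => /iI->.
  by have := congr1 r' e; rewrite !linearD !r's !s'K !add0r => ->.
- by have [q <-] := pS x; exists (s q); rewrite sK.
split=> [/pE[y yE]|[[y q] <-]]; first by exists (y, r' x); rewrite /= yE -srE.
by rewrite linearD sK rs' addr0; apply/pE; exists y.
Qed.
End GorensteinProjective.

(** * Base change of complexes *)

Lemma tens_exact_transport (R R' : pzRingType) (P : complex R) (P' : complex R')
    (D : lmodType R^c) (D' : lmodType R'^c)
    (h : forall i, {additive tens D (P i) -> tens D' (P' i)}) :
  (forall i, bijective (h i)) ->
  (forall i t, h (i + 1) (tmapr (cx_d P i) t) = tmapr (cx_d P' i) (h i t)) ->
  (tens_exact P D <-> tens_exact P' D').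
Proof.
move=> hB hd.
have E i t : tmapr (cx_d P i) t = 0 <-> tmapr (cx_d P' i) (h i t) = 0.
  rewrite -hd; split=> [->|]; first exact: raddf0.
  by rewrite -(raddf0 (h (i + 1))) => /(bij_inj (hB _)).
have I i t : (exists s, tmapr (cx_d P i) s = t) <->
    (exists s, tmapr (cx_d P' i) s = h (i + 1) t).
  split=> -[s]; first by move=> <-; exists (h i s); rewrite hd.
  have [g _ gK] := hB i; rewrite -(gK s) -hd.
  by move=> /(bij_inj (hB _)) <-; exists (g s).
split=> PD i t; last by apply: iff_trans (E _ _) (iff_trans _ (iff_sym (I _ _))); apply: PD.
have [g _ gK] := hB (i + 1); rewrite -(gK t).
by apply: iff_trans (iff_sym (E _ _)) (iff_trans _ (I _ _)); apply: PD.
Qed.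

Section ComplexBaseChange.
Variables (R S : pzRingType) (f : {rmorphism R -> S}) (P : complex R).

Fact ind_cx_dd (i : int) x :
  (ind_map f (cx_d P (i + 1))) (ind_map f (cx_d P i) x) = 0.
Proof.
by apply: etrans (tmapr_comp (D := bcr f) _ _ x) _; apply: tmapr0 => y; apply: cx_dd.
Qed.
Definition ind_cx : complex S :=
  Complex (cx_d := fun i => ind_map f (cx_d P i) : {linear _ -> _}) ind_cx_dd.

Lemma hom_exact_ind (V : lmodType S) :
  hom_exact P (restr f V) <-> hom_exact ind_cx V.
Proof.
split=> PV i u.
- split=> [u0|[v vE] x]; last by rewrite vE (cx_dd (c := ind_cx)) linear0.
  have [|v vE] := (PV i (ind_adj u)).1.
    move=> x; rewrite -[LHS]/(u (ind_unit f (cx_d P i x))) -ind_map_unit.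
    exact: u0.
  exists (ind_lift v).
  apply: (ind_ext (g := u) (h := ind_lift v \o ind_map f (cx_d P (i + 1)))) => x /=.
  by rewrite ind_map_unit ind_lift_unit -vE.
split=> [u0|[v vE] x]; last by rewrite vE cx_dd linear0.
have [|v vE] := (PV i (ind_lift u)).1.
  move=> x; rewrite -[RHS]/((\0 : {linear ind f (P i) -> V}) x).
  apply: (ind_ext (g := ind_lift u \o ind_map f (cx_d P i))) => y /=.
  by rewrite ind_map_unit ind_lift_unit u0.
exists (ind_adj v) => y; rewrite -[RHS]/(v (ind_unit f (cx_d P (i + 1) y))).
by rewrite -ind_map_unit -[ind_map _ _ _]/(cx_d ind_cx (i + 1) _) -vE /= ind_lift_unit.
Qed.

Lemma tens_exact_ind (V : lmodType S^c) :
  tens_exact P (restr (cmorph f) V) <-> tens_exact ind_cx V.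
Proof.
apply: (@tens_exact_transport R S P ind_cx (restr (cmorph f) V) V
  (fun i => tind f V (P i))) => i.
  exact: tind_bij.
exact: tind_natr.
Qed.

Hypotheses (pP : terms_in_proj P) (tP : totally_exact P).
Hypotheses (PS : tens_exact P (restr (cmorph f) (regularr S)))
  (PS' : hom_exact P (restr f S^o)).

Lemma ind_cx_proj : terms_in_proj ind_cx.
Proof. by move=> i; apply: in_proj_ind. Qed.

(** Tor_1(S, -) vanishes on the cycles of P, so base change commutes with
    taking cycles. *)
Lemma inj_tens_bcr i : inj_tens (bcr f) (cx_incl P i).
Proof.
apply: inj_tens_iso (bcr_restr f) _.
exact: (tens_exactP tP.1 _).1.
Qed.

Lemma ind_cx_total : totally_exact ind_cx.
Proof.
split; last exact/hom_exact_ind.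
have [eP _] := tP; apply: (_ : tens_exact P (bcr f)).
by apply/(tens_exactP eP) => i; apply: inj_tens_bcr.
Qed.

Lemma gp_ind_ker i : gorenstein_projective (ind f (cx_ker P i)).
Proof.
have [eP _] := tP.
apply: gp_iso (gp_ker i ind_cx_proj ind_cx_total); apply: lin_iso_sym.
have dE x : cx_d ind_cx i x = ind_map f (cx_incl P (i + 1)) (ind_map f (cx_proj P i) x).
  rewrite -[RHS]/((ind_map f (cx_incl P (i + 1)) \o ind_map f (cx_proj P i)) x).
  apply: (ind_ext (g := cx_d ind_cx i)) => y.
  by rewrite [LHS]ind_map_unit [RHS]/= !ind_map_unit cx_projE.
have [iI iS iE] := ind_ses (cx_ses eP i) (inj_tens_bcr (i := i)).
have [k kE] : exists k : {linear ind f (cx_ker P i) -> cx_ker ind_cx i},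
    forall x, cx_incl ind_cx i (k x) = ind_map f (cx_incl P i) x.
  apply: factor_inj => [|x]; first exact: cx_incl_inj.
  apply/cx_inclP; rewrite dE; have -> : ind_map f (cx_proj P i) (ind_map f (cx_incl P i) x) = 0.
    by apply/iE; exists x.
  exact: linear0.
exists k; apply: inj_surj_bij => [x y e|y].
  by apply: iI; apply: etrans (esym (kE x)) (etrans (congr1 _ e) (kE y)).
have d0 : cx_d ind_cx i (cx_incl ind_cx i y) = 0 by apply/cx_inclP; exists y.
have /iE[x xE] : ind_map f (cx_proj P i) (cx_incl ind_cx i y) = 0.
  apply: (inj_tens_bcr (i := i + 1)); rewrite raddf0.
  exact: etrans (esym (dE _)) d0.
by exists x; apply: cx_incl_inj; rewrite kE.
Qed.
End ComplexBaseChange.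

(** * Split ring extensions *)

Section RingMapLinear.
Variables (R S : pzRingType) (f : {rmorphism R -> S}).
Fact ringmap_l_linear : linear (f : R^o -> restr f S^o).
Proof. by move=> r x y; rewrite rmorphD rmorphM. Qed.
Definition ringmap_l : {linear R^o -> restr f S^o} := lin_of ringmap_l_linear.
Fact ringmap_r_linear : linear (f : regularr R -> restr (cmorph f) (regularr S)).
Proof. by move=> r x y; rewrite rmorphD rmorphM. Qed.
Definition ringmap_r : {linear regularr R -> restr (cmorph f) (regularr S)} :=
  lin_of ringmap_r_linear.
End RingMapLinear.

(** With the module structures of U and V as arguments, types of maps between
    iterated restrictions are compared through these structures alone. *)
Definition linmap (R : pzRingType) (U V : lmodType R) : Type := {linear U -> V}.

(** A split ring extension T = S + J whose kernel J has a two-step filtration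
    J > I with I and G = J/I killed by J, hence S-modules.  The data are recorded
    once for left and once for right modules.  The retractions split the
    filtration over S: G and I are left S-summands of T, and I is a right
    S-summand of J. *)
Record splitExt (T S : pzRingType) := SplitExt {
  se_pi : {rmorphism T -> S};
  se_iota : {rmorphism S -> T};
  se_piK : cancel se_iota se_pi;
  se_Jl : lmodType T; se_Gl : lmodType S; se_Il : lmodType S;
  se_jl : {linear se_Jl -> T^o};
  se_il : {linear restr se_pi se_Il -> se_Jl};
  se_ql : {linear se_Jl -> restr se_pi se_Gl};
  se_jlP : ses se_jl (ringmap_l se_pi);
  se_ilP : ses se_il se_ql;
  se_Gl_in : {linear se_Gl -> restr se_iota T^o};
  se_Gl_out : {linear restr se_iota T^o -> se_Gl};
  se_GlK : cancel se_Gl_in se_Gl_out;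
  se_Il_in : {linear se_Il -> restr se_iota T^o};
  se_Il_out : {linear restr se_iota T^o -> se_Il};
  se_IlK : cancel se_Il_in se_Il_out;
  se_Jr : lmodType T^c; se_Gr : lmodType S^c; se_Ir : lmodType S^c;
  se_jr : {linear se_Jr -> regularr T};
  se_ir : {linear restr (cmorph se_pi) se_Ir -> se_Jr};
  se_qr : {linear se_Jr -> restr (cmorph se_pi) se_Gr};
  se_jrP : ses se_jr (ringmap_r se_pi);
  se_irP : ses se_ir se_qr;
  se_ir_out : linmap (restr (cmorph se_iota) se_Jr)
                     (restr (cmorph se_iota) (restr (cmorph se_pi) se_Ir));
  se_irK : cancel (rlin (cmorph se_iota) se_ir) se_ir_out }.

Section SplitExtension.
Variables (T S : pzRingType) (E : splitExt T S).
Local Notation pi := (se_pi E).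
Local Notation iota := (se_iota E).
Local Notation Jl := (se_Jl E).
Local Notation Gl := (se_Gl E).
Local Notation Il := (se_Il E).
Local Notation Jr := (se_Jr E).
Local Notation Gr := (se_Gr E).
Local Notation Ir := (se_Ir E).
Local Notation jr := (se_jr E).
Local Notation ir := (se_ir E).
Local Notation rS := (restr (cmorph pi) (regularr S)).
Implicit Types (W K F Z : lmodType T).

(** The second clause is Tor_1(S, W) = 0. *)
Definition good W : Prop :=
  gorenstein_projective (ind pi W) /\ injective (tmapl jr (W := W)).
(** The graded pieces of W along T > J > I are those of T tensored with W/JW. *)
Definition strong W : Prop := good W /\ injective (tmapl ir (W := W)).

Definition ext_compatible : Prop :=
  [/\ semi_weakly_compatible Gl, semi_weakly_compatible Il,
      semi_weakly_compatible_r Gr & semi_weakly_compatible_r Ir].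

(** By adjunction Hom_T(Q, S) is the dual over S of the base change of Q, so
    this says that base change along T -> S preserves total exactness. *)
Definition quotient_exact : Prop := forall Q : complex T,
  terms_in_proj Q -> totally_exact Q -> tens_exact Q rS /\ hom_exact Q (restr pi S^o).

Lemma pi_surj : surj pi.
Proof. by move=> s; exists (iota s); apply: se_piK. Qed.

(** The projection t - iota (pi t) of T onto J is right linear over S. *)
Lemma se_jr_split :
  exists r : {linear restr (cmorph iota) (regularr T) -> restr (cmorph iota) Jr},
    cancel (rlin (cmorph iota) jr) r.
Proof.
have L : linear (fun t : restr (cmorph iota) (regularr T) =>
    (t - iota (pi t)) : restr (cmorph iota) (regularr T)).
  move=> s t t'; rewrite -[s *: t]/((t : T) * iota s) rmorphD rmorphM se_piK.
  rewrite rmorphD rmorphM -[RHS]/(((t : T) - iota (pi t)) * iota s + (t' - iota (pi t'))).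
  by rewrite mulrBl opprD addrACA.
have [jI jS jE] := se_jrP E.
have [r rE] : exists r : {linear restr (cmorph iota) (regularr T) -> restr (cmorph iota) Jr},
    forall t, rlin (cmorph iota) jr (r t) = lin_of L t.
  apply: factor_inj => // t; apply/(jE (t - iota (pi t))).
  by rewrite /= rmorphB se_piK subrr.
exists r => x; apply: jI; rewrite -[LHS]/(rlin (cmorph iota) jr _) rE.
have px : pi (jr x) = 0 by apply/(jE (jr x)); exists x.
by rewrite -[LHS]/((jr x : T) - iota (pi (jr x))) px rmorph0 subr0.
Qed.

Lemma tmapl_lin_iso (C D : lmodType T^c) (j : {linear C -> D}) W W' :
  lin_iso W W' -> injective (tmapl j (W := W)) -> injective (tmapl j (W := W')).
Proof.
case=> h /bij_inv_linear[g [hK gK]] jI s t /(congr1 (tmapr g)).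
rewrite -!tmaplr => /jI/(congr1 (tmapr h)); rewrite !tmapr_comp.
by rewrite !tmapr_id.
Qed.

Lemma good_iso W W' : lin_iso W W' -> good W -> good W'.
Proof.
move=> WW' [gW jW]; split; last exact: tmapl_lin_iso WW' jW.
exact: gp_iso (lin_iso_ind pi WW') gW.
Qed.

Lemma strong_iso W W' : lin_iso W W' -> strong W -> strong W'.
Proof.
by move=> WW' [gW iW]; split; [exact: good_iso gW | exact: tmapl_lin_iso iW].
Qed.

(** Balancing Tor_1(S, W): the kernel of J (x) W -> T (x) W is also the kernel on
    presentations of W. *)
Lemma good_inj_S W K F (k : {linear K -> F}) (p : {linear F -> W}) :
  good W -> ses k p -> inj_tens rS k.
Proof.
move=> [_ jW] kp; apply: tor_balance_l (se_jrP E) (kp) _ jW.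
by apply/inj_tens_regular; case: kp.
Qed.

Lemma good_ses W K F (k : {linear K -> F}) (p : {linear F -> W}) :
  good W -> ses k p -> ses (ind_map pi k) (ind_map pi p).
Proof.
move=> gW kp; apply: ind_ses => //.
exact: inj_tens_iso (bcr_restr pi) (good_inj_S gW kp).
Qed.

(** Hence Tor_1 and Ext^1 between W and modules over S may be computed over S. *)
Lemma good_tor W K F (k : {linear K -> F}) (p : {linear F -> W}) (D : lmodType S^c) :
  good W -> ses k p -> semi_weakly_compatible_r D ->
  inj_tens (restr (cmorph pi) D) k.
Proof.
move=> gW kp DC; apply/inj_tens_ind; exact: gp_tor gW.1 DC (good_ses gW kp).
Qed.

Lemma good_ext W K F (k : {linear K -> F}) (p : {linear F -> W}) (U : lmodType S) :
  good W -> ses k p -> semi_weakly_compatible U -> ext_along k (restr pi U).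
Proof.
move=> gW kp UC; apply/ext_along_ind; exact: gp_ext gW.1 UC (good_ses gW kp).
Qed.

Lemma flat_jr F : in_proj F -> injective (tmapl jr (W := F)).
Proof. by move=> pF; apply: flat_of_proj => //; case: (se_jrP E). Qed.
Lemma flat_ir F : in_proj F -> injective (tmapl ir (W := F)).
Proof. by move=> pF; apply: flat_of_proj => //; case: (se_irP E). Qed.

Lemma inj_tens_Jr K F (k : {linear K -> F}) : in_proj F ->
  inj_tens (restr (cmorph pi) Ir) k -> inj_tens (restr (cmorph pi) Gr) k ->
  inj_tens Jr k.
Proof. by move=> pF; apply: inj_tens_ses (se_irP E) (flat_ir pF). Qed.

Lemma inj_tmapl_of (C D : lmodType T^c) (j : {linear C -> D}) K F (k : {linear K -> F}) :
  injective (tmapl j (W := F)) -> inj_tens C k -> injective (tmapl j (W := K)).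
Proof.
move=> jF kC s t /(congr1 (tmapr k)); rewrite -!tmaplr => /jF; exact: kC.
Qed.

(** A module killed by base change to S is zero: T has a finite filtration by
    right S-modules. *)
Lemma ind_zero Z : (forall x : ind pi Z, x = 0) -> forall z : Z, z = 0.
Proof.
move=> Z0.
have S0 (D : lmodType S^c) (t : tens (restr (cmorph pi) D) Z) : t = 0.
  apply: (bij_inj (tind_bij pi D Z)); rewrite raddf0; move: (tind _ _ _ _).
  elim/tens_ind => [|s s' -> ->|d x] //; first exact: addr0.
  by rewrite (Z0 x) tmul0r.
have J0 (t : tens Jr Z) : t = 0.
  have [_ qS qE] := se_irP E.
  have /(tmapl_exact qS qE)[s <-] := S0 _ (tmapl (se_qr E) t).
  by rewrite (S0 _ s) raddf0.
have T0 (t : tens (regularr T) Z) : t = 0.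
  have [_ qS qE] := se_jrP E.
  have /(tmapl_exact qS qE)[s <-] := S0 _ (tmapl (ringmap_r pi) t).
  by rewrite (J0 s) raddf0.
move=> z; have := congr1 (act Z) (T0 ((1 : regularr T) \ot z)).
by rewrite actE scale1r raddf0.
Qed.

Lemma ind_surj_surj F W (p : {linear F -> W}) : surj (ind_map pi p) -> surj p.
Proof.
move=> pS; have [Z [c [cS cE]]] := coker_ex p.
suff Z0 : forall z : Z, z = 0 by move=> w; apply/cE/Z0.
apply: ind_zero => x; have [y <-] := tmapr_surj cS x.
have [z <-] := pS y; rewrite -[LHS]/(tmapr c (tmapr p z)) tmapr_comp.
by apply: tmapr0 => f; apply/cE; exists f.
Qed.

Section Compatible.
Hypothesis compat : ext_compatible.

Lemma good_ext_T W K F (k : {linear K -> F}) (p : {linear F -> W}) :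
  good W -> ses k p -> in_proj F -> ext_along k Jl /\ ext_along k T^o.
Proof.
have [cGl cIl _ _] := compat; move=> gW kp [pF _].
have kJ : ext_along k Jl.
  by apply: ext_along_ses (se_ilP E) pF _ _; apply: good_ext kp _.
split=> //; apply: ext_along_ses (se_jlP E) pF kJ _.
exact: good_ext kp (compatible_regular (R := S)).
Qed.

(** A free cover of the base change of W lifts to W: it remains surjective as
    J is nilpotent, and its kernel is good because Tor_1(J/I, W) and Tor_1(I, W)
    vanish. *)
Lemma good_cover W : good W ->
  exists n K (k : {linear K -> freemod T n}) (p : {linear freemod T n -> W}),
    ses k p /\ good K.
Proof.
move=> gW; have [n [Y [i [q [iq gY]]]]] := gp_free_left gW.1.
have [theta [thB thE _]] := ind_free pi n.
have [w wE] := choice (fun j => ind_unit_surj pi_surj (q (free_basis S j) : ind pi W)).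
pose p : {linear freemod T n -> W} := comb w.
have pq x : ind_map pi p (theta x) = q x.
  move: x; apply: (freemod_ext (g := ind_map pi p \o theta)) => j.
  by rewrite [LHS]/= thE ind_map_unit /p /= comb_basis wE.
have pS : surj p.
  apply: ind_surj_surj => x; have [_ qS _] := iq; have [y <-] := qS x.
  by exists (theta y); rewrite pq.
have [K [k kp]] := ses_ker pS; exists n, K, k, p; split=> //.
have pF := in_proj_free T n.
split; first exact: gp_iso (lin_iso_sym (ses_ker_iso (good_ses gW kp) iq thB pq)) gY.
have [_ _ cGr cIr] := compat.
by apply: (inj_tmapl_of (k := k)); [exact: flat_jr |
  apply: inj_tens_Jr => //; apply: good_tor kp _].
Qed.

(** An embedding of the base change of W into a free module, with Gorenstein
    projective cokernel, lifts along T -> S because Ext^1(W, J) = 0. *)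
Lemma good_embed W : good W ->
  exists n Z (h : {linear W -> freemod T n}) (c : {linear freemod T n -> Z}),
    ses h c /\ good Z.
Proof.
move=> gW; have [n0 [K [k [p [kp _]]]]] := good_cover gW.
have [kJ _] := good_ext_T gW kp (in_proj_free T n0).
have [n [Y [i [q [iq gY]]]]] := gp_free_right gW.1.
have [theta [thB _ thE]] := ind_free pi n.
have L j : linear (fun x => free_coord j (i (ind_unit pi x)) : restr pi S^o).
  by move=> r x y; rewrite linearP -[X in free_coord j X]/(i (_ *: _ + _)) !linearP.
(* Each coordinate W -> S of i lifts to T because Ext^1(W, J) = 0. *)
have [g gE] := choice (fun j => lift_of_ext kp (se_jlP E) (in_proj_free T n0).1 kJ (lin_of (L j))).
have hL : linear (fun x => [ffun j => g j x] : freemod T n).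
  by move=> r x y; apply/ffunP => j; rewrite !ffunE linearP.
pose h := lin_of hL.
have hE x : theta (i x) = ind_map pi h x.
  move: x; apply: (ind_ext (g := theta \o i)) => x; rewrite [RHS]ind_map_unit -thE.
  rewrite [LHS]/=; congr (theta _); apply/ffunP => j; rewrite !ffunE.
  exact: esym (gE j x).
have [Z [c [cS cE]]] := coker_ex h.
have indh : ses (ind_map pi h) (ind_map pi c).
  split; [|exact: tmapr_surj|exact: tmapr_exact cS cE].
  have [iI _ _] := iq; move=> x y e; apply/iI/(bij_inj thB).
  by apply: etrans (hE x) (etrans e (esym (hE y))).
have gZ : gorenstein_projective (ind pi Z).
  exact: gp_iso (ses_coker_iso iq indh thB hE) gY.
have [_ _ cGr cIr] := compat; have pF := in_proj_free T n.
have hS : inj_tens rS h by apply/inj_tens_ind/inj_tens_regular; case: indh.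
have hI : injective h.
  apply/inj_tens_regular; apply: inj_tens_ses (se_jrP E) (flat_jr pF) _ hS.
  by apply: inj_tens_Jr => //; apply/inj_tens_ind; apply: gp_tor gZ _ indh.
have hc : ses h c by [].
exists n, Z, h, c; split=> //; split=> //.
exact: tor_balance_r (se_jrP E) hc (flat_jr pF) hS.
Qed.

(** Good modules continue by one step in both directions. *)
Theorem gp_of_good W : good W -> gorenstein_projective W.
Proof.
move=> gW; apply: (gp_coind (C := good)) => // {gW}W gW.
- have [n [Z [h [c [hc gZ]]]]] := good_embed gW; exists Z => //.
  exists (freemod T n), h, c; split=> //; first exact: in_proj_free.
  by have [] := good_ext_T gZ hc (in_proj_free T n).
- have [n [K [k [p [kp gK]]]]] := good_cover gW; exists K => //.
  exists (freemod T n), k, p; split=> //; first exact: in_proj_free.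
  by have [] := good_ext_T gW kp (in_proj_free T n).
Qed.

Hypothesis qexact : quotient_exact.

Lemma quotient_tens (Q : complex T) (D : lmodType S^c) :
  terms_in_proj Q -> totally_exact Q -> semi_weakly_compatible_r D ->
  tens_exact Q (restr (cmorph pi) D).
Proof.
move=> pQ tQ DC; have [QS QS'] := qexact pQ tQ; apply/tens_exact_ind.
by apply: DC; [exact: ind_cx_proj | exact: ind_cx_total].
Qed.

Lemma quotient_hom (Q : complex T) (U : lmodType S) :
  terms_in_proj Q -> totally_exact Q -> semi_weakly_compatible U ->
  hom_exact Q (restr pi U).
Proof.
move=> pQ tQ UC; have [QS QS'] := qexact pQ tQ; apply/hom_exact_ind.
by apply: UC; [exact: ind_cx_proj | exact: ind_cx_total].
Qed.

(** The Tor groups involved are read off a totally exact complex over T, whose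
    base change to S is again totally exact. *)
Theorem strong_of_gp W : gorenstein_projective W -> strong W.
Proof.
move=> [Q [pQ tQ WQ]]; apply: strong_iso (lin_iso_sym WQ) _.
have [QS QS'] := qexact pQ tQ; have [eQ _] := tQ.
have [_ _ cGr cIr] := compat.
have QI : inj_tens (restr (cmorph pi) Ir) (cx_incl Q 0).
  exact: (tens_exactP eQ _).1 (quotient_tens pQ tQ cIr) 0.
have QG : inj_tens (restr (cmorph pi) Gr) (cx_incl Q 0).
  exact: (tens_exactP eQ _).1 (quotient_tens pQ tQ cGr) 0.
split; first split.
- exact: gp_ind_ker.
- apply: (inj_tmapl_of (k := cx_incl Q 0)); first exact: flat_jr.
  exact: inj_tens_Jr.
- by apply: (inj_tmapl_of (k := cx_incl Q 0)); first exact: flat_ir.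
Qed.
End Compatible.

Section Converse.
Hypothesis strongP : forall W, fin_gen W -> (gorenstein_projective W <-> strong W).

Lemma gp_strong W : gorenstein_projective W -> strong W.
Proof. by move=> gW; apply/strongP => //; apply: fin_gen_gp. Qed.

(** The cycles of Q are Gorenstein projective, hence good, so Tor_1(S, -) and
    Ext^1(-, S) vanish on them. *)
Theorem quotient_exact_of_strong : quotient_exact.
Proof.
move=> Q pQ tQ; have [eQ _] := tQ.
have sQ i : good (cx_ker Q i) by have [] := gp_strong (gp_ker i pQ tQ).
split; first by apply/(tens_exactP eQ) => i; apply: good_inj_S (sQ (i + 1)) (cx_ses eQ i).
apply/(hom_exactP eQ) => i; apply: good_ext (sQ (i + 1)) (cx_ses eQ i) _.
exact: compatible_regular.
Qed.

(** Tensoring the filtration of T with an induced module is tensoring it over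
    S, where it splits. *)
Lemma strong_ind (V : lmodType S) : gorenstein_projective V -> strong (ind iota V).
Proof.
move=> gV; split; first split.
- exact: gp_iso (lin_iso_sym (ind_section (@se_piK _ _ E) V)) gV.
- by apply/tmapl_ind_inj; have [r rK] := se_jr_split; apply: tmapl_split_inj rK.
- apply/tmapl_ind_inj; apply: tmapl_split_inj; exact: se_irK.
Qed.

Lemma gp_ind (V : lmodType S) : gorenstein_projective V ->
  gorenstein_projective (ind iota V).
Proof.
move=> gV; apply/strongP; last exact: strong_ind.
exact: fin_gen_ind (fin_gen_gp gV).
Qed.

Lemma strong_tor W F Z (h : {linear W -> F}) (c : {linear F -> Z}) :
  strong W -> strong Z -> ses h c ->
  inj_tens (restr (cmorph pi) Ir) h /\ inj_tens (restr (cmorph pi) Gr) h.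
Proof.
move=> [[_ jW] iW] [[_ jZ] iZ] hc; have [hI _ _] := hc.
have hJ : inj_tens Jr h.
  apply: inj_ker0 => t ht; apply: jW; rewrite raddf0.
  by apply: (inj_tens_regular _).1 hI _ _ _; rewrite -tmaplr ht !raddf0.
split; last exact: tor_balance_l (se_irP E) hc hJ iZ.
apply: inj_ker0 => t ht; apply: iW; rewrite raddf0.
by apply: hJ; rewrite -tmaplr ht !raddf0.
Qed.

Lemma restr_section (D : lmodType S^c) :
  lin_iso D (restr (cmorph iota) (restr (cmorph pi) D)).
Proof.
have L : linear (id : D -> restr (cmorph iota) (restr (cmorph pi) D)).
  move=> r x y; rewrite -[RHS]/((pi (iota r) : S^c) *: (x : D) + y).
  by rewrite se_piK.
by exists (lin_of L); exists id.
Qed.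

(** One step V -> P -> V' of a totally exact complex over S.  The module induced
    from V embeds over T into a projective Q with strong cokernel, and P maps to
    the base change of Q; this yields the Tor statements.  These make the step
    induced to T exact, and Ext^1 over T from the module induced from V' into T
    vanishes; I and J/I are summands of T over S. *)
Lemma strong_compat (V P V' : lmodType S) (k : {linear V -> P}) (p : {linear P -> V'}) :
  in_proj P -> ses k p -> gorenstein_projective V -> gorenstein_projective V' ->
  [/\ ext_along k Gl, ext_along k Il, inj_tens Gr k & inj_tens Ir k].
Proof.
move=> pP kp gV gV'.
have [Q [Z [h [c [pQ hc gZ]]]]] := gp_right (gp_ind gV).
have [hIr hGr] := strong_tor (strong_ind gV) (gp_strong gZ) hc.
(* Ext^1(V', -) vanishes on the base change of Q, so h extends along k. *)
have [e eB] := lin_iso_sym (ind_section (@se_piK _ _ E) V).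
have [v vE] : exists v : {linear P -> ind pi Q}, forall x, v (k x) = (ind_map pi h \o e) x.
  apply: ext_along_proj; first exact: in_proj_ind.
  exact: gp_ext gV' (compatible_regular (R := S)) kp.
have [e' [eK e'K]] := bij_inv_linear eB.
(* v \o k is the base change of h up to the isomorphism e, so injectivity of h
   tensored with D passes to k. *)
have kD D : inj_tens (restr (cmorph pi) D) h -> inj_tens D k.
  move=> /inj_tens_ind hD; apply: inj_tens_factor vE _ => s t.
  rewrite -!tmapr_comp => /hD/(congr1 (tmapr e')); rewrite !tmapr_comp.
  by rewrite !tmapr_id.
have kG := kD _ hGr; have kI := kD _ hIr.
have kJ : inj_tens (restr (cmorph iota) Jr) k.
  apply: inj_tens_ses (ses_rlin (cmorph iota) (se_irP E)) _ _ _.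
  - by apply: flat_of_proj => //; case: (se_irP E).
  - exact: inj_tens_iso (restr_section _) kI.
  - exact: inj_tens_iso (restr_section _) kG.
have kT : inj_tens (restr (cmorph iota) (regularr T)) k.
  apply: inj_tens_ses (ses_rlin (cmorph iota) (se_jrP E)) _ kJ _.
  - by apply: flat_of_proj => //; case: (se_jrP E).
  apply: inj_tens_iso (restr_section _) _.
  by apply/inj_tens_regular; case: kp.
have kp' : ses (ind_map iota k) (ind_map iota p).
  by apply: ind_ses => //; apply: inj_tens_iso (bcr_restr iota) kT.
have kT' : ext_along k (restr iota T^o).
  apply/ext_along_ind; exact: gp_ext (gp_ind gV') (compatible_regular (R := T)) kp'.
by split=> //; [apply: ext_along_retract (@se_GlK _ _ E) kT' |
               apply: ext_along_retract (@se_IlK _ _ E) kT'].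
Qed.

Theorem compatible_of_strong : ext_compatible.
Proof.
have H (P : complex S) i : terms_in_proj P -> totally_exact P ->
    [/\ ext_along (cx_incl P i) Gl, ext_along (cx_incl P i) Il,
        inj_tens Gr (cx_incl P i) & inj_tens Ir (cx_incl P i)].
  move=> pP tP; have [eP _] := tP.
  exact: strong_compat (pP i) (cx_ses eP i) (gp_ker i pP tP) (gp_ker (i + 1) pP tP).
split=> P pP tP; have [eP _] := tP.
- by apply/(hom_exactP eP) => i; case: (H P i pP tP).
- by apply/(hom_exactP eP) => i; case: (H P i pP tP).
- by apply/(tens_exactP eP) => i; case: (H P i pP tP).
- by apply/(tens_exactP eP) => i; case: (H P i pP tP).
Qed.
End Converse.
End SplitExtension.

(** * Direct factors of a ring *)

Section ExactRetracts.
Variables (R : pzRingType) (P : complex R).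

Lemma hom_exact_retract (U U' : lmodType R) (i : {linear U' -> U}) (r : {linear U -> U'}) :
  exact_cx P -> cancel i r -> hom_exact P U -> hom_exact P U'.
Proof.
move=> eP iK /(hom_exactP eP) PU; apply/(hom_exactP eP) => j.
exact: ext_along_retract iK (PU j).
Qed.

Lemma hom_exact_iso (U U' : lmodType R) :
  exact_cx P -> lin_iso U U' -> hom_exact P U -> hom_exact P U'.
Proof. by move=> eP [h /bij_inv_linear[g [hK gK]]]; apply: hom_exact_retract gK. Qed.

Lemma hom_exact_prod (U U' : lmodType R) :
  exact_cx P -> hom_exact P U -> hom_exact P U' -> hom_exact P (U * U')%type.
Proof.
move=> eP /(hom_exactP eP) PU /(hom_exactP eP) PU'; apply/(hom_exactP eP) => j.
exact: ext_along_prod.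
Qed.

Lemma tens_exact_retract (U U' : lmodType R^c) (i : {linear U' -> U})
    (r : {linear U -> U'}) :
  exact_cx P -> cancel i r -> tens_exact P U -> tens_exact P U'.
Proof.
move=> eP iK /(tens_exactP eP) PU; apply/(tens_exactP eP) => j.
exact: inj_tens_retract iK (PU j).
Qed.

Lemma tens_exact_iso (U U' : lmodType R^c) :
  exact_cx P -> lin_iso U U' -> tens_exact P U -> tens_exact P U'.
Proof. by move=> eP [h /bij_inv_linear[g [hK gK]]]; apply: tens_exact_retract gK. Qed.

Lemma tens_exact_prod (U U' : lmodType R^c) :
  exact_cx P -> tens_exact P U -> tens_exact P U' -> tens_exact P (U * U')%type.
Proof.
move=> eP /(tens_exactP eP) PU /(tens_exactP eP) PU'; apply/(tens_exactP eP) => j.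
exact: inj_tens_prod.
Qed.

Lemma tens_exact_regular : exact_cx P -> tens_exact P (regularr R).
Proof.
move=> eP; apply/(tens_exactP eP) => j; apply/inj_tens_regular.
exact: cx_incl_inj.
Qed.
End ExactRetracts.

Lemma compatible_retract (R : pzRingType) (U U' : lmodType R) (i : {linear U' -> U})
    (r : {linear U -> U'}) :
  cancel i r -> semi_weakly_compatible U -> semi_weakly_compatible U'.
Proof.
move=> iK UC P pP tP; apply: hom_exact_retract iK _; first by case: tP.
exact: UC.
Qed.

Lemma compatible_r_retract (R : pzRingType) (U U' : lmodType R^c) (i : {linear U' -> U})
    (r : {linear U -> U'}) :
  cancel i r -> semi_weakly_compatible_r U -> semi_weakly_compatible_r U'.
Proof.
move=> iK UC P pP tP; apply: tens_exact_retract iK _; first by case: tP.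
exact: UC.
Qed.

Lemma compatible_iso (R : pzRingType) (U U' : lmodType R) :
  lin_iso U U' -> semi_weakly_compatible U -> semi_weakly_compatible U'.
Proof. by case=> h /bij_inv_linear[g [hK gK]]; apply: compatible_retract gK. Qed.

Lemma compatible_r_iso (R : pzRingType) (U U' : lmodType R^c) :
  lin_iso U U' -> semi_weakly_compatible_r U -> semi_weakly_compatible_r U'.
Proof. by case=> h /bij_inv_linear[g [hK gK]]; apply: compatible_r_retract gK. Qed.

Lemma compatible_prod (R : pzRingType) (U U' : lmodType R) :
  semi_weakly_compatible (U * U')%type <->
  semi_weakly_compatible U /\ semi_weakly_compatible U'.
Proof.
split=> [UC|[UC UC'] P pP tP]; last first.
  by apply: hom_exact_prod; [case: tP | exact: UC | exact: UC'].
split; first by apply: (compatible_retract (i := inl_lin U U') (r := fst)) => // x.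
by apply: (compatible_retract (i := inr_lin U U') (r := snd)) => // x.
Qed.

Lemma compatible_r_prod (R : pzRingType) (U U' : lmodType R^c) :
  semi_weakly_compatible_r (U * U')%type <->
  semi_weakly_compatible_r U /\ semi_weakly_compatible_r U'.
Proof.
split=> [UC|[UC UC'] P pP tP]; last first.
  by apply: tens_exact_prod; [case: tP | exact: UC | exact: UC'].
split; first by apply: (compatible_r_retract (i := inl_lin U U') (r := fst)) => // x.
by apply: (compatible_r_retract (i := inr_lin U U') (r := snd)) => // x.
Qed.

(** L is a direct factor of the ring S, with projection f and (nonunital)
    inclusion e. *)
Section RingFactor.
Variables (S L : pzRingType) (f : {rmorphism S -> L}) (e : {additive L -> S}).
Hypotheses (eK : cancel e f) (eL : forall s l, s * e l = e (f s * l))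
  (eR : forall s l, e l * s = e (l * f s)).

Lemma factor_surj_ring : surj f.
Proof. by move=> l; exists (e l); apply: eK. Qed.

Fact factor_in_l_linear : linear (e : restr f L^o -> S^o).
Proof. by move=> r x y; rewrite raddfD -eL. Qed.
Fact factor_out_l_linear : linear (f : S^o -> restr f L^o).
Proof. by move=> r x y; rewrite rmorphD rmorphM. Qed.
Fact factor_in_r_linear : linear (e : restr (cmorph f) (regularr L) -> regularr S).
Proof. by move=> r x y; rewrite raddfD -eR. Qed.
Fact factor_out_r_linear : linear (f : regularr S -> restr (cmorph f) (regularr L)).
Proof. by move=> r x y; rewrite rmorphD rmorphM. Qed.

Section OverS.
Variable P : complex S.
Hypotheses (pP : terms_in_proj P) (tP : totally_exact P).

Lemma factor_tens_exact : tens_exact P (restr (cmorph f) (regularr L)).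
Proof.
apply: (tens_exact_retract (i := lin_of factor_in_r_linear) (r := lin_of factor_out_r_linear)).
- by case: tP.
- exact: eK.
- by apply: tens_exact_regular; case: tP.
Qed.

Lemma factor_hom_exact : hom_exact P (restr f L^o).
Proof.
apply: (hom_exact_retract (i := lin_of factor_in_l_linear) (r := lin_of factor_out_l_linear)).
- by case: tP.
- exact: eK.
- by case: tP.
Qed.

Lemma factor_ind_total : totally_exact (ind_cx f P).
Proof. exact: ind_cx_total factor_tens_exact factor_hom_exact. Qed.
End OverS.

Lemma gp_ind_factor (V : lmodType S) :
  gorenstein_projective V -> gorenstein_projective (ind f V).
Proof.
move=> [P [pP tP VP]]; apply: gp_iso (lin_iso_ind f (lin_iso_sym VP)) _.
exact: gp_ind_ker pP tP (factor_tens_exact tP) (factor_hom_exact tP) 0.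
Qed.

Lemma ind_factor (V : lmodType S) (X : lmodType L) (q : {linear V -> restr f X}) :
  surj q -> (forall v, q v = 0 -> e 1 *: v = 0) -> lin_iso (ind f V) X.
Proof.
move=> qS qE; exists (ind_lift q); apply: inj_surj_bij => [|x].
  apply: inj_lker0 => t; have [v <-] := ind_unit_surj factor_surj_ring t.
  move=> qv; have /qE ev : q v = 0 by rewrite -(ind_lift_unit q).
  transitivity (f (e 1) *: (ind_unit f v : ind f V)); first by rewrite eK scale1r.
  have L0 : ind_unit f (e 1 *: v) = e 1 *: ind_unit f v by rewrite linearZ.
  exact: etrans (esym L0) (etrans (congr1 _ ev) (linear0 _)).
by have [v <-] := qS x; exists (ind_unit f v); apply: ind_lift_unit.
Qed.

(** Such a map lands in the factor L, being fixed by the idempotent e 1. *)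
Lemma factor_map_split (X : lmodType L) (u : {linear restr f X -> S^o}) :
  exists u1 : {linear X -> L^o}, forall x, u x = e (u1 x).
Proof.
have [u1 u1E] := rlin_lift (lin_of factor_out_l_linear \o u : {linear restr f X -> restr f L^o})
  factor_surj_ring.
exists u1 => x; rewrite u1E /=.
rewrite -[f _]mul1r -eR -[RHS](linearZ_LR u (e 1) x); congr (u _).
by rewrite -[RHS]/(f (e 1) *: (x : X)) eK scale1r.
Qed.

Lemma in_proj_restr (Q : lmodType L) : in_proj Q -> in_proj (restr f Q).
Proof.
move=> /in_proj_dual_basis[I [b [phi bE]]]; apply: dual_basis_in_proj.
exists I, b, (fun i => lin_of factor_in_l_linear \o rlin f (phi i)) => x.
rewrite {1}(bE x); apply: eq_bigr => i _.
by rewrite -[RHS]/(f (e (phi i x)) *: (b i : Q)) eK.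
Qed.

Lemma ext_along_restr (K F : lmodType L) (k : {linear K -> F}) :
  ext_along k L^o -> ext_along (rlin f k) S^o.
Proof.
move=> kL u; have [u1 u1E] := factor_map_split u; have [v vE] := kL u1.
by exists (lin_of factor_in_l_linear \o rlin f v) => x; rewrite /= vE u1E.
Qed.

Lemma gp_step_restr (X Y : lmodType L) : gp_step X Y -> gp_step (restr f X) (restr f Y).
Proof.
move=> [Q [i [p [pQ ip iL]]]]; exists (restr f Q), (rlin f i), (rlin f p).
split; [exact: in_proj_restr | exact: ses_rlin | exact: ext_along_restr].
Qed.

Lemma gp_restr (X : lmodType L) :
  gorenstein_projective X -> gorenstein_projective (restr f X).
Proof.
move=> gX; apply: (gp_coind (C := fun W => exists X, W = restr f X /\
  gorenstein_projective X)); first by exists X.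
- move=> W [Y [-> /gp_step_right[Z gZ YZ]]].
  by exists (restr f Z); [exists Z | apply: gp_step_restr].
- move=> W [Y [-> /gp_step_left[Z gZ ZY]]].
  by exists (restr f Z); [exists Z | apply: gp_step_restr].
Qed.

Section OverL.
Variable P : complex L.

Definition restr_cx : complex S :=
  Complex (cx_d := fun i => rlin f (cx_d P i)) (@cx_dd _ P).

Hypotheses (pP : terms_in_proj P) (tP : totally_exact P).

Lemma restr_cx_proj : terms_in_proj restr_cx.
Proof. by move=> i; apply: in_proj_restr. Qed.

Lemma restr_cx_total : totally_exact restr_cx.
Proof.
have [eP hP] := tP; split=> // i u; split=> [u0|[v vE] x]; last first.
  by rewrite vE (cx_dd (c := restr_cx)) linear0.
have [u1 u1E] := factor_map_split u.
have [|v vE] := (hP i u1).1.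
  move=> x; apply: (can_inj eK); rewrite -u1E raddf0; exact: u0.
by exists (lin_of factor_in_l_linear \o rlin f v) => y; rewrite u1E vE.
Qed.

Lemma hom_exact_restr (U : lmodType L) :
  hom_exact restr_cx (restr f U) -> hom_exact P U.
Proof.
move=> PU i u; split=> [u0|[v vE] x]; last by rewrite vE cx_dd linear0.
have [v vE] := (PU i (rlin f u)).1 u0.
have [v' v'E] := rlin_lift v factor_surj_ring.
by exists v' => y; rewrite v'E -vE.
Qed.

Section TensRestr.
Variables (D : lmodType L^c) (X : lmodType L).
Let D' : lmodType S^c := restr (cmorph f) D.
Let X' : lmodType S := restr f X.

Fact trestr_balanced : balanced (fun (d : D') (x : X') => (d : D) \ot (x : X)).
Proof.
split=> [x d d'|d x x'|d s x]; [exact: tmulDl|exact: tmulDr|].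
exact: (tmul_mid (f s) (d : D) (x : X)).
Qed.
Fact trestr_inv_balanced : balanced (fun (d : D) (x : X) => (d : D') \ot (x : X')).
Proof.
split=> [x d d'|d x x'|d l x].
- exact: (tmulDl (d : D') (d' : D')).
- exact: (tmulDr (d : D') (x : X') (x' : X')).
have [s <-] := factor_surj_ring l; exact: (tmul_mid s (d : D') (x : X')).
Qed.
Definition trestr := tlift_of trestr_balanced.
Lemma trestrE (d : D) (x : X) : trestr ((d : D') \ot (x : X')) = d \ot x.
Proof. exact: tlift_ofE. Qed.
Lemma trestr_bij : bijective trestr.
Proof.
exists (tlift_of trestr_inv_balanced).
  apply: (tens_additive_ext (f := tlift_of trestr_inv_balanced \o trestr) (g := idfun)) => d x.
  by rewrite -[LHS]/(tlift_of trestr_inv_balanced (trestr (d \ot x))) trestrE tlift_ofE.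
apply: (tens_additive_ext (f := trestr \o tlift_of trestr_inv_balanced) (g := idfun)) => d x.
by rewrite -[LHS]/(trestr (tlift_of trestr_inv_balanced (d \ot x))) tlift_ofE trestrE.
Qed.
End TensRestr.

Lemma tens_exact_restr (D : lmodType L^c) :
  tens_exact restr_cx (restr (cmorph f) D) -> tens_exact P D.
Proof.
apply: (@tens_exact_transport S L restr_cx P (restr (cmorph f) D) D
  (fun i => trestr D (P i)) _ _).1 => i.
  exact: trestr_bij.
move=> t; move: t.
apply: (tens_additive_ext (f := trestr D (P (i + 1)) \o tmapr (cx_d restr_cx i))
  (g := tmapr (cx_d P i) \o trestr D (P i))) => d x.
rewrite -[LHS]/(trestr D (P (i + 1)) (tmapr (cx_d restr_cx i) (d \ot x))) tmaprE.
rewrite -[RHS]/(tmapr (cx_d P i) (trestr D (P i) (d \ot x))).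
by rewrite !trestrE [RHS]tmaprE.
Qed.
End OverL.

(** Base change and restriction between S and L both preserve total
    exactness. *)
Lemma compatible_factor (U : lmodType L) :
  semi_weakly_compatible (restr f U) <-> semi_weakly_compatible U.
Proof.
split=> UC P pP tP.
  by apply: hom_exact_restr; apply: UC; [exact: restr_cx_proj | exact: restr_cx_total].
apply/hom_exact_ind; apply: UC; first exact: ind_cx_proj.
exact: factor_ind_total.
Qed.

Lemma compatible_r_factor (U : lmodType L^c) :
  semi_weakly_compatible_r (restr (cmorph f) U) <-> semi_weakly_compatible_r U.
Proof.
split=> UC P pP tP.
  by apply: tens_exact_restr; apply: UC; [exact: restr_cx_proj | exact: restr_cx_total].
apply/tens_exact_ind; apply: UC; first exact: ind_cx_proj.
exact: factor_ind_total.
Qed.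
End RingFactor.

Section ProductRing.
Variables L B : pzRingType.
Local Notation S := (L * B)%type.
Definition pr1 : {rmorphism S -> L} := fst.
Definition pr2 : {rmorphism S -> B} := snd.
Definition in1 : L -> S := fun l => (l, 0).
Definition in2 : B -> S := fun b => (0, b).
Fact in1D : {morph in1 : x y / x + y}.
Proof. by move=> x y; rewrite /in1 [RHS]surjective_pairing /= addr0. Qed.
Fact in2D : {morph in2 : x y / x + y}.
Proof. by move=> x y; rewrite /in2 [RHS]surjective_pairing /= addr0. Qed.
Lemma in1_l (s : S) l : s * add_of in1D l = add_of in1D (pr1 s * l).
Proof. by rewrite [LHS]surjective_pairing /= mulr0. Qed.
Lemma in1_r (s : S) l : add_of in1D l * s = add_of in1D (l * pr1 s).
Proof. by rewrite [LHS]surjective_pairing /= mul0r. Qed.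
Lemma in2_l (s : S) l : s * add_of in2D l = add_of in2D (pr2 s * l).
Proof. by rewrite [LHS]surjective_pairing /= mulr0. Qed.
Lemma in2_r (s : S) l : add_of in2D l * s = add_of in2D (l * pr2 s).
Proof. by rewrite [LHS]surjective_pairing /= mul0r. Qed.
Lemma in1K : cancel (add_of in1D) pr1. Proof. by []. Qed.
Lemma in2K : cancel (add_of in2D) pr2. Proof. by []. Qed.

Lemma gp_product (X : lmodType L) (Y : lmodType B) :
  gorenstein_projective (restr pr1 X * restr pr2 Y)%type <->
  gorenstein_projective X /\ gorenstein_projective Y.
Proof.
split=> [gXY|[gX gY]]; last first.
  apply: gp_prod; first exact: gp_restr in1K in1_l in1_r _ gX.
  exact: gp_restr in2K in2_l in2_r _ gY.
split.
- apply: gp_iso (gp_ind_factor in1K in1_l in1_r gXY).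
  apply: (ind_factor in1K (q := fst : {linear (restr pr1 X * restr pr2 Y)%type -> _})).
    by move=> x; exists (x, 0).
  move=> [x y] /= ->; rewrite [LHS]surjective_pairing /=.
  by rewrite scaler0 -[X in (_, X)]/((0 : B) *: (y : Y)) scale0r.
- apply: gp_iso (gp_ind_factor in2K in2_l in2_r gXY).
  apply: (ind_factor in2K (q := snd : {linear (restr pr1 X * restr pr2 Y)%type -> _})).
    by move=> y; exists (0, y).
  move=> [x y] /= ->; rewrite [LHS]surjective_pairing /=.
  by rewrite scaler0 -[X in (X, _)]/((0 : L) *: (x : X)) scale0r.
Qed.
End ProductRing.

(** * The Morita context ring as an extension of L * B *)

Section MoritaRing.
Variables (A B : pzRingType) (M : bimodType B A) (N : bimodType A B).
Variables (mc : moritaContext M N) (S : pred A) (L : subPzRingType S).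
Hypothesis phi0 : forall t, phi mc t = 0.
Hypothesis trivext : trivial_extension mc L.
Local Notation T := (mring mc).
Local Notation incl := (subring_incl L).
Local Notation I := (impsi mc).

Lemma trivext_ex (a : A) : exists p : L * I, incl p.1 + impsi_val p.2 = a.
Proof. by case: trivext => -[g hK gK] _; exists (g a); rewrite gK. Qed.

Definition rho_fun (a : A) : L := (projT1 (cid (trivext_ex a))).1.
Definition sigma (a : A) : I := (projT1 (cid (trivext_ex a))).2.

Lemma rho_sigma a : incl (rho_fun a) + impsi_val (sigma a) = a.
Proof. exact: (projT2 (cid (trivext_ex a))). Qed.

Lemma rho_sigma_uniq l x a : incl l + impsi_val x = a -> rho_fun a = l /\ sigma a = x.
Proof.
case: trivext => hB _ e.
have [] : (rho_fun a, sigma a) = (l, x).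
  by apply: (bij_inj hB); rewrite /= rho_sigma e.
by [].
Qed.

Fact impsi_valD (x y : I) : impsi_val (x + y) = impsi_val x + impsi_val y.
Proof. by []. Qed.
Fact impsi_val0 : impsi_val (0 : I) = 0.
Proof. by []. Qed.

Fact rho_morphD : {morph rho_fun : a b / a + b}.
Proof.
move=> a b; apply: (rho_sigma_uniq (x := sigma a + sigma b) _).1.
by rewrite rmorphD impsi_valD addrACA !rho_sigma.
Qed.
Lemma sigmaD : {morph sigma : a b / a + b}.
Proof.
move=> a b; apply: (rho_sigma_uniq (l := rho_fun a + rho_fun b) _).2.
by rewrite rmorphD impsi_valD addrACA !rho_sigma.
Qed.
Lemma rho_mul_eq a b : a * b = incl (rho_fun a * rho_fun b) +
  impsi_val (incl (rho_fun a) *: sigma b + sigma a <* incl (rho_fun b)).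
Proof. by case: trivext => _ <-; rewrite !rho_sigma. Qed.
Fact rho_monoid : monoid_morphism rho_fun.
Proof.
split=> [|a b].
  by apply: (rho_sigma_uniq (x := 0) _).1; rewrite rmorph1 impsi_val0 addr0.
exact: (rho_sigma_uniq (esym (rho_mul_eq a b))).1.
Qed.
(** The projection of A = L + I onto L, a ring map as I is an ideal. *)
Definition rho : {rmorphism A -> L} :=
  HB.pack rho_fun (GRing.isZmodMorphism.Build A L rho_fun (morphD_zmod rho_morphD))
    (GRing.isMonoidMorphism.Build A L rho_fun rho_monoid).

Lemma rho_incl l : rho (incl l) = l.
Proof. by apply: (rho_sigma_uniq (x := 0) _).1; rewrite impsi_val0 addr0. Qed.
Lemma rho_impsi (x : I) : rho (impsi_val x) = 0.
Proof. by apply: (rho_sigma_uniq (x := x) _).1; rewrite rmorph0 add0r. Qed.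
Lemma sigma_impsi (x : I) : sigma (impsi_val x) = x.
Proof. by apply: (rho_sigma_uniq (l := 0) _).2; rewrite rmorph0 add0r. Qed.
Lemma rho0_sigma a : rho a = 0 -> impsi_val (sigma a) = a.
Proof. by move=> ra; rewrite -[RHS]rho_sigma -[rho_fun a]/(rho a) ra rmorph0 add0r. Qed.

Lemma psim_impsi_val n m : exists x : I, impsi_val x = psim mc n m.
Proof.
have Ip : submod_pred (impsi_pred mc) (psim mc n m).
  by apply/asboolP; exists ((n : rmod N) \ot m).
by exists (Submod Ip).
Qed.
Lemma rho_psim n m : rho (psim mc n m) = 0.
Proof. by have [x <-] := psim_impsi_val n m; apply: rho_impsi. Qed.

Lemma impsi_valP (x : I) : exists t, psi mc t = impsi_val x.
Proof. by case: x => a Ia; have /asboolP := Ia. Qed.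

(** The following products with I vanish because
    psi (n (x) m) n' = n phi (m (x) n') and m' psi (n (x) m) = phi (m' (x) n) m. *)
Lemma impsi_N (x : I) (n : N) : impsi_val x *: n = 0.
Proof.
have [t <-] := impsi_valP x.
elim/tens_ind: t => [|s t IHs IHt|n' m']; first by rewrite raddf0 scale0r.
  by rewrite raddfD scalerDl IHs IHt addr0.
exact: psim_N.
Qed.
Lemma M_impsi (m : M) (x : I) : m <* impsi_val x = 0.
Proof.
have [t <-] := impsi_valP x.
elim/tens_ind: t => [|s t IHs IHt|n' m']; first by rewrite raddf0 rscale0r.
  by rewrite raddfD rscalerDr IHs IHt addr0.
exact: (M_psim phi0).
Qed.
Lemma impsi_mul0 (x y : I) : impsi_val x * impsi_val y = 0.
Proof.
have [t <-] := impsi_valP x; have [s <-] := impsi_valP y.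
elim/tens_ind: s => [|s s' IHs IHs'|n' m']; first by rewrite raddf0 mulr0.
  by rewrite raddfD mulrDr IHs IHs' addr0.
exact: psi_psim.
Qed.

Lemma scale_rho_N a (n : N) : a *: n = incl (rho a) *: n.
Proof. by rewrite -{1}(rho_sigma a) scalerDl impsi_N addr0. Qed.
Lemma scale_rho_M a (m : M) : m <* a = m <* incl (rho a).
Proof. by rewrite -{1}(rho_sigma a) rscalerDr M_impsi addr0. Qed.
Lemma mul_rho_l a (x : I) : a * impsi_val x = incl (rho a) * impsi_val x.
Proof. by rewrite -{1}(rho_sigma a) mulrDl impsi_mul0 addr0. Qed.
Lemma mul_rho_r a (x : I) : impsi_val x * a = impsi_val x * incl (rho a).
Proof. by rewrite -{1}(rho_sigma a) mulrDr impsi_mul0 addr0. Qed.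

Definition qpi_fun (t : T) : L * B := (rho t.1.1, t.2.2).
Fact qpi_morphD : {morph qpi_fun : s t / s + t}.
Proof.
by move=> [[a n] [m b]] [[a' n'] [m' b']]; congr (_, _); exact: (rmorphD rho).
Qed.
Fact qpi_monoid : monoid_morphism qpi_fun.
Proof.
split=> [|[[a n] [m b]] [[a' n'] [m' b']]]; congr (_, _).
- exact: (rmorph1 rho).
- rewrite -[LHS]/(rho (a * a' + psim mc n m')) rmorphD rmorphM rho_psim addr0 //.
- rewrite -[LHS]/(phim mc m n' + b * b') [phim _ _ _]phi0 add0r //.
Qed.
(** Reduction modulo J. *)
Definition qpi : {rmorphism T -> (L * B)%type} :=
  HB.pack qpi_fun
    (GRing.isZmodMorphism.Build T (L * B)%type qpi_fun (morphD_zmod qpi_morphD))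
    (GRing.isMonoidMorphism.Build T (L * B)%type qpi_fun qpi_monoid).

Definition qiota_fun (s : L * B) : T := ((incl s.1, 0), (0, s.2)).
Fact qiota_morphD : {morph qiota_fun : s t / s + t}.
Proof.
move=> [l b] [l' b']; congr ((_, _), (_, _)); rewrite ?addr0 //.
exact: (rmorphD incl).
Qed.
Fact qiota_monoid : monoid_morphism qiota_fun.
Proof.
split=> [|[l b] [l' b']]; first by congr ((_, _), (_, _)); exact: (rmorph1 incl).
rewrite -[RHS]/(mring_mul _ _) /= psim0l phim0l !scaler0 !rscale0l !addr0 !add0r.
by congr ((_, _), (_, _)); exact: (rmorphM incl).
Qed.
Definition qiota : {rmorphism (L * B)%type -> T} :=
  HB.pack qiota_fun
    (GRing.isZmodMorphism.Build (L * B)%type T qiota_fun (morphD_zmod qiota_morphD))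
    (GRing.isMonoidMorphism.Build (L * B)%type T qiota_fun qiota_monoid).

Lemma qpiK : cancel qiota qpi.
Proof. by move=> [l b]; congr (_, _); exact: rho_incl. Qed.
End MoritaRing.

Section MoritaSplitExt.
Variables (A B : pzRingType) (M : bimodType B A) (N : bimodType A B).
Variables (mc : moritaContext M N) (S : pred A) (L : subPzRingType S).
Hypothesis phi0 : forall t, phi mc t = 0.
Hypothesis trivext : trivial_extension mc L.
Local Notation T := (mring mc).
Local Notation incl := (subring_incl L).
Local Notation I := (impsi mc).
Local Notation pi := (qpi phi0 trivext).
Local Notation iota := (qiota mc L).
Local Notation rho := (rho trivext).
Local Notation sigma := (sigma trivext).
Local Notation LB := (L * B)%type.
Local Notation pr1 := (pr1 L B).
Local Notation pr2 := (pr2 L B).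

(** N, M and I over the subring L of A. *)
Definition UN : bimodType L B := restrl incl N.
Definition UM : bimodType B L := restrr incl M.
Definition UI : bimodType L L := restrl incl (restrr incl I).

(** J/I = N + M and I over L * B.  On the left N is a module over L and M one
    over B; on the right it is the other way round. *)
Definition mGl : lmodType LB := (restr pr1 UN * restr pr2 UM)%type.
Definition mIl : lmodType LB := restr pr1 UI.
Definition mGr : lmodType LB^c :=
  (restr (cmorph pr1) (rmod UM) * restr (cmorph pr2) (rmod UN))%type.
Definition mIr : lmodType LB^c := restr (cmorph pr1) (rmod UI).

Lemma qpi_surj : surj pi.
Proof. by move=> s; exists (iota s); apply: qpiK. Qed.

Lemma qpi_eq0 (t : T) : pi t = 0 -> rho t.1.1 = 0 /\ t.2.2 = 0.
Proof. by case: t => [[a n] [m b]] []. Qed.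

Definition mJl : lmodType T := kermod (ringmap_l pi).
Definition mjl : {linear mJl -> T^o} := val.
Lemma mjlP : ses mjl (ringmap_l pi).
Proof. exact/ses_kermod/qpi_surj. Qed.

Definition mJr : lmodType T^c := kermod (ringmap_r pi).
Definition mjr : {linear mJr -> regularr T} := val.
Lemma mjrP : ses mjr (ringmap_r pi).
Proof. exact/ses_kermod/qpi_surj. Qed.

Lemma mjl0 (x : mJl) : rho (mjl x : T).1.1 = 0 /\ (mjl x : T).2.2 = 0.
Proof. by apply/qpi_eq0/eqP/(submod_valP x). Qed.
Lemma mjr0 (x : mJr) : rho (mjr x : T).1.1 = 0 /\ (mjr x : T).2.2 = 0.
Proof. by apply/qpi_eq0/eqP/(submod_valP x). Qed.

Lemma rho0_M (m : M) a : rho a = 0 -> m <* a = 0.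
Proof. by move=> ra; rewrite (scale_rho_M phi0 trivext) ra rmorph0 rscale0r. Qed.
Lemma rho0_N (n : N) a : rho a = 0 -> a *: n = 0.
Proof. by move=> ra; rewrite (scale_rho_N phi0 trivext) ra rmorph0 scale0r. Qed.

Definition offdiag (t : T) : mGl := (t.1.2, t.2.1).
Fact mql_linear : linear (fun x : mJl => offdiag (mjl x) : restr pi mGl).
Proof.
move=> t x y; have [rx bx] := mjl0 x; rewrite linearP.
rewrite -[RHS]/(pi t *: (offdiag (mjl x)) + offdiag (mjl y)).
move: (mjl x) (mjl y) rx bx => [[a n] [m b]] [[a2 n2] [m2 b2]] /= ra ->.
case: t => [[a' n'] [m' b']]; congr (_, _).
- rewrite -[LHS]/(a' *: n + n' <* 0 + n2) rscale0r addr0.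
  by rewrite (scale_rho_N phi0 trivext).
- by rewrite -[LHS]/(m' <* a + b' *: m + m2) rho0_M // add0r.
Qed.
Definition mql : {linear mJl -> restr pi mGl} := lin_of mql_linear.

Definition corner (x : I) : T := ((impsi_val x, 0), (0, 0)).
Lemma corner_pi x : pi (corner x) = 0.
Proof. by congr (_, _); exact: rho_impsi. Qed.
Fact mil_linear : linear (corner : restr pi mIl -> T^o).
Proof.
move=> t x y; rewrite -[RHS]/(mring_mul t (corner x) + corner y).
case: t => [[a' n'] [m' b']]; congr ((_, _), (_, _)) => /=.
- rewrite psim0r addr0 (mul_rho_l phi0 trivext); exact: erefl.
- by rewrite scaler0 rscale0r !addr0.
- by rewrite M_impsi // scaler0 !addr0.
- by rewrite phim0r mulr0 !addr0.
Qed.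
Lemma mil_ex : exists i : {linear restr pi mIl -> mJl}, forall x, mjl (i x) = corner x.
Proof.
have [jI _ jE] := mjlP.
by apply: (factor_inj (f := lin_of mil_linear)) => // x; apply/jE/corner_pi.
Qed.
Definition mil := projT1 (cid mil_ex).
Lemma milE x : mjl (mil x) = corner x.
Proof. exact: (projT2 (cid mil_ex)). Qed.

Lemma corner_sigma (t : T) : rho t.1.1 = 0 -> t.2.2 = 0 -> offdiag t = 0 ->
  corner (sigma t.1.1) = t.
Proof.
case: t => [[a n] [m b]] /= ra -> [-> ->]; congr ((_, _), (_, _)).
exact: rho0_sigma.
Qed.

Lemma milP : ses mil mql.
Proof.
have [jI _ jE] := mjlP.
split=> [x y /(congr1 mjl)|[n m]|x].
- by rewrite !milE => -[/impsi_val_inj].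
- have /jE[x xE] : ringmap_l pi ((0, n), (m, 0)) = 0.
    by rewrite -[LHS]/((rho 0, 0) : LB) rmorph0.
  by exists x; rewrite -[LHS]/(offdiag (mjl x)) xE.
have [rx bx] := mjl0 x; split=> [x0|[y <-]].
  by exists (sigma (mjl x : T).1.1); apply: jI; rewrite milE corner_sigma.
by rewrite -[LHS]/(offdiag (mjl (mil y))) milE.
Qed.

Lemma iota_l (s : LB) (t : T) :
  iota s * t = ((incl s.1 * t.1.1, incl s.1 *: t.1.2), (s.2 *: t.2.1, s.2 * t.2.2)).
Proof.
case: t => [[a n] [m b]]; rewrite -[LHS]/(mring_mul _ _) /=.
by rewrite psim0l phim0l !rscale0l !addr0 !add0r.
Qed.

Fact mGl_in_linear : linear (fun g : mGl => ((0, g.1), (g.2, 0)) : restr iota T^o).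
Proof.
move=> s g h; rewrite -[RHS]/(iota s * ((0, g.1), (g.2, 0)) + ((0, h.1), (h.2, 0))).
by rewrite iota_l /= !mulr0; congr ((_, _), (_, _)); rewrite addr0.
Qed.
Fact mGl_out_linear : linear (offdiag : restr iota T^o -> mGl).
Proof.
move=> s t t'; rewrite -[LHS]/(offdiag (iota s * (t : T) + t')) iota_l.
by case: t => [[a n] [m b]]; case: t' => [[a' n'] [m' b']].
Qed.
Lemma mGlK : cancel (lin_of mGl_in_linear) (lin_of mGl_out_linear).
Proof. by move=> []. Qed.

Fact mIl_in_linear : linear (corner : mIl -> restr iota T^o).
Proof.
move=> s g h; rewrite -[RHS]/(iota s * corner g + corner h).
rewrite iota_l /= mulr0; congr ((_, _), (_, _)); rewrite ?scaler0 ?addr0 //.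
Qed.
Fact mIl_out_linear : linear (fun t : restr iota T^o => sigma (t : T).1.1 : mIl).
Proof.
move=> s t t'; rewrite -[X in sigma X]/((iota s * (t : T) + t').1.1) iota_l.
rewrite -[X in sigma X]/(incl s.1 * (t : T).1.1 + (t' : T).1.1) sigmaD.
congr (_ + _); set a := (t : T).1.1.
apply: (rho_sigma_uniq trivext (l := s.1 * rho a) _).2.
by rewrite rmorphM -mulrDr [in RHS](esym (rho_sigma trivext a)).
Qed.
Lemma mIlK : cancel (lin_of mIl_in_linear) (lin_of mIl_out_linear).
Proof. by move=> x; exact: sigma_impsi. Qed.

Definition offdiagr (t : T) : mGr := (t.2.1, t.1.2).
Fact mqr_linear : linear (fun x : mJr => offdiagr (mjr x) : restr (cmorph pi) mGr).
Proof.
move=> t x y; have [rx bx] := mjr0 x; rewrite linearP.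
rewrite -[LHS]/(offdiagr ((mjr x : T) * (t : T) + mjr y)).
rewrite -[RHS]/((pi t : LB^c) *: (offdiagr (mjr x)) + offdiagr (mjr y)).
move: (mjr x) (mjr y) rx bx => [[a n] [m b]] [[a2 n2] [m2 b2]] /= ra ->.
case: t => [[a' n'] [m' b']]; congr (_, _).
- rewrite -[LHS]/(m <* a' + 0 *: m' + m2) scale0r addr0.
  by rewrite (scale_rho_M phi0 trivext).
- by rewrite -[LHS]/(a *: n' + n <* b' + n2) rho0_N // add0r.
Qed.
Definition mqr : {linear mJr -> restr (cmorph pi) mGr} := lin_of mqr_linear.

Fact mir_linear : linear (corner : restr (cmorph pi) mIr -> regularr T).
Proof.
move=> t x y; rewrite -[RHS]/(mring_mul (corner x) t + corner y).
case: t => [[a' n'] [m' b']]; congr ((_, _), (_, _)) => /=.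
- rewrite psim0l addr0 [X in _ = X + _](mul_rho_r phi0 trivext); exact: erefl.
- by rewrite impsi_N // rscale0l !addr0.
- by rewrite rscale0l scale0r !addr0.
- by rewrite phim0l mul0r !addr0.
Qed.
Lemma mir_ex : exists i : {linear restr (cmorph pi) mIr -> mJr},
  forall x, mjr (i x) = corner x.
Proof.
have [jI _ jE] := mjrP.
by apply: (factor_inj (f := lin_of mir_linear)) => // x; apply/jE/corner_pi.
Qed.
Definition mir := projT1 (cid mir_ex).
Lemma mirE x : mjr (mir x) = corner x.
Proof. exact: (projT2 (cid mir_ex)). Qed.

Lemma mirP : ses mir mqr.
Proof.
have [jI _ jE] := mjrP.
split=> [x y /(congr1 mjr)|[m n]|x].
- by rewrite !mirE => -[/impsi_val_inj].
- have /jE[x xE] : ringmap_r pi ((0, n), (m, 0)) = 0.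
    by rewrite -[LHS]/((rho 0, 0) : LB) rmorph0.
  by exists x; rewrite -[LHS]/(offdiagr (mjr x)) xE.
have [rx bx] := mjr0 x; split=> [[xm xn]|[y <-]].
  by exists (sigma (mjr x : T).1.1); apply: jI; rewrite mirE corner_sigma // /offdiag xm xn.
by rewrite -[LHS]/(offdiagr (mjr (mir y))) mirE.
Qed.

Fact mir_out_linear : linear (fun x : restr (cmorph iota) mJr =>
  sigma (mjr x : T).1.1 : restr (cmorph iota) (restr (cmorph pi) mIr)).
Proof.
move=> s x y; rewrite -[X in mjr X]/((iota s : T^c) *: (x : mJr) + y) linearP.
move: (mjr x) (mjr y) => [[a n] [m b]] [[a2 n2] [m2 b2]].
rewrite -[LHS]/(sigma (a * incl s.1 + psim mc n 0 + a2)) psim0r addr0 sigmaD.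
congr (_ + _); rewrite -[RHS]/(sigma a <* incl (pi (iota s)).1) qpiK.
apply: (rho_sigma_uniq trivext (l := rho a * s.1) _).2.
by rewrite rmorphM -mulrDl (rho_sigma trivext a).
Qed.
Lemma mirK : cancel (rlin (cmorph iota) mir) (lin_of mir_out_linear).
Proof.
move=> x; rewrite -[LHS]/(sigma (mjr (mir x) : T).1.1) mirE; exact: sigma_impsi.
Qed.

Definition moritaExt : splitExt T LB :=
  @SplitExt T LB pi iota (qpiK phi0 trivext) mJl mGl mIl mjl mil mql mjlP milP
    (lin_of mGl_in_linear) (lin_of mGl_out_linear) mGlK
    (lin_of mIl_in_linear) (lin_of mIl_out_linear) mIlK
    mJr mGr mIr mjr mir mqr mjrP mirP (lin_of mir_out_linear) mirK.

Lemma moritaExt_compatible :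
  ext_compatible moritaExt <->
  [/\ weakly_compatible UN, weakly_compatible UM & weakly_compatible UI].
Proof.
have Hl (U : lmodType L) := compatible_factor (@in1K L B) (@in1_l L B) (@in1_r L B) U.
have Hl' (U : lmodType B) := compatible_factor (@in2K L B) (@in2_l L B) (@in2_r L B) U.
have Hr (U : lmodType L^c) := compatible_r_factor (@in1K L B) (@in1_l L B) (@in1_r L B) U.
have Hr' (U : lmodType B^c) := compatible_r_factor (@in2K L B) (@in2_l L B) (@in2_r L B) U.
split=> [[/compatible_prod[/Hl Nl /Hl' Ml] /Hl Il /compatible_r_prod[/Hr Mr /Hr' Nr] /Hr Ir]|].
  by split; split.
move=> [[Nl Nr] [Ml Mr] [Il Ir]]; split.
- by apply/compatible_prod; split; [apply/Hl | apply/Hl'].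
- exact/Hl.
- by apply/compatible_r_prod; split; [apply/Hr | apply/Hr'].
- exact/Hr.
Qed.
End MoritaSplitExt.

(** * The triangular argument *)

Section ExactTwoOfThree.
Variables (R : pzRingType) (P : complex R).
Hypotheses (pP : terms_in_proj P) (eP : exact_cx P).

Lemma tens_exact_ses (C D E : lmodType R^c) (i : {linear C -> D}) (q : {linear D -> E}) :
  ses i q -> tens_exact P C -> tens_exact P E -> tens_exact P D.
Proof.
move=> iq /(tens_exactP eP) PC /(tens_exactP eP) PE; apply/(tens_exactP eP) => j.
by apply: inj_tens_ses (iq) _ _ _ => //; apply: flat_of_proj => //; case: iq.
Qed.

Lemma tens_exact_quot (C D E : lmodType R^c) (i : {linear C -> D}) (q : {linear D -> E}) :
  ses i q -> tens_exact P C -> tens_exact P D -> tens_exact P E.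
Proof.
move=> iq /(tens_exactP eP) PC /(tens_exactP eP) PD; apply/(tens_exactP eP) => j.
apply: tor_balance_l (iq) (cx_ses eP j) (PD j) _.
apply: inj_tmapl_of (PC (j + 1)).
by apply: flat_of_proj => //; case: iq.
Qed.

Lemma hom_exact_ses (C D E : lmodType R) (i : {linear C -> D}) (q : {linear D -> E}) :
  ses i q -> hom_exact P C -> hom_exact P E -> hom_exact P D.
Proof.
move=> iq /(hom_exactP eP) PC /(hom_exactP eP) PE; apply/(hom_exactP eP) => j.
exact: ext_along_ses iq (pP j).1 _ _.
Qed.

Lemma hom_exact_quot (C D E : lmodType R) (i : {linear C -> D}) (q : {linear D -> E}) :
  ses i q -> hom_exact P C -> hom_exact P D -> hom_exact P E.
Proof.
move=> iq /(hom_exactP eP) PC /(hom_exactP eP) PD; apply/(hom_exactP eP).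
apply: int_succ => j.
exact: ext_along_quot (cx_ses eP j) iq (pP j).1 (PC j) (PD (j + 1)).
Qed.
End ExactTwoOfThree.

Section RestrComp.
Variables (R S U : pzRingType) (f : {rmorphism R -> S}) (g : {rmorphism S -> U}).

Lemma restr_comp (V : lmodType U) : lin_iso (restr f (restr g V)) (restr (g \o f) V).
Proof.
have L : linear (id : restr f (restr g V) -> restr (g \o f) V) by [].
by exists (lin_of L); exists id.
Qed.

Lemma restr_comp_r (V : lmodType U^c) :
  lin_iso (restr (cmorph f) (restr (cmorph g) V)) (restr (cmorph (g \o f)) V).
Proof.
have L : linear (id : restr (cmorph f) (restr (cmorph g) V) -> restr (cmorph (g \o f)) V).
  by [].
by exists (lin_of L); exists id.
Qed.

Lemma restr_prod (V W : lmodType S) :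
  lin_iso (restr f V * restr f W)%type (restr f (V * W)%type).
Proof.
have L : linear (id : restr f V * restr f W -> restr f (V * W)%type) by [].
by exists (lin_of L); exists id.
Qed.
End RestrComp.

Section Triangular.
Variables (A B : pzRingType) (M : bimodType B A) (N : bimodType A B).
Variables (mc : moritaContext M N) (S : pred A) (L : subPzRingType S).
Hypothesis phi0 : forall t, phi mc t = 0.
Hypothesis trivext : trivial_extension mc L.
Local Notation T := (mring mc).
Local Notation incl := (subring_incl L).
Local Notation I := (impsi mc).
Local Notation pi := (qpi phi0 trivext).
Local Notation rho := (rho trivext).
Local Notation LB := (L * B)%type.
Local Notation pr1 := (pr1 L B).
Local Notation pr2 := (pr2 L B).
Local Notation UN := (UN N L).
Local Notation UM := (UM M L).
Local Notation UI := (UI mc L).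
Local Notation E := (moritaExt phi0 trivext).

(** N, M and B over T, acting through T -> L * B. *)
Definition NT : lmodType T := restr pi (restr pr1 UN).
Definition MTr : lmodType T^c := restr (cmorph pi) (restr (cmorph pr1) (rmod UM)).
Definition BT : lmodType T := restr pi (restr pr2 B^o).
Definition BTr : lmodType T^c := restr (cmorph pi) (restr (cmorph pr2) (regularr B)).

Lemma lquad0_iso (X : lmodType A) (X0 : forall n m (x : X), psim mc n m *: x = 0)
    (V : lmodType T) (h : V -> X) :
  bijective h -> {morph h : x y / x + y} ->
  (forall (t : T) v, h (t *: v) = t.1.1 *: h v) ->
  lin_iso V (lquad_mod (lquad0 X0)).
Proof.
move=> [g hK gK] hD hZ.
have Lh : linear (fun v => (h v, tt) : lquad_mod (lquad0 X0)).
  move=> t x y; rewrite -[RHS]/(lquad_scale t ((h x, tt) : lquad_mod (lquad0 X0)) +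
    ((h y, tt) : lquad_mod (lquad0 X0))).
  rewrite hD hZ; case: t => [[a n] [m b]].
  by congr (_, _); rewrite -[RHS]/(a *: h x + 0 + h y) addr0.
exists (lin_of Lh); exists (fun z => g z.1) => [v|[x []]] /=; first exact: hK.
by rewrite gK.
Qed.

Lemma rquad0_iso (X : lmodType A^c)
    (X0 : forall n m (x : X), (psim mc n m : A^c) *: x = 0)
    (V : lmodType T^c) (h : V -> X) :
  bijective h -> {morph h : x y / x + y} ->
  (forall (t : T) v, h ((t : T^c) *: v) = (t.1.1 : A^c) *: h v) ->
  lin_iso V (rquad_mod (rquad0 X0)).
Proof.
move=> [g hK gK] hD hZ.
have Lh : linear (fun v => (h v, tt) : rquad_mod (rquad0 X0)).
  move=> t x y; rewrite -[RHS]/(rquad_scale t ((h x, tt) : rquad_mod (rquad0 X0)) +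
    ((h y, tt) : rquad_mod (rquad0 X0))).
  rewrite hD hZ; case: t => [[a n] [m b]].
  by congr (_, _); rewrite -[RHS]/((a : A^c) *: h x + 0 + h y) addr0.
exists (lin_of Lh); exists (fun z => g z.1) => [v|[x []]] /=; first exact: hK.
by rewrite gK.
Qed.

Lemma lquad_N_iso : lin_iso NT (lquad_mod (lquad_N phi0)).
Proof.
apply: (@lquad0_iso N (psim_N phi0) NT id) => // [|t v]; first by exists id.
rewrite [RHS](scale_rho_N phi0 trivext); by case: t => [[a n] [m b]].
Qed.

Lemma lquad_I_iso : lin_iso (restr pi (mIl mc L)) (lquad_mod (lquad_I phi0)).
Proof.
apply: (@lquad0_iso I (psim_impsi phi0) (restr pi (mIl mc L)) id) => // [|t v]; first by exists id.
apply: impsi_val_inj; rewrite -[RHS]/(t.1.1 * impsi_val v) (mul_rho_l phi0 trivext).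
by case: t => [[a n] [m b]].
Qed.

Lemma rquad_M_iso : lin_iso MTr (rquad_mod (rquad_M phi0)).
Proof.
apply: (@rquad0_iso (rmod M) (M_psim phi0) MTr id) => // [|t v]; first by exists id.
rewrite -[RHS]/((v : M) <* t.1.1) (scale_rho_M phi0 trivext).
by case: t => [[a n] [m b]].
Qed.

Lemma rquad_I_iso : lin_iso (restr (cmorph pi) (mIr mc L)) (rquad_mod (rquad_I phi0)).
Proof.
apply: (@rquad0_iso (rmod I) (impsi_psim phi0) (restr (cmorph pi) (mIr mc L)) id) => // [|t v].
  by exists id.
apply: impsi_val_inj; rewrite -[RHS]/(impsi_val v * t.1.1) (mul_rho_r phi0 trivext).
by case: t => [[a n] [m b]].
Qed.

Definition e1 : T := ((1, 0), (0, 0)).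

Lemma mul_e1 (t : T) : e1 * t = ((t.1.1, t.1.2), (0, 0)).
Proof.
case: t => [[a n] [m b]]; rewrite -[LHS]/(mring_mul _ _) /= mul1r scale1r.
by rewrite psim0l phim0l !rscale0l scale0r mul0r !addr0.
Qed.
Lemma mul_e1r (t : T) : t * e1 = ((t.1.1, 0), (t.2.1, 0)).
Proof.
case: t => [[a n] [m b]]; rewrite -[LHS]/(mring_mul _ _) /= mulr1 rscaler1.
by rewrite psim0r phim0r rscale0r !scaler0 mulr0 !addr0.
Qed.

(** The second row e2 T and the second column T e2 of the matrix ring, with e2
    the complement of e1, are cut out by e1. *)
Fact row_linear : linear (fun t : regularr T => e1 * (t : T) : regularr T).
Proof.
by move=> s x y; rewrite -[LHS]/(e1 * ((x : T) * s + y)) mulrDr mulrA.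
Qed.
Definition row2 : lmodType T^c := kermod (lin_of row_linear).
Fact col_linear : linear (fun t : T^o => (t : T) * e1 : T^o).
Proof. by move=> s x y; rewrite -[LHS]/((s * x + y) * e1) mulrDl -mulrA. Qed.
Definition col2 : lmodType T := kermod (lin_of col_linear).

Lemma row2P (t : T) : (exists x : row2, (val x : T) = t) <-> t.1 = 0.
Proof.
split=> [[x <-]|t1].
  have /eqP := submod_valP x; rewrite -[X in X = 0]/(e1 * (val x : T)) mul_e1.
  by case: (val x) => [[a n] [m b]] [-> ->].
have tP : submod_pred (ker_pred (lin_of row_linear)) t.
  by apply/eqP; rewrite -[LHS]/(e1 * t) mul_e1 t1.
by exists (Submod tP).
Qed.

Lemma col2P (t : T) : (exists x : col2, (val x : T) = t) <-> (t.1.1 = 0 /\ t.2.1 = 0).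
Proof.
split=> [[x <-]|[ta tm]].
  have /eqP := submod_valP x; rewrite -[X in X = 0]/((val x : T) * e1) mul_e1r.
  by case: (val x) => [[a n] [m b]] [-> ->].
have tP : submod_pred (ker_pred (lin_of col_linear)) t.
  by apply/eqP; rewrite -[LHS]/(t * e1) mul_e1r ta tm.
by exists (Submod tP).
Qed.

Lemma row2_retract : exists r : {linear regularr T -> row2},
  cancel (val : {linear row2 -> regularr T}) r.
Proof.
have [r rE] : exists r : {linear regularr T -> row2},
    forall t, (val : {linear row2 -> regularr T}) (r t) = (idfun \- lin_of row_linear) t.
  apply: factor_inj => [|t]; first exact: val_inj.
  apply/row2P; rewrite -[X in X.1]/((t : T) - e1 * (t : T)) mul_e1.
  by case: t => [[a n] [m b]]; congr (_, _); apply: subrr.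
exists r => x; apply: val_inj; apply: etrans (rE (val x)) _.
have /eqP x0 := submod_valP x.
by rewrite /= -[X in _ - X]/(lin_of row_linear (val x)) x0 subr0.
Qed.

Lemma col2_retract : exists r : {linear T^o -> col2},
  cancel (val : {linear col2 -> T^o}) r.
Proof.
have [r rE] : exists r : {linear T^o -> col2},
    forall t, (val : {linear col2 -> T^o}) (r t) = (idfun \- lin_of col_linear) t.
  apply: factor_inj => [|t]; first exact: val_inj.
  have tE : (idfun \- lin_of col_linear) t = ((0, (t : T).1.2), (0, (t : T).2.2)) :> T.
    rewrite -[LHS]/((t : T) - (t : T) * e1) mul_e1r.
    case: t => [[a n] [m b]]; congr ((_, _), (_, _)); rewrite ?subrr ?subr0 //.
  have /col2P[x xE] : (((0, (t : T).1.2), (0, (t : T).2.2)) : T).1.1 = 0 /\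
    (((0, (t : T).1.2), (0, (t : T).2.2)) : T).2.1 = 0 by [].
  by exists x; exact: etrans xE (esym tE).
exists r => x; apply: val_inj; apply: etrans (rE (val x)) _.
have /eqP x0 := submod_valP x.
by rewrite /= -[X in _ - X]/(lin_of col_linear (val x)) x0 subr0.
Qed.

(** M is a submodule of e2 T because the product M N in B is given by phi = 0;
    the quotient is B. *)
Lemma row2_ses : exists (i : {linear MTr -> row2}) (q : {linear row2 -> BTr}), ses i q.
Proof.
have Li : linear (fun m : MTr => ((0, 0), ((m : M), 0)) : regularr T).
  move=> t m m'; rewrite -[RHS]/(mring_mul ((0, 0), (m : M, 0)) t + ((0, 0), (m' : M, 0))).
  case: t => [[a n] [m1 b]]; congr ((_, _), (_, _)) => /=.
  - by rewrite mul0r psim0l !addr0.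
  - by rewrite scale0r rscale0l !addr0.
  - rewrite scale0r addr0 (scale_rho_M phi0 trivext); exact: erefl.
  - by rewrite mul0r addr0 [phim _ _ _]phi0 addr0.
have [i iE] : exists i : {linear MTr -> row2},
    forall m, (val : {linear row2 -> regularr T}) (i m) = lin_of Li m.
  by apply: factor_inj => [|m]; [exact: val_inj | exact/row2P].
pose q : {linear row2 -> BTr} :=
  rlin (cmorph pi) (ringmap_r pr2) \o (ringmap_r pi \o (val : {linear row2 -> regularr T})).
exists i, q; split=> [m m' e|b|x].
- by have := iE m; rewrite e iE => -[].
- have /row2P[x xE] : (((0, 0), (0, b)) : T).1 = 0 by [].
  by exists x; rewrite /= xE.
split=> [xb|[m <-]]; last by rewrite -[LHS]/((val (i m) : T).2.2) iE.
exists (val x : T).2.1; apply: val_inj; rewrite iE.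
have /row2P : exists y : row2, (val y : T) = val x by exists x.
move: xb; rewrite -[LHS]/((val x : T).2.2).
by case: (val x) => [[a n] [m b]] /= -> [-> ->].
Qed.

Lemma col2_ses : exists (i : {linear NT -> col2}) (q : {linear col2 -> BT}), ses i q.
Proof.
have Li : linear (fun n : NT => ((0, (n : N)), (0, 0)) : T^o).
  move=> t n n'; rewrite -[RHS]/(mring_mul t ((0, (n : N)), (0, 0)) + ((0, (n' : N)), (0, 0))).
  case: t => [[a n1] [m b]]; congr ((_, _), (_, _)) => /=.
  - by rewrite mulr0 psim0r !addr0.
  - rewrite rscale0r addr0 (scale_rho_N phi0 trivext); exact: erefl.
  - by rewrite rscale0r scaler0 !addr0.
  - by rewrite mulr0 addr0 [phim _ _ _]phi0 addr0.
have [i iE] : exists i : {linear NT -> col2},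
    forall n, (val : {linear col2 -> T^o}) (i n) = lin_of Li n.
  by apply: factor_inj => [|n]; [exact: val_inj | exact/col2P].
pose q : {linear col2 -> BT} :=
  rlin pi (ringmap_l pr2) \o (ringmap_l pi \o (val : {linear col2 -> T^o})).
exists i, q; split=> [m m' e|b|x].
- by have := iE m; rewrite e iE => -[].
- have /col2P[x xE] : (((0, 0), (0, b)) : T).1.1 = 0 /\ (((0, 0), (0, b)) : T).2.1 = 0.
    by [].
  by exists x; rewrite /= xE.
split=> [xb|[m <-]]; last by rewrite -[LHS]/((val (i m) : T).2.2) iE.
exists (val x : T).1.2; apply: val_inj; rewrite iE.
have /col2P : exists y : col2, (val y : T) = val x by exists x.
move: xb; rewrite -[LHS]/((val x : T).2.2).
by case: (val x) => [[a n] [m b]] /= -> [-> ->].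
Qed.

(** The sequences for e2 T and T e2 give total exactness after base change to
    B; compatibility over B then supplies the N part of J on the right and the M
    part on the left, while M on the right, N on the left and I are given. *)
Lemma quotient_exact_of_corner :
  ext_compatible E ->
  semi_weakly_compatible NT -> semi_weakly_compatible (restr pi (mIl mc L)) ->
  semi_weakly_compatible_r MTr ->
  semi_weakly_compatible_r (restr (cmorph pi) (mIr mc L)) ->
  quotient_exact E.
Proof.
move=> /moritaExt_compatible[[UNl UNr] [UMl UMr] _] cN cI cM cIr Q pQ tQ.
have [eQ hQ] := tQ.
pose pi2 : {rmorphism T -> B} := pr2 \o pi.
have tB : tens_exact Q (restr (cmorph pi2) (regularr B)).
  have [r rK] := row2_retract; have [i [q iq]] := row2_ses.
  apply: tens_exact_iso (restr_comp_r pi pr2 (regularr B)) _ => //.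
  apply: tens_exact_quot iq (cM _ pQ tQ) _ => //.
  by apply: tens_exact_retract rK _ => //; apply: tens_exact_regular.
have hB : hom_exact Q (restr pi2 B^o).
  have [r rK] := col2_retract; have [i [q iq]] := col2_ses.
  apply: hom_exact_iso (restr_comp pi pr2 B^o) _ => //.
  apply: hom_exact_quot iq (cN _ pQ tQ) _ => //.
  exact: hom_exact_retract rK _.
have pQB : terms_in_proj (ind_cx pi2 Q) by apply: ind_cx_proj.
have tQB : totally_exact (ind_cx pi2 Q) by apply: ind_cx_total.
have tN : tens_exact Q (restr (cmorph pi) (restr (cmorph pr2) (rmod UN))).
  apply: tens_exact_iso (lin_iso_sym (restr_comp_r pi pr2 (rmod UN))) _ => //.
  by apply/tens_exact_ind; apply: UNr.
have hM : hom_exact Q (restr pi (restr pr2 UM)).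
  apply: hom_exact_iso (lin_iso_sym (restr_comp pi pr2 UM)) _ => //.
  by apply/hom_exact_ind; apply: UMl.
split.
- apply: tens_exact_quot (mjrP phi0 trivext) _ (tens_exact_regular eQ) => //.
  apply: tens_exact_ses (mirP phi0 trivext) (cIr _ pQ tQ) _ => //.
  apply: tens_exact_iso (restr_prod (cmorph pi) (restr (cmorph pr1) (rmod UM))
    (restr (cmorph pr2) (rmod UN))) _ => //.
  by apply: tens_exact_prod => //; apply: cM.
- apply: hom_exact_quot (mjlP phi0 trivext) _ hQ => //.
  apply: hom_exact_ses (milP phi0 trivext) (cI _ pQ tQ) _ => //.
  apply: hom_exact_iso (restr_prod pi (restr pr1 UN) (restr pr2 UM)) _ => //.
  by apply: hom_exact_prod => //; apply: cN.
Qed.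

Lemma corner_of_quotient_exact :
  ext_compatible E -> quotient_exact E ->
  [/\ semi_weakly_compatible NT, semi_weakly_compatible (restr pi (mIl mc L)),
      semi_weakly_compatible_r MTr
    & semi_weakly_compatible_r (restr (cmorph pi) (mIr mc L))].
Proof.
move=> cE qE; have [cG cI cGr cIr] := cE.
have [cN _] := (compatible_prod _ _).1 cG.
have [cM _] := (compatible_r_prod _ _).1 cGr.
split=> Q pQ tQ.
- exact: (quotient_hom (E := E)).
- exact: (quotient_hom (E := E)).
- exact: (quotient_tens (E := E)).
- exact: (quotient_tens (E := E)).
Qed.

Lemma compatible_conditions :
  ([/\ weakly_compatible UN, weakly_compatible UM & weakly_compatible UI] /\
   [/\ semi_weakly_compatible (lquad_mod (lquad_N phi0)),
       semi_weakly_compatible (lquad_mod (lquad_I phi0)),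
       semi_weakly_compatible_r (rquad_mod (rquad_M phi0))
     & semi_weakly_compatible_r (rquad_mod (rquad_I phi0))]) <->
  ext_compatible E /\ quotient_exact E.
Proof.
have iN := lquad_N_iso; have iI := lquad_I_iso.
have iM := rquad_M_iso; have iIr := rquad_I_iso.
split=> [[/moritaExt_compatible-/(_ phi0 trivext) cE [cN cI cM cIr]]|[cE qE]].
  split=> //; apply: quotient_exact_of_corner => //.
  - exact: compatible_iso (lin_iso_sym iN) cN.
  - exact: compatible_iso (lin_iso_sym iI) cI.
  - exact: compatible_r_iso (lin_iso_sym iM) cM.
  - exact: compatible_r_iso (lin_iso_sym iIr) cIr.
split; first exact/(moritaExt_compatible phi0 trivext).
have [cN cI cM cIr] := corner_of_quotient_exact cE qE; split.
- exact: compatible_iso iN cN.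
- exact: compatible_iso iI cI.
- exact: compatible_r_iso iM cM.
- exact: compatible_r_iso iIr cIr.
Qed.
End Triangular.

(** * Noetherian modules *)

Section Noetherian.
Variable R : pzRingType.

(** The span of a list, by recursion, so that induction on generators is
    structural. *)
Fixpoint in_span (V : lmodType R) (s : seq V) (v : V) : Prop :=
  if s is x :: s' then exists r : R, in_span s' (v - r *: x) else v = 0.

Section Span.
Variable V : lmodType R.
Implicit Types (s : seq V) (u v x : V).

Lemma in_span0 s : in_span s 0.
Proof. by elim: s => //= x s IHs; exists 0; rewrite scale0r subr0. Qed.

Lemma in_spanP s (a : R) u v : in_span s u -> in_span s v -> in_span s (a *: u + v).
Proof.
elim: s u v => /= [u v -> ->|x s IHs u v [r ur] [t vt]].
  by rewrite scaler0 addr0.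
exists (a * r + t); rewrite scalerDl -scalerA.
have -> : a *: u + v - (a *: (r *: x) + t *: x) = a *: (u - r *: x) + (v - t *: x).
  by rewrite scalerBr opprD addrACA.
exact: IHs.
Qed.

Lemma in_spanD s u v : in_span s u -> in_span s v -> in_span s (u + v).
Proof. by move=> us vs; rewrite -[u]scale1r; apply: in_spanP. Qed.

Lemma in_span_mem s x : x \in s -> in_span s x.
Proof.
elim: s => //= y s IHs; rewrite inE => /predU1P[->|/IHs xs].
  by exists 1; rewrite scale1r subrr; apply: in_span0.
by exists 0; rewrite scale0r subr0.
Qed.

Lemma in_span_sum s n (c : 'I_n -> R) (w : 'I_n -> V) :
  (forall i, w i \in s) -> in_span s (\sum_i c i *: w i).
Proof.
move=> ws; elim/big_rec: _ => [|i u _ us]; first exact: in_span0.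
by apply: in_spanP => //; apply: in_span_mem.
Qed.

Lemma in_span_catr s s' v : in_span s' v -> in_span (s ++ s') v.
Proof. by move=> vs; elim: s => //= x s IHs; exists 0; rewrite scale0r subr0. Qed.

Lemma in_span_catl s s' v : in_span s v -> in_span (s ++ s') v.
Proof.
elim: s v => /= [v ->|x s IHs v [r /IHs]]; first exact: in_span0.
by exists r.
Qed.

Lemma in_span_ind (P : V -> Prop) s v :
  P 0 -> (forall (a : R) u u', P u -> P u' -> P (a *: u + u')) ->
  (forall x, x \in s -> P x) -> in_span s v -> P v.
Proof.
move=> P0 PP; elim: s v => /= [v _ -> //|x s IHs v Ps [r vr]].
rewrite -[v](subrK (r *: x)) addrC; apply: PP; first by apply: Ps; rewrite inE eqxx.
by apply: IHs vr => y ys; apply: Ps; rewrite inE ys orbT.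
Qed.
End Span.

Variable V : lmodType R.
Hypothesis noeth : left_noetherian R.

(** Induction on the generators: the coefficients of the first one that occur
    in U form a left ideal. *)
Lemma noetherian_span (s : seq V) (U : V -> Prop) :
  U 0 -> (forall (a : R) u v, U u -> U v -> U (a *: u + v)) ->
  (forall u, U u -> in_span s u) ->
  exists s', (forall x, x \in s' -> U x) /\ forall u, U u -> in_span s' u.
Proof.
elim: s U => [|x s IHs] U U0 UP Us; first by exists [::]; split=> // u /Us.
pose J : {pred R^o} := fun r => `[< exists2 u, U u & in_span s (u - (r : R) *: x) >].
have JC : submod_closed J.
  split=> [|a r t /asboolP[u Uu ur] /asboolP[v Uv vt]].
    by apply/asboolP; exists 0 => //; rewrite scale0r subr0; apply: in_span0.
  apply/asboolP; exists (a *: u + v); first exact: UP.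
  rewrite scalerDl -[(a *: r : R) *: x]scalerA.
  have -> : a *: u + v - (a *: ((r : R) *: x) + (t : R) *: x) =
    a *: (u - (r : R) *: x) + (v - (t : R) *: x) by rewrite scalerBr opprD addrACA.
  exact: in_spanP.
pose Jc : submodClosed R^o := HB.pack J (GRing.isSubmodClosed.Build R R^o J JC).
have [n [e eE]] := noeth Jc.
have /choice[w wP] (i : 'I_n) : exists u, U u /\ in_span s (u - (submod_val (e i) : R) *: x).
  by have /asboolP[u Uu us] := submod_valP (e i); exists u.
have [||u [] //|s' [s'U s'P]] := IHs (fun u => U u /\ in_span s u).
- by split=> //; apply: in_span0.
- by move=> a u v [Uu us] [Uv vs]; split; [apply: UP | apply: in_spanP].
exists ([seq w i | i <- enum 'I_n] ++ s'); split=> [y|u Uu].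
  by rewrite mem_cat => /orP[/mapP[i _ ->]|/s'U[]//]; case: (wP i).
have [r ur] := Us u Uu.
have rJ : submod_pred Jc r by apply/asboolP; exists u.
have [c /(congr1 (@submod_val _ _ Jc))] := eE (Submod rJ).
move=> /= rE0; have rE : r = \sum_i c i * submod_val (e i).
  exact: etrans rE0 (linear_sum (val : {linear submod Jc -> R^o}) _ _ _).
pose v := \sum_i c i *: w i.
have Uv : U v by rewrite /v; elim/big_rec: _ => // i y _; apply: UP; case: (wP i).
have vs : in_span s (v - r *: x).
  rewrite rE scaler_suml -sumrB.
  elim/big_rec: _ => [|i y _ ys]; first exact: in_span0.
  rewrite -scalerA -scalerBr.
  by apply: in_spanP => //; case: (wP i).
have /s'P uvs : U (u - v) /\ in_span s (u - v).
  split; first by rewrite addrC -scaleN1r; apply: UP.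
  have -> : u - v = (-1) *: (v - r *: x) + (u - r *: x).
    by rewrite scaleN1r opprB [RHS]addrC addrA subrK.
  exact: in_spanP.
rewrite -(subrK v u); apply: in_spanD; first exact: in_span_catr.
apply: in_span_catl; apply: in_span_sum => i.
by apply/mapP; exists i => //; rewrite mem_enum.
Qed.

Lemma fin_gen_span : fin_gen V -> exists s : seq V, forall v, in_span s v.
Proof.
move=> [n [e eE]]; exists [seq e i | i <- enum 'I_n] => v.
have [c ->] := eE v; apply: in_span_sum => i.
by apply/mapP; exists i => //; rewrite mem_enum.
Qed.

(** A surjective endomorphism of a noetherian module is injective: the union
    of the kernels of its powers is finitely generated, hence is one of them. *)
Lemma hopfian (h : {linear V -> V}) : fin_gen V -> surj h -> injective h.
Proof.
move=> /fin_gen_span[s sP] hS.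
have iterP n (a : R) u v : iter n h (a *: u + v) = a *: iter n h u + iter n h v.
  by elim: n => //= n ->; rewrite linearP.
have iter0 n : iter n h 0 = 0 by elim: n => //= n ->; rewrite linear0.
have iterA m n u : iter n h u = 0 -> iter (m + n) h u = 0.
  by move=> u0; rewrite iterD u0 iter0.
(* Generators s' of the union of the kernels of the powers of h. *)
have [|a u v [m um] [n vn]|//|s' [s'U s'P]] :=
    @noetherian_span s (fun u => exists n, iter n h u = 0).
- by exists 0.
- by exists (m + n)%N; rewrite iterP [X in _ + X]iterA // addr0 addnC iterA // scaler0.
have [n nP] : exists n, forall x, x \in s' -> iter n h x = 0.
  elim: (s') s'U => [|x t IHt] tU; first by exists 0.
  have [m xm] := tU x (mem_head _ _).
  have [n nP] : exists n, forall y, y \in t -> iter n h y = 0.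
    by apply: IHt => y yt; apply: tU; rewrite inE yt orbT.
  exists (m + n)%N => y; rewrite inE => /predU1P[->|yt]; first by rewrite addnC iterA.
  by apply: iterA; apply: nP.
have nK u : (exists m, iter m h u = 0) -> iter n h u = 0.
  move=> /s'P us; apply: (in_span_ind (P := fun v => iter n h v = 0) _ _ nP us) => //.
  move=> a v v' v0 v'0.
  by rewrite iterP v0 v'0 scaler0 addr0.
have itS m u : exists v, iter m h v = u.
  elim: m u => [|m IHm] u; first by exists u.
  by have [v <-] := hS u; have [v' <-] := IHm v; exists v'.
apply: inj_lker0 => x hx; have [y yx] := itS n x.
by rewrite -yx nK //; exists n.+1; rewrite /= yx.
Qed.
End Noetherian.

(** Composing the canonical surjection C -> Y with an abstract isomorphism
    Y -> C gives a surjective endomorphism of the noetherian module C. *)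
Lemma iso_canonical (R : pzRingType) (F C Y : lmodType R) (q : {linear F -> C})
    (g : {linear F -> Y}) :
  left_noetherian R -> fin_gen C -> surj q -> surj g ->
  (forall s, q s = 0 -> g s = 0) ->
  (lin_iso Y C <-> forall s, g s = 0 -> q s = 0).
Proof.
move=> noeth fgC qS gS qg; have [c cE] := factor_surj qS qg.
have cS : surj c by move=> y; have [s <-] := gS y; exists (q s).
split=> [[h hB] s gs|gq].
  have hcS : surj (h \o c).
    move=> z; have [h' h'K hK'] := hB; have [z' z'E] := cS (h' z).
    by exists z'; rewrite /= z'E hK'.
  by apply: (hopfian noeth fgC hcS); rewrite /= cE gs !linear0.
apply: lin_iso_sym; exists c; apply: inj_surj_bij => //.
apply: inj_lker0 => z; have [s <-] := qS z; rewrite cE; exact: gq.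
Qed.

Lemma fin_gen_ltens (R S : pzRingType) (M : bimodType R S) (X : lmodType S) :
  fin_gen M -> fin_gen X -> fin_gen (ltens M X).
Proof.
move=> [n [e eE]] [k [z zE]].
apply: (@fin_gen_fintype R (ltens M X) ('I_n * 'I_k)%type
  (fun ij => (e ij.1 : rmod M) \ot z ij.2)) => t.
elim/tens_ind: t => [|s t [c ->] [d ->]|m x].
- by exists (fun=> 0); rewrite big1 // => i _; rewrite scale0r.
- exists (fun i => c i + d i); rewrite -big_split; apply: eq_bigr => i _ /=.
  by rewrite scalerDl.
have [a ->] := zE x; have [b bE] := choice (fun j => eE ((m : M) <* a j)).
exists (fun ij => b ij.2 ij.1).
rewrite -(pair_bigA _ (fun i j => b j i *: ((e i : rmod M) \ot z j : ltens M X))).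
rewrite exchange_big /=.
pose h : {additive X -> ltens M X} := add_of (tmulDr (m : rmod M)).
rewrite -[LHS]/(h (\sum_i a i *: z i)) raddf_sum; apply: eq_bigr => j _.
rewrite -[LHS]/(m \ot (a j *: z j)) -tmul_mid.
rewrite -[(_ *: m)]/(((m : M) <* a j : M) : rmod M) (bE j).
pose h' : {additive M -> ltens M X} := add_of (fun u v => tmulDl (u : rmod M) (v : rmod M) (z j)).
rewrite -[LHS]/(h' (\sum_i b j i *: e i)) raddf_sum; apply: eq_bigr => i _.
by rewrite [RHS]ltens_scaleE.
Qed.

Section ImageIso.
Variables (R : pzRingType) (F C V : lmodType R) (q : {linear F -> C})
  (g : {linear F -> V}) (D E : submodClosed V).
Hypotheses (noeth : left_noetherian R) (fgC : fin_gen C) (qS : surj q).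
Hypothesis gD : forall v, v \in D <-> exists s, g s = v.

Lemma corestr_ex : exists g' : {linear F -> submod D},
  (forall s, submod_val (g' s) = g s) /\ surj g'.
Proof.
have [g' gE] : exists g' : {linear F -> submod D},
    forall s, (val : {linear submod D -> V}) (g' s) = g s.
  apply: factor_inj => [|s]; first exact: val_inj.
  have sP : submod_pred D (g s) by apply/gD; exists s.
  by exists (Submod sP).
exists g'; split=> // y; have /gD[s sE] : submod_val y \in D := submod_valP y.
by exists s; apply: val_inj; apply: etrans (gE s) sE.
Qed.

Lemma image_iso : (forall s, q s = 0 -> g s = 0) ->
  (lin_iso (submod D) C <-> forall s, g s = 0 -> q s = 0).
Proof.
move=> qg; have [g' [gE g'S]] := corestr_ex.
have g0 s : g' s = 0 <-> g s = 0.
  by rewrite -gE; split=> [->//|e]; apply: val_inj.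
apply: iff_trans (iso_canonical noeth fgC qS g'S _) _; first by move=> s /qg/g0.
by split=> H s; [move=> /g0/H | move=> /g0/H].
Qed.

Lemma image_quotient_iso : (forall s, q s = 0 -> g s \in E) ->
  (lin_iso (relquot D E) C <-> forall s, g s \in E -> q s = 0).
Proof.
move=> qg; have [g' [gE g'S]] := corestr_ex.
pose r := quot_map (relquot_pred (S := D) E).
have g0 s : r (g' s) = 0 <-> g s \in E by rewrite quot_mapE -gE.
apply: iff_trans (iso_canonical (g := r \o g') noeth fgC qS _ _) _.
- by move=> y; have [z <-] := quot_map_surj y; have [s <-] := g'S z; exists s.
- by move=> s /qg/g0.
by split=> H s; [move=> /g0/H | move=> /g0/H].
Qed.
End ImageIso.

(** * Quadruples and their tensor conditions *)

(** Tensor products over T seen over R: the right T-module D is the right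
    R-module C through a function chi : T -> R (not a ring map in general), and
    sigma embeds X in W so that W/rad W = X/ker q as far as D can tell. *)
Lemma tens_cover (T R : pzRingType) (D : lmodType T^c) (C : lmodType R^c)
    (h : D -> C) (hi : C -> D) (chi : T -> R) (j : R -> T)
    (W : lmodType T) (X Z : lmodType R) (p : W -> Z) (sigma : X -> W) (tau : W -> X)
    (q : {linear X -> Z}) :
  cancel h hi -> cancel hi h -> {morph h : x y / x + y} ->
  (forall (t : T) d, h ((t : T^c) *: d) = (chi t : R^c) *: h d) -> cancel j chi ->
  {morph p : x y / x + y} -> (forall t w, p (t *: w) = chi t *: p w) ->
  {morph sigma : x y / x + y} -> (forall r x, sigma (r *: x) = j r *: sigma x) ->
  surj q -> (forall x, p (sigma x) = q x) ->
  (forall (d : D) x, q x = 0 -> d \ot sigma x = 0) ->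
  (forall (d : D) w, d \ot w = d \ot sigma (tau w)) ->
  exists Xi : {additive tens C X -> tens D W},
    [/\ surj Xi, forall c x, Xi (c \ot x) = hi c \ot sigma x
      & forall s, Xi s = 0 <-> tmapr q s = 0].
Proof.
move=> hK hiK hD hZ jK pD pZ sD sZ qS ps kill cover.
have hiD : {morph hi : x y / x + y}.
  by move=> x y; apply: (can_inj hK); rewrite hD !hiK.
have XiB : balanced (fun c x => hi c \ot sigma x).
  split=> [x c c'|c x x'|c r x]; first by rewrite hiD tmulDl.
    by rewrite sD tmulDr.
  rewrite sZ -tmul_mid; congr (_ \ot _); apply: (can_inj hK).
  by rewrite hiK hZ jK hiK.
have ThB : balanced (fun d w => h d \ot p w).
  split=> [x c c'|c x x'|c t x]; first by rewrite hD tmulDl.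
    by rewrite pD tmulDr.
  by rewrite pZ hZ tmul_mid.
exists (tlift_of XiB); split=> [t|c x|s]; last split=> [s0|].
- elim/tens_ind: t => [|s t [x <-] [y <-]|d w].
  + by exists 0; rewrite raddf0.
  + by exists (x + y); rewrite raddfD.
  + by exists (h d \ot tau w); rewrite tlift_ofE hK -cover.
- exact: tlift_ofE.
(* h (x) p recovers the class of s in C (x) Z from its image under Xi. *)
- have <- : tlift_of ThB (tlift_of XiB s) = tmapr q s.
    move: s {s0}; apply: (tens_additive_ext (f := tlift_of ThB \o tlift_of XiB)
      (g := tmapr q)) => c x.
    rewrite -[LHS]/(tlift_of ThB (tlift_of XiB (c \ot x))) (tlift_ofE XiB) (tlift_ofE ThB).
    by rewrite hiK ps [RHS]tmaprE.
  by rewrite s0 raddf0.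
have [_ _ kE] := ses_kermod qS.
move=> /(tmapr_exact qS kE)[s' <-].
rewrite -[RHS]/((\0 : {additive _ -> _}) s').
move: s'; apply: (tens_additive_ext (f := tlift_of XiB \o tmapr (val : {linear kermod q -> X}))
  (g := \0)) => c x.
rewrite -[LHS]/(tlift_of XiB (tmapr (val : {linear kermod q -> X}) (c \ot x))) tmaprE.
by rewrite tlift_ofE kill //; apply/kE; exists x.
Qed.

Section Bridge.
Variables (A B : pzRingType) (M : bimodType B A) (N : bimodType A B).
Variables (mc : moritaContext M N) (S : pred A) (L : subPzRingType S).
Hypothesis phi0 : forall t, phi mc t = 0.
Hypothesis trivext : trivial_extension mc L.
Variable Q : lquad mc.
Local Notation T := (mring mc).
Local Notation incl := (subring_incl L).
Local Notation I := (impsi mc).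
Local Notation pi := (qpi phi0 trivext).
Local Notation rho := (rho trivext).
Local Notation LB := (L * B)%type.
Local Notation pr1 := (pr1 L B).
Local Notation pr2 := (pr2 L B).
Local Notation UN := (UN N L).
Local Notation UM := (UM M L).
Local Notation UI := (UI mc L).
Local Notation X := (lX Q).
Local Notation Y := (lY Q).
Local Notation W := (lquad_mod Q).
Local Notation IX := (impsi_mul_pred mc X).
Local Notation jr := (mjr phi0 trivext).
Local Notation ir := (mir phi0 trivext).
Local Notation qr := (mqr phi0 trivext).

Definition qg : {linear X -> coker (lg Q)} := quot_map (im_pred (lg Q)).
Definition qf : {linear Y -> coker (lf Q)} := quot_map (im_pred (lf Q)).

Lemma qgE x : qg x = 0 <-> exists t, lg Q t = x.
Proof. by rewrite quot_mapE; split=> [/asboolP|]; last by move=> ?; apply/asboolP. Qed.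
Lemma qfE x : qf x = 0 <-> exists t, lf Q t = x.
Proof. by rewrite quot_mapE; split=> [/asboolP|]; last by move=> ?; apply/asboolP. Qed.
Lemma qg_surj : surj qg. Proof. exact: quot_map_surj. Qed.
Lemma qf_surj : surj qf. Proof. exact: quot_map_surj. Qed.

Lemma scaleW (t : T) (w : W) :
  t *: w = (t.1.1 *: w.1 + lgm t.1.2 w.2, lfm t.2.1 w.1 + t.2.2 *: w.2).
Proof. by case: t w => [[a n] [m b]] [x y]. Qed.

Lemma qg_lgm n y : qg (lgm n y) = 0.
Proof. by apply/qgE; exists ((n : rmod N) \ot y). Qed.
Lemma qf_lfm m x : qf (lfm m x) = 0.
Proof. by apply/qfE; exists ((m : rmod M) \ot x). Qed.

(** psi (n (x) m) x = g (n (x) f (m (x) x)) lies in Im g. *)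
Lemma impsi_lg (i : I) x : qg (impsi_val i *: x) = 0.
Proof.
have [t <-] := impsi_valP i; elim/tens_ind: t => [|s t IHs IHt|n m].
- by rewrite raddf0 scale0r linear0.
- by rewrite raddfD scalerDl linearD IHs IHt addr0.
- by apply/qgE; exists ((n : rmod N) \ot lf Q ((m : rmod M) \ot x)); rewrite lgf.
Qed.
Lemma qg_rho a x : qg (a *: x) = incl (rho a) *: qg x.
Proof.
by rewrite -{1}(rho_sigma trivext a) scalerDl linearD impsi_lg addr0 linearZ.
Qed.

Definition topmod : lmodType LB :=
  (restr pr1 (restr incl (coker (lg Q))) * restr pr2 (coker (lf Q)))%type.

Fact top_linear : linear (fun w : W => (qg w.1, qf w.2) : restr pi topmod).
Proof.
move=> t w w'; rewrite scaleW.
rewrite -[LHS]/(qg (t.1.1 *: w.1 + lgm t.1.2 w.2 + w'.1),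
  qf (lfm t.2.1 w.1 + t.2.2 *: w.2 + w'.2)).
rewrite !linearD qg_lgm qf_lfm addr0 add0r qg_rho linearZ.
by case: t => [[a n] [m b]].
Qed.

(** W/JW is the pair of cokernels. *)
Lemma ind_top : lin_iso (ind pi W) topmod.
Proof.
have unit0 (t : T) (w : W) : pi t = 0 -> ind_unit pi (t *: w) = 0.
  move=> t0; rewrite linearZ.
  by rewrite -[LHS]/(pi t *: (ind_unit pi w : ind pi W)) t0 scale0r.
exists (ind_lift (lin_of top_linear)); apply: inj_surj_bij => [|[x y]]; last first.
  have [x' <-] := qg_surj x; have [y' <-] := qf_surj y.
  by exists (ind_unit pi ((x', y') : W)); rewrite ind_lift_unit.
apply: inj_lker0 => z; have [[x y] <-] := ind_unit_surj (qpi_surj phi0 trivext) z.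
rewrite ind_lift_unit => -[/qgE[s <-] /qfE[t <-]].
have -> : (lg Q s, lf Q t) = (lg Q s, 0) + (0, lf Q t) :> W.
  by rewrite [RHS]surjective_pairing /= addr0 add0r.
rewrite linearD -[RHS](addr0 0); congr (_ + _).
- elim/tens_ind: s => [|s s' IHs IHs'|n y'].
  + by rewrite linear0; apply: linear0.
  + rewrite linearD (_ : (_, 0) = (lg Q s, 0) + (lg Q s', 0) :> W).
      by rewrite linearD IHs IHs' addr0.
    by rewrite [RHS]surjective_pairing /= addr0.
  + have -> : (lg Q ((n : rmod N) \ot y'), 0) = (((0, n), (0, 0)) : T) *: ((0, y') : W).
      by rewrite scaleW /= scale0r add0r scale0r addr0 lfm0l.
    by apply: unit0; congr (_, _); apply: rmorph0.
- elim/tens_ind: t => [|s' s'' IHs IHs'|m x'].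
  + by rewrite linear0; apply: linear0.
  + rewrite linearD (_ : (0, _) = (0, lf Q s') + (0, lf Q s'') :> W).
      by rewrite linearD IHs IHs' addr0.
    by rewrite [RHS]surjective_pairing /= addr0.
  + have -> : (0, lf Q ((m : rmod M) \ot x')) = (((0, 0), (m, 0)) : T) *: ((x', 0) : W).
      by rewrite scaleW /= scale0r add0r scale0r addr0 lgm0l.
    by apply: unit0; congr (_, _); apply: rmorph0.
Qed.

Lemma cokers_gp :
  gorenstein_projective (ind pi W) <-> cokers_gorenstein_projective L Q.
Proof.
have <- : gorenstein_projective topmod <-> cokers_gorenstein_projective L Q.
  by rewrite /cokers_gorenstein_projective; split=> [/gp_product[]|[g1 g2]];
    [split | apply/gp_product].
by split; apply: gp_iso; [exact: ind_top | exact: lin_iso_sym ind_top].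
Qed.

Lemma tmul_act0 (D : lmodType T^c) (d : D) (t : T) (w : W) :
  ((t : T^c) *: d = 0) -> d \ot (t *: w) = 0.
Proof. by move=> td; rewrite -tmul_mid td tmul0l. Qed.

Lemma cover_row1 (D : lmodType T^c) (C : lmodType A^c) (h : D -> C) (hi : C -> D) :
  cancel h hi -> cancel hi h -> {morph h : x y / x + y} ->
  (forall (t : T) d, h ((t : T^c) *: d) = (t.1.1 : A^c) *: h d) ->
  exists Xi : {additive tens C X -> tens D W},
    [/\ surj Xi, forall c x, Xi (c \ot x) = hi c \ot ((x, 0) : W),
        forall s, Xi s = 0 <-> tmapr qg s = 0
      & forall (d : D) (w : W), d \ot w = d \ot ((w.1, 0) : W)].
Proof.
move=> hK hiK hD hZ.
have act0 (d : D) (t : T) : t.1.1 = 0 -> (t : T^c) *: d = 0.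
  move=> t0; apply: (can_inj hK); rewrite hZ t0 scale0r.
  by apply: (addIr (h 0)); rewrite -hD !add0r.
have D2 (d : D) y : d \ot ((0, y) : W) = 0.
  have -> : (0, y) = (((0, 0), (0, 1)) : T) *: ((0, y) : W).
    by rewrite scaleW /= scale1r scale0r lgm0l lfm0l !add0r.
  exact/tmul_act0/act0.
have cover (d : D) (w : W) : d \ot w = d \ot ((w.1, 0) : W).
  have {1}-> : w = (w.1, 0) + (0, w.2).
    by rewrite [RHS]surjective_pairing /= addr0 add0r; case: w.
  by rewrite tmulDr D2 addr0.
have [|||||||||Xi [XiS XiE Xi0]] := @tens_cover T A D C h hi (fun t => t.1.1)
  (fun a => ((a, 0), (0, 0))) W X (coker (lg Q)) (fun w => qg w.1) (fun x => (x, 0))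
  (fun w => w.1) qg hK hiK hD hZ; try by [].
- by move=> w w'; exact: (linearD qg w.1 w'.1).
- by move=> t w; rewrite scaleW -[LHS]/(qg (t.1.1 *: w.1 + lgm t.1.2 w.2)) linearD qg_lgm addr0 linearZ.
- by move=> x x'; rewrite [RHS]surjective_pairing /= addr0.
- by move=> a x; rewrite scaleW /= lgm0l scale0r addr0 lfm0l addr0.
- exact: qg_surj.
- move=> d x /qgE[s <-]; elim/tens_ind: s => [|s s' IHs IHs'|n y].
  + by rewrite linear0; apply: tmul0r.
  + rewrite linearD (_ : (_, 0) = (lg Q s, 0) + (lg Q s', 0) :> W).
      by rewrite tmulDr IHs IHs' addr0.
    by rewrite [RHS]surjective_pairing /= addr0.
  + have -> : (lg Q ((n : rmod N) \ot y), 0) = (((0, n), (0, 0)) : T) *: ((0, y) : W).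
      by rewrite scaleW /= scale0r add0r scale0r addr0 lfm0l.
    exact/tmul_act0/act0.
by exists Xi.
Qed.

Lemma cover_row2 (D : lmodType T^c) (C : lmodType B^c) (h : D -> C) (hi : C -> D) :
  cancel h hi -> cancel hi h -> {morph h : x y / x + y} ->
  (forall (t : T) d, h ((t : T^c) *: d) = (t.2.2 : B^c) *: h d) ->
  exists Xi : {additive tens C Y -> tens D W},
    [/\ surj Xi, forall c y, Xi (c \ot y) = hi c \ot ((0, y) : W),
        forall s, Xi s = 0 <-> tmapr qf s = 0
      & forall (d : D) (w : W), d \ot w = d \ot ((0, w.2) : W)].
Proof.
move=> hK hiK hD hZ.
have act0 (d : D) (t : T) : t.2.2 = 0 -> (t : T^c) *: d = 0.
  move=> t0; apply: (can_inj hK); rewrite hZ t0 scale0r.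
  by apply: (addIr (h 0)); rewrite -hD !add0r.
have D1 (d : D) x : d \ot ((x, 0) : W) = 0.
  have -> : (x, 0) = (((1, 0), (0, 0)) : T) *: ((x, 0) : W).
    by rewrite scaleW /= scale1r scale0r lgm0l lfm0l !addr0.
  exact/tmul_act0/act0.
have cover (d : D) (w : W) : d \ot w = d \ot ((0, w.2) : W).
  have {1}-> : w = (w.1, 0) + (0, w.2).
    by rewrite [RHS]surjective_pairing /= addr0 add0r; case: w.
  by rewrite tmulDr D1 add0r.
have [|||||||||Xi [XiS XiE Xi0]] := @tens_cover T B D C h hi (fun t => t.2.2)
  (fun b => ((0, 0), (0, b))) W Y (coker (lf Q)) (fun w => qf w.2) (fun y => (0, y))
  (fun w => w.2) qf hK hiK hD hZ; try by [].
- by move=> w w'; exact: (linearD qf w.2 w'.2).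
- by move=> t w; rewrite scaleW -[LHS]/(qf (lfm t.2.1 w.1 + t.2.2 *: w.2)) linearD qf_lfm add0r linearZ.
- by move=> x x'; rewrite [RHS]surjective_pairing /= addr0.
- by move=> a x; rewrite scaleW /= lgm0l scale0r addr0 lfm0l add0r.
- exact: qf_surj.
- move=> d x /qfE[s <-]; elim/tens_ind: s => [|s s' IHs IHs'|m x'].
  + by rewrite linear0; apply: tmul0r.
  + rewrite linearD (_ : (0, _) = (0, lf Q s) + (0, lf Q s') :> W).
      by rewrite tmulDr IHs IHs' addr0.
    by rewrite [RHS]surjective_pairing /= addr0.
  + have -> : (0, lf Q ((m : rmod M) \ot x')) = (((0, 0), (m, 0)) : T) *: ((x', 0) : W).
      by rewrite scaleW /= scale0r add0r scale0r addr0 lgm0l.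
    exact/tmul_act0/act0.
by exists Xi.
Qed.

Lemma actI_ex : exists g : {linear ltens I X -> X},
  forall (i : I) x, g ((i : rmod I) \ot x) = impsi_val i *: x.
Proof.
apply: (ltens_lift (b := fun (i : rmod I) (x : X) => impsi_val i *: x)).
  split=> [x i i'|i x x'|i a x]; first by rewrite impsi_valD scalerDl.
    by rewrite scalerDr.
  by rewrite scalerA.
by move=> a i x; rewrite scalerA.
Qed.
Definition actI := projT1 (cid actI_ex).
Lemma actIE (i : I) x : actI ((i : rmod I) \ot x) = impsi_val i *: x.
Proof. exact: (projT2 (cid actI_ex)). Qed.

Lemma actIP x : x \in IX <-> exists s, actI s = x.
Proof.
split=> [/asboolP[s ->]|[s <-]].
  exists (\sum_(p <- s) (p.1 : rmod I) \ot p.2 : ltens I X).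
  by rewrite linear_sum; apply: eq_bigr => p _; rewrite actIE.
elim/tens_ind: s => [|s t IHs IHt|i y].
- by rewrite linear0; apply: rpred0.
- by rewrite linearD; apply: rpredD.
- apply/asboolP; exists [:: (i, y)]; rewrite big_seq1; exact: actIE.
Qed.

(** f kills M (x) Im g, since f (m (x) g (n (x) y)) = phi (m (x) n) y = 0. *)
Lemma lf_ker (s : tens (rmod M) X) : tmapr qg s = 0 -> lf Q s = 0.
Proof.
move=> /(tmapr_exact qg_surj qgE)[s' <-].
elim/tens_ind: s' => [|s' t' IHs IHt|m t].
- by rewrite raddf0; apply: linear0.
- by rewrite raddfD -[LHS]/(lf Q ((tmapr _ s' : ltens M X) + tmapr _ t')) linearD IHs IHt addr0.
rewrite tmaprE; elim/tens_ind: t => [|u t IHs IHt|n y].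
- by rewrite linear0 tmul0r; apply: linear0.
- by rewrite linearD tmulDr -[LHS]/(lf Q ((_ \ot _ : ltens M X) + _ \ot _)) linearD IHs IHt addr0.
- by rewrite lfg [phim _ _ _]phi0 scale0r.
Qed.

(** g maps N (x) Im f to I X, since g (n (x) f (m (x) x)) = psi (n (x) m) x. *)
Lemma lg_ker (s : tens (rmod N) Y) : tmapr qf s = 0 -> lg Q s \in IX.
Proof.
move=> /(tmapr_exact qf_surj qfE)[s' <-].
elim/tens_ind: s' => [|s' t' IHs IHt|n t].
- by rewrite raddf0 -[lg Q _]/(lg Q (0 : ltens N Y)) linear0; apply: rpred0.
- rewrite raddfD -[lg Q _]/(lg Q ((tmapr _ s' : ltens N Y) + tmapr _ t')) linearD.
  exact: rpredD.
rewrite tmaprE; elim/tens_ind: t => [|u t IHs IHt|m x].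
- by rewrite linear0 tmul0r -[lg Q _]/(lg Q (0 : ltens N Y)) linear0; apply: rpred0.
- rewrite linearD tmulDr -[lg Q _]/(lg Q ((_ \ot _ : ltens N Y) + _ \ot _)) linearD.
  exact: rpredD.
have [i iE] := psim_impsi_val mc n m.
rewrite lgf -iE; apply/actIP; exists ((i : rmod I) \ot x); exact: actIE.
Qed.

(** I kills Im g because I N = 0. *)
Lemma actI_ker (s : tens (rmod I) X) : tmapr qg s = 0 -> actI s = 0.
Proof.
move=> /(tmapr_exact qg_surj qgE)[s' <-].
elim/tens_ind: s' => [|s' t' IHs IHt|i t].
- by rewrite raddf0; apply: linear0.
- by rewrite raddfD -[LHS]/(actI ((tmapr _ s' : ltens I X) + tmapr _ t')) linearD IHs IHt addr0.
rewrite tmaprE actIE -linearZ; elim/tens_ind: t => [|u t IHs IHt|n y].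
- by rewrite scaler0 linear0.
- rewrite [_ *: _](scalerDr (impsi_val i) (u : ltens N Y)) linearD IHs IHt; exact: addr0.
- by rewrite ltens_scaleE impsi_N // tmul0l; apply: linear0.
Qed.

(** The canonical surjections from the tensor products onto Im f, Im g / I X
    and I X are injective. *)
Definition canonical_inj : Prop :=
  [/\ forall s : ltens M X, lf Q s = 0 -> tmapr qg s = 0,
      forall s : ltens N Y, lg Q s \in IX -> tmapr qf s = 0
    & forall s : ltens I X, actI s = 0 -> tmapr qg s = 0].

(** The sources of the canonical surjections are finitely generated, so that an
    abstract isomorphism with the target makes them injective. *)
Lemma images_iso_canonical :
  left_noetherian A -> left_noetherian B -> fin_gen M -> fin_gen N -> fin_gen W ->
  images_iso_tensors Q <-> canonical_inj.
Proof.
move=> noethA noethB fgM fgN fgW.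
have [n [w wE]] := fgW.
have fgX : fin_gen (coker (lg Q)).
  exists n, (fun i => qg (w i).1) => z; have [x <-] := qg_surj z.
  have [c cE] := wE (x, 0); exists (fun i => (c i : T).1.1).
  have -> : x = \sum_i (c i *: w i).1.
    rewrite -[LHS]/((x, 0 : Y).1) cE; exact: (raddf_sum (fst : {additive W -> X})).
  rewrite linear_sum; apply: eq_bigr => i _.
  by rewrite scaleW -[LHS]/(qg (_ *: _ + _)) linearD qg_lgm addr0 linearZ.
have fgY : fin_gen (coker (lf Q)).
  exists n, (fun i => qf (w i).2) => z; have [y <-] := qf_surj z.
  have [c cE] := wE (0, y); exists (fun i => (c i : T).2.2).
  have -> : y = \sum_i (c i *: w i).2.
    rewrite -[LHS]/((0 : X, y).2) cE; exact: (raddf_sum (snd : {additive W -> Y})).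
  rewrite linear_sum; apply: eq_bigr => i _.
  by rewrite scaleW -[LHS]/(qf (_ + _ *: _)) linearD qf_lfm add0r linearZ.
have fgI : fin_gen I := noethA (impsi_pred mc).
have imP (R : pzRingType) (U V : lmodType R) (k : {linear U -> V}) v :
    v \in im_pred k <-> exists s, k s = v.
  by split=> [/asboolP//|kv]; apply/asboolP.
have i1 := image_iso (q := ltens_map M qg) noethB (fin_gen_ltens fgM fgX)
  (tmapr_surj qg_surj) (imP _ _ _ (lf Q)) lf_ker.
have i2 := image_quotient_iso (q := ltens_map N qf) (E := IX) noethA
  (fin_gen_ltens fgN fgY) (tmapr_surj qf_surj) (imP _ _ _ (lg Q)) lg_ker.
have i3 := image_iso (q := ltens_map I qg) noethA (fin_gen_ltens fgI fgX)
  (tmapr_surj qg_surj) actIP actI_ker.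
by split=> [[/i1 ? /i2 ? /i3 ?] | [/i1 ? /i2 ? /i3 ?]].
Qed.
Local Notation DI := (restr (cmorph pi) (mIr mc L)).
Local Notation DM := (restr (cmorph pi) (restr (cmorph pr1) (rmod UM))).
Local Notation DN := (restr (cmorph pi) (restr (cmorph pr2) (rmod UN))).
Local Notation DG := (restr (cmorph pi) (mGr M N L)).

(** On I, M and N the radical J acts as zero, so tensoring them with W over T
    depends only on one of the two cokernels. *)
Lemma coverI : exists Xi : {additive tens (rmod I) X -> tens DI W},
  [/\ surj Xi, forall (i : I) x, Xi ((i : rmod I) \ot x) = (i : DI) \ot ((x, 0) : W),
      forall s, Xi s = 0 <-> tmapr qg s = 0
    & forall (d : DI) (w : W), d \ot w = d \ot ((w.1, 0) : W)].
Proof.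
apply: (@cover_row1 DI (rmod I) id id) => // t v.
apply: impsi_val_inj; rewrite -[RHS]/(impsi_val v * t.1.1) (mul_rho_r phi0 trivext).
by case: t => [[a n] [m b]].
Qed.

Lemma coverM : exists Xi : {additive tens (rmod M) X -> tens DM W},
  [/\ surj Xi, forall (m : M) x, Xi ((m : rmod M) \ot x) = (m : DM) \ot ((x, 0) : W),
      forall s, Xi s = 0 <-> tmapr qg s = 0
    & forall (d : DM) (w : W), d \ot w = d \ot ((w.1, 0) : W)].
Proof.
apply: (@cover_row1 DM (rmod M) id id) => // t v.
rewrite -[RHS]/((v : M) <* t.1.1) (scale_rho_M phi0 trivext).
by case: t => [[a n] [m b]].
Qed.

Lemma coverN : exists Xi : {additive tens (rmod N) Y -> tens DN W},
  [/\ surj Xi, forall (n : N) y, Xi ((n : rmod N) \ot y) = (n : DN) \ot ((0, y) : W),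
      forall s, Xi s = 0 <-> tmapr qf s = 0
    & forall (d : DN) (w : W), d \ot w = d \ot ((0, w.2) : W)].
Proof.
exact: (@cover_row2 DN (rmod N) id id).
Qed.

Definition prM : {linear DG -> DM} := rlin (cmorph pi) fst.
Definition prN : {linear DG -> DN} := rlin (cmorph pi) snd.
Definition inM : {linear DM -> DG} := rlin (cmorph pi) (inl_lin _ _).
Definition inN : {linear DN -> DG} := rlin (cmorph pi) (inr_lin _ _).

Lemma DG_split (d : DG) : d = inM (prM d) + inN (prN d).
Proof.
case: d => [m n]; apply: esym.
rewrite -[LHS]/((m + 0, 0 + n) : restr (cmorph pr1) (rmod UM) * restr (cmorph pr2) (rmod UN)).
by rewrite addr0 add0r.
Qed.

Definition actW : {additive tens (regularr T) W -> W} := act W.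

(** The composite I (x) W -> J (x) W -> W is the action of I on X. *)
Lemma act_corner (s : ltens I X) (XiI : {additive tens (rmod I) X -> tens DI W}) :
  (forall (i : I) x, XiI ((i : rmod I) \ot x) = (i : DI) \ot ((x, 0) : W)) ->
  actW (tmapl jr (tmapl ir (XiI s))) = (actI s, 0).
Proof.
move=> XiE; elim/tens_ind: s => [|s t IHs IHt|i x].
- by rewrite !raddf0.
- rewrite !raddfD IHs IHt.
  by rewrite [LHS]surjective_pairing /= addr0.
rewrite XiE !tmaplE mirE /actW actE scaleW actIE /=.
by rewrite lgm0l lfm0l scale0r !addr0.
Qed.

(** An element of J (x) W acts on W, up to I X, through its components in
    M (x) Coker g and N (x) Coker f. *)
Lemma act_J (XiM : {additive tens (rmod M) X -> tens DM W})
    (XiN : {additive tens (rmod N) Y -> tens DN W}) :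
  (forall (m : M) x, XiM ((m : rmod M) \ot x) = (m : DM) \ot ((x, 0) : W)) ->
  (forall (d : DM) (w : W), d \ot w = d \ot ((w.1, 0) : W)) ->
  (forall (n : N) y, XiN ((n : rmod N) \ot y) = (n : DN) \ot ((0, y) : W)) ->
  (forall (d : DN) (w : W), d \ot w = d \ot ((0, w.2) : W)) ->
  forall t : tens (mJr phi0 trivext) W,
  exists (sM : ltens M X) (sN : ltens N Y),
  [/\ tmapl prM (tmapl qr t) = XiM sM, tmapl prN (tmapl qr t) = XiN sN,
      (actW (tmapl jr t)).2 = lf Q sM & (actW (tmapl jr t)).1 - lg Q sN \in IX].
Proof.
move=> XiME covM XiNE covN; elim/tens_ind => [|s t [sM [sN [s1 s2 s3 s4]]]
  [tM [tN [t1 t2 t3 t4]]]|j [x y]].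
- exists 0, 0; rewrite !raddf0; split=> //; rewrite addr0; exact: rpred0.
- exists (sM + tM), (sN + tN); split.
  + exact: etrans (raddfD (tmapl prM (W := W) \o tmapl qr (W := W)) s t)
      (etrans (congr2 +%R s1 t1) (esym (raddfD XiM sM tM))).
  + exact: etrans (raddfD (tmapl prN (W := W) \o tmapl qr (W := W)) s t)
      (etrans (congr2 +%R s2 t2) (esym (raddfD XiN sN tN))).
  + by rewrite !raddfD /= s3 t3.
  by rewrite !raddfD /= addrACA; apply: rpredD.
exists (((jr j : T).2.1 : rmod M) \ot x), (((jr j : T).1.2 : rmod N) \ot y); split.
- rewrite !tmaplE XiME; exact: covM.
- rewrite !tmaplE XiNE; exact: covN.
- rewrite tmaplE /actW actE scaleW -[LHS]/(lfm (jr j : T).2.1 x + (jr j : T).2.2 *: y).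
  by have [_ ->] := mjr0 j; rewrite scale0r addr0.
rewrite tmaplE /actW actE scaleW -[X in X - _]/((jr j : T).1.1 *: x + lgm (jr j : T).1.2 y).
rewrite addrK; have [/(rho0_sigma (trivext := trivext)) <- _] := mjr0 j.
apply/actIP; exists ((sigma trivext (jr j : T).1.1 : rmod I) \ot x); exact: actIE.
Qed.

(** The canonical maps are the graded parts of J (x) W -> W = T (x) W: its
    restriction to I (x) W is the action of I on X, and modulo I X it is f on
    M (x) Coker g and g on N (x) Coker f.  Injectivity of the graded parts is
    injectivity of this map together with that of I (x) W -> J (x) W. *)
Lemma canonical_tor :
  canonical_inj <-> injective (tmapl jr (W := W)) /\ injective (tmapl ir (W := W)).
Proof.
have [XiI [XiIS XiIE XiI0 _]] := coverI.
have [XiM [XiMS XiME XiM0 covM]] := coverM.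
have [XiN [XiNS XiNE XiN0 covN]] := coverN.
have actC (s : ltens I X) := act_corner s XiIE.
have aJ := act_J XiME covM XiNE covN.
have [_ qrS qrE] := mirP phi0 trivext.
split=> [[P1 P2 P3]|[jI iI]].
  have act0 (s : tens DI W) : actW (tmapl jr (tmapl ir s)) = 0 -> s = 0.
    have [u <-] := XiIS s; rewrite (actC u) => -[u0].
    by apply/XiI0/P3.
  split; last by apply: inj_ker0 => s s0; apply: act0; rewrite s0 !raddf0.
  apply: inj_ker0 => t t0; have [sM [sN [tM tN]]] := aJ t.
  rewrite t0 raddf0 sub0r rpredN => /esym/P1/XiM0 M0 /P2/XiN0 N0.
  have /(tmapl_exact qrS qrE)[s st] : tmapl qr t = 0.
    by apply: (tens_split0 DG_split); [apply: etrans tM M0 | apply: etrans tN N0].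
  by rewrite -st (act0 s) ?raddf0 // st t0 raddf0.
have jirI s : actW (tmapl jr (tmapl ir s)) = 0 -> s = 0.
  rewrite -(raddf0 actW) => /(bij_inj (act_bij W)).
  by rewrite -(raddf0 (tmapl jr (W := W))) => /jI; rewrite -(raddf0 (tmapl ir (W := W))) => /iI.
have pMM (u : tens DM W) : tmapl prM (tmapl inM u) = u by rewrite tmapl_comp tmapl_id.
have pMN (u : tens DN W) : tmapl prM (tmapl inN u) = 0 by rewrite tmapl_comp tmapl0.
have pNM (u : tens DM W) : tmapl prN (tmapl inM u) = 0 by rewrite tmapl_comp tmapl0.
have pNN (u : tens DN W) : tmapl prN (tmapl inN u) = u by rewrite tmapl_comp tmapl_id.
(* Lift the pair (sM, sN) to an element t of J (x) W.  If f sM = 0 and g sN lies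
   in I X, then t acts like an element of I (x) W, hence is one. *)
have PMN (sM : ltens M X) (sN : ltens N Y) :
    lf Q sM = 0 -> lg Q sN \in IX -> tmapr qg sM = 0 /\ tmapr qf sN = 0.
  move=> fM gN; have [t tE] := tmapl_surj qrS (tmapl inM (XiM sM) + tmapl inN (XiN sN)).
  have tM : tmapl prM (tmapl qr t) = XiM sM.
    rewrite tE.
    apply: etrans (raddfD (tmapl prM (W := W)) _ _) _.
    exact: etrans (congr2 +%R (pMM _) (pMN _)) (addr0 _).
  have tN : tmapl prN (tmapl qr t) = XiN sN.
    rewrite tE.
    apply: etrans (raddfD (tmapl prN (W := W)) _ _) _.
    exact: etrans (congr2 +%R (pNM _) (pNN _)) (add0r _).
  have [uM [uN []]] := aJ t; rewrite tM tN => uME uNE a2 a1.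
  have uM0 : lf Q uM = 0.
    have := lf_ker (s := uM - sM); rewrite -[lf Q (uM - sM)]/(lf Q ((uM : ltens M X) - sM)).
    rewrite linearB fM subr0; apply; apply/XiM0.
    by rewrite raddfB -uME subrr.
  have uN0 : lg Q uN \in IX.
    have := lg_ker (s := uN - sN); rewrite -[lg Q (uN - sN)]/(lg Q ((uN : ltens N Y) - sN)).
    rewrite linearB rpredBr //; apply; apply/XiN0.
    by rewrite raddfB -uNE subrr.
  have /actIP[s sE] : (actW (tmapl jr t)).1 \in IX.
    by rewrite -(subrK (lg Q uN) (actW _).1); apply: rpredD.
  have tI : t = tmapl ir (XiI s).
    apply: jI; apply: (bij_inj (act_bij W)); apply: etrans (esym (actC s)).
    by rewrite sE -uM0 -a2 -surjective_pairing.
  have qt0 : tmapl qr t = 0.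
    by rewrite tI tmapl_comp tmapl0 // => d; apply/qrE; exists d.
  by split; [apply/XiM0; rewrite -tM | apply/XiN0; rewrite -tN]; rewrite qt0 raddf0.
split=> s s0.
- by have [] := PMN s 0 s0; rewrite ?linear0 ?rpred0.
- by have [] := PMN 0 s _ s0; rewrite ?linear0.
- by apply/XiI0/jirI; rewrite actC s0.
Qed.
End Bridge.

Section Conditions.
Variables (A B : pzRingType) (M : bimodType B A) (N : bimodType A B).
Variables (mc : moritaContext M N) (S : pred A) (L : subPzRingType S).
Hypothesis phi0 : forall t, phi mc t = 0.
Hypothesis trivext : trivial_extension mc L.
Hypotheses (noethA : left_noetherian A) (noethB : left_noetherian B).
Hypotheses (fgM : fin_gen M) (fgN : fin_gen N).

Lemma conditions_strong (Q : lquad mc) : fin_gen (lquad_mod Q) ->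
  cokers_gorenstein_projective L Q /\ images_iso_tensors Q <->
  strong (moritaExt phi0 trivext) (lquad_mod Q).
Proof.
move=> fgQ; have cE := cokers_gp phi0 trivext Q.
have iE := images_iso_canonical phi0 noethA noethB fgM fgN fgQ.
have tE := canonical_tor phi0 trivext Q.
split=> [[/cE gQ /iE/tE[jI iI]]|[[/cE gQ jI] iI]] //.
by split=> //; apply/iE/tE.
Qed.
End Conditions.

(** * Modules over the Morita context ring as quadruples *)

Section Corner.
Variables (T R : pzRingType) (h : {additive R -> T}) (W : lmodType T).

Definition corner_pred : {pred W} := fun w => h 1 *: w == w.
Fact corner_closed : zmod_closed corner_pred.
Proof.
split=> [|u v]; rewrite !unfold_in ?scaler0 // => /eqP hu /eqP hv.
by rewrite scalerBr hu hv.
Qed.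
HB.instance Definition _ := GRing.isZmodClosed.Build W corner_pred corner_closed.

Record corner_mod : Type :=
  CornerMod { corner_val : W; corner_valP : corner_pred corner_val }.
HB.instance Definition _ := [isSub for @corner_val].
HB.instance Definition _ := [Choice of corner_mod by <:].
HB.instance Definition _ := [SubChoice_isSubZmodule of corner_mod by <:].

(** The corner e W cut out by the idempotent e = h 1 is a module over R. *)
Lemma corner_ex : (forall r s, h (r * s) = h r * h s) ->
  exists (X : lmodType R) (v : {additive X -> W}),
  [/\ injective v, forall r x, v (r *: x) = h r *: v x
    & forall w, (exists x, v x = w) <-> h 1 *: w = w].
Proof.
move=> hM.
have sP (r : R) (x : corner_mod) : corner_pred (h r *: corner_val x).
  by apply/eqP; rewrite scalerA -hM mul1r.
pose scale r x := CornerMod (sP r x).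
have sA r s x : scale r (scale s x) = scale (r * s) x.
  by apply: val_inj; rewrite /= scalerA hM.
have s1 : left_id 1 scale.
  by move=> x; apply: val_inj; apply/eqP/(corner_valP x).
have sDr : right_distributive scale +%R.
  by move=> r x y; apply: val_inj; exact: scalerDr.
have sDl x : {morph scale^~ x : r s / r + s}.
  by move=> r s; apply: val_inj; rewrite /= raddfD; exact: scalerDl.
pose X : lmodType R :=
  HB.pack corner_mod (GRing.Zmodule_isLmodule.Build R corner_mod sA s1 sDr sDl).
exists X, (val : {additive corner_mod -> W}); split=> // [|w]; first exact: val_inj.
split=> [[x <-]|hw]; first by apply/eqP/(corner_valP x).
have wP : corner_pred w by apply/eqP.
by exists (CornerMod wP).
Qed.
End Corner.

Section QuadOfModule.
Variables (A B : pzRingType) (M : bimodType B A) (N : bimodType A B).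
Variable mc : moritaContext M N.
Local Notation T := (mring mc).

Definition atA (a : A) : T := ((a, 0), (0, 0)).
Definition atN (n : N) : T := ((0, n), (0, 0)).
Definition atM (m : M) : T := ((0, 0), (m, 0)).
Definition atB (b : B) : T := ((0, 0), (0, b)).

Local Definition zeros := (@psim0l A B M N mc, @psim0r A B M N mc, @phim0l A B M N mc,
  @phim0r A B M N mc, rscale0l, rscale0r, @scaler0, @scale0r, mulr0, mul0r, addr0, add0r).

Fact atAD : {morph atA : x y / x + y}.
Proof. by move=> x y; congr ((_, _), (_, _)); rewrite ?addr0. Qed.
Fact atND : {morph atN : x y / x + y}.
Proof. by move=> x y; congr ((_, _), (_, _)); rewrite ?addr0. Qed.
Fact atMD : {morph atM : x y / x + y}.
Proof. by move=> x y; congr ((_, _), (_, _)); rewrite ?addr0. Qed.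
Fact atBD : {morph atB : x y / x + y}.
Proof. by move=> x y; congr ((_, _), (_, _)); rewrite ?addr0. Qed.

Fact atA_M a a' : atA (a * a') = atA a * atA a'.
Proof. by rewrite -[RHS]/(mring_mul _ _) /= !zeros. Qed.
Fact atB_M b b' : atB (b * b') = atB b * atB b'.
Proof. by rewrite -[RHS]/(mring_mul _ _) /= !zeros. Qed.
Fact atA_N a n : atN (a *: n) = atA a * atN n.
Proof. by rewrite -[RHS]/(mring_mul _ _) /= !zeros. Qed.
Fact atN_B n b : atN (n <* b) = atN n * atB b.
Proof. by rewrite -[RHS]/(mring_mul _ _) /= !zeros. Qed.
Fact atB_M' b m : atM (b *: m) = atB b * atM m.
Proof. by rewrite -[RHS]/(mring_mul _ _) /= !zeros. Qed.
Fact atM_A m a : atM (m <* a) = atM m * atA a.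
Proof. by rewrite -[RHS]/(mring_mul _ _) /= !zeros. Qed.
Fact atN_M n m : atA (psim mc n m) = atN n * atM m.
Proof. by rewrite -[RHS]/(mring_mul _ _) /= !zeros. Qed.
Fact atM_N m n : atB (phim mc m n) = atM m * atN n.
Proof. by rewrite -[RHS]/(mring_mul _ _) /= !zeros. Qed.
Fact mul_at1 (t : T) : t * atA 1 = atA t.1.1 + atM t.2.1.
Proof.
case: t => [[a n] [m b]]; rewrite -[LHS]/(mring_mul _ _) /= !zeros mulr1 rscaler1.
by congr ((_, _), (_, _)); rewrite ?addr0 ?add0r.
Qed.
Fact mul_at2 (t : T) : t * atB 1 = atN t.1.2 + atB t.2.2.
Proof.
case: t => [[a n] [m b]]; rewrite -[LHS]/(mring_mul _ _) /= !zeros mulr1 rscaler1.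
by congr ((_, _), (_, _)); rewrite ?addr0 ?add0r.
Qed.
Fact at_one : atA 1 + atB 1 = 1.
Proof. by congr ((_, _), (_, _)); rewrite ?addr0 ?add0r. Qed.

(** Every module over the matrix ring is given by a quadruple: its components
    are the images of the two diagonal idempotents. *)
Lemma quad_ex (W : lmodType T) : exists Q : lquad mc, lin_iso (lquad_mod Q) W.
Proof.
have [X [vX [vXI vXZ vXE]]] := @corner_ex T A (add_of atAD) W atA_M.
have [Y [vY [vYI vYZ vYE]]] := @corner_ex T B (add_of atBD) W atB_M.
rewrite /= in vXZ vXE vYZ vYE.
have fX x : atA 1 *: vX x = vX x by apply/vXE; exists x.
have fY y : atB 1 *: vY y = vY y by apply/vYE; exists y.
have [f0 f0E] := choice (fun p : M * X => (vYE (atM p.1 *: vX p.2)).2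
  (etrans (scalerA _ _ _) (congr1 (fun t : T => t *: vX p.2)
    (etrans (esym (atB_M' 1 p.1)) (congr1 atM (scale1r p.1)))))).
have [g0 g0E] := choice (fun p : N * Y => (vXE (atN p.1 *: vY p.2)).2
  (etrans (scalerA _ _ _) (congr1 (fun t : T => t *: vY p.2)
    (etrans (esym (atA_N 1 p.1)) (congr1 atN (scale1r p.1)))))).
have [||f fE] := ltens_lift (M := M) (b := fun (m : rmod M) (x : X) => f0 (m, x)).
- split=> [x m m'|m x x'|m a x]; apply: vYI.
  + by rewrite raddfD !f0E /= atMD scalerDl.
  + by rewrite raddfD !f0E /= raddfD scalerDr.
  + by rewrite !f0E /= vXZ scalerA -atM_A.
- by move=> b m x; apply: vYI; rewrite vYZ !f0E /= atB_M' scalerA.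
have [||g gE] := ltens_lift (M := N) (b := fun (n : rmod N) (y : Y) => g0 (n, y)).
- split=> [x m m'|m x x'|m a x]; apply: vXI.
  + by rewrite raddfD !g0E /= atND scalerDl.
  + by rewrite raddfD !g0E /= raddfD scalerDr.
  + by rewrite !g0E /= vYZ scalerA -atN_B.
- by move=> b m x; apply: vXI; rewrite vXZ !g0E /= atA_N scalerA.
have gf n m x : g ((n : rmod N) \ot f ((m : rmod M) \ot x)) = psim mc n m *: x.
  by apply: vXI; rewrite gE fE g0E /= f0E vXZ atN_M scalerA.
have fg m n y : f ((m : rmod M) \ot g ((n : rmod N) \ot y)) = phim mc m n *: y.
  by apply: vYI; rewrite fE gE f0E /= g0E vYZ atM_N scalerA.
pose Q := LQuad gf fg; exists Q.
have L : linear (fun w : lquad_mod Q => vX w.1 + vY w.2).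
  move=> t w w'; rewrite scaleW -[LHS]/(vX (t.1.1 *: w.1 + lgm t.1.2 w.2 + w'.1)
    + vY (lfm t.2.1 w.1 + t.2.2 *: w.2 + w'.2)).
  rewrite !raddfD addrACA; congr (_ + _).
  rewrite vXZ vYZ /lgm /lfm /= gE fE g0E f0E /= -[in RHS]fX -[in RHS]fY !scalerA.
  by rewrite mul_at1 mul_at2 !scalerDl addrACA.
exists (lin_of L); apply: inj_surj_bij => [|w].
  apply: inj_lker0 => -[x y]; rewrite -[lin_of L _]/(vX x + vY y) => e.
  have xy (r : T) : r *: vX x = - (r *: vY y).
    by apply/eqP; rewrite -addr_eq0 -scalerDr e scaler0.
  have x0 : vX x = 0.
    rewrite -fX xy -fY scalerA mul_at2 /= /atA /atN /atB /=.
    by rewrite (_ : _ + _ = 0 :> T) ?scale0r ?oppr0 //; congr ((_, _), (_, _)); apply: addr0.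
  have y0 : vY y = 0 by move: e; rewrite x0 add0r.
  by congr (_, _); [apply: vXI | apply: vYI]; rewrite raddf0.
have /vXE[x xE] : atA 1 *: (atA 1 *: w) = atA 1 *: w.
  by rewrite scalerA -atA_M mulr1.
have /vYE[y yE] : atB 1 *: (atB 1 *: w) = atB 1 *: w.
  by rewrite scalerA -atB_M mulr1.
by exists (x, y); rewrite /= xE yE -scalerDl at_one scale1r.
Qed.
End QuadOfModule.

Theorem theorem1p1 (A B : pzRingType) (M : bimodType B A) (N : bimodType A B)
    (mc : moritaContext M N) (S : pred A) (L : subPzRingType S)
    (phi0 : forall t, phi mc t = 0)
    (noethA : noetherian A) (noethB : noetherian B)
    (fgM_left : fin_gen M) (fgM_right : fin_gen (rmod M))
    (fgN_left : fin_gen N) (fgN_right : fin_gen (rmod N))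
    (trivext : trivial_extension mc L) :
  ( [/\ weakly_compatible (restrl (subring_incl L) N),
        weakly_compatible (restrr (subring_incl L) M)
      & weakly_compatible
          (restrl (subring_incl L) (restrr (subring_incl L) (impsi mc)))] /\
    [/\ semi_weakly_compatible (lquad_mod (lquad_N phi0)),
        semi_weakly_compatible (lquad_mod (lquad_I phi0)),
        semi_weakly_compatible_r (rquad_mod (rquad_M phi0))
      & semi_weakly_compatible_r (rquad_mod (rquad_I phi0))]
    <->
    forall Q : lquad mc, fin_gen (lquad_mod Q) ->
      (gorenstein_projective (lquad_mod Q) <->
       cokers_gorenstein_projective L Q /\ images_iso_tensors Q) )
  /\
  ( weakly_compatible (restrl (subring_incl L) N) ->
    weakly_compatible (restrr (subring_incl L) M) ->
    weakly_compatible
      (restrl (subring_incl L) (restrr (subring_incl L) (impsi mc))) ->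
    forall Q : lquad mc, fin_gen (lquad_mod Q) ->
      cokers_gorenstein_projective L Q -> images_iso_tensors Q ->
      gorenstein_projective (lquad_mod Q) ).
Proof.
have condP Q := conditions_strong phi0 trivext noethA.1 noethB.1 fgM_left fgN_left (Q := Q).
pose E := moritaExt phi0 trivext.
split; last first.
  move=> cN cM cI Q fgQ cG iQ.
  have cE : ext_compatible E by apply/moritaExt_compatible.
  by have [gQ _] := (condP Q fgQ).1 (conj cG iQ); apply: gp_of_good cE _ gQ.
apply: iff_trans (compatible_conditions phi0 trivext) _.
split=> [[cE qE] Q fgQ|H].
  apply: iff_trans _ (iff_sym (condP Q fgQ)).
  by split=> [|[gQ _]]; [exact: strong_of_gp cE qE _ | exact: gp_of_good cE _ gQ].
have strongP (W : lmodType (mring mc)) : fin_gen W ->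
    (gorenstein_projective W <-> strong E W).
  move=> fgW; have [Q QW] := quad_ex W; have WQ := lin_iso_sym QW.
  have fgQ : fin_gen (lquad_mod Q).
    have [h /bij_inv_linear[g [hK gK]]] := WQ.
    by apply: fin_gen_surj fgW => q; exists (g q); apply: gK.
  have HQ := iff_trans (H Q fgQ) (condP Q fgQ).
  by split=> [/(gp_iso WQ)/HQ|/(strong_iso WQ)/HQ];
    [exact: strong_iso QW | exact: gp_iso QW].
by split; [exact: compatible_of_strong strongP | exact: quotient_exact_of_strong strongP].
Qed.
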